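(* Let $0<\gamma<\infty$, $a\in(0,\infty)\setminus\{1\}$ and $s>0$. Then the global maximal function inequality $$\Big\|\sup_{n\ge1}|S^af(\cdot,n^{-\gamma})|\Big\|_{L^2(\mathbb{R})}\le C\|f\|_{H^s}$$ holds for some $C>0$ and all $f\in H^s(\mathbb{R})$ if and only if $s\ge\frac{a}{2\gamma+4}$.
   Context: The Fourier transform is $\widehat f(\xi)=\int_{\mathbb{R}}f(x)e^{-ix\xi}\,dx$. The Sobolev space $H^s=H^s(\mathbb{R})$ consists of all distributions $f$ with $\|f\|_{H^s}:=\big(\int(1+|\xi|^2)^s|\widehat f(\xi)|^2\,d\xi\big)^{1/2}<\infty$. For $a>0$ the generalized Schrödinger means are $$S^af(x,t)=\int_{\mathbb{R}}e^{i(x\xi+t|\xi|^a)}\widehat f(\xi)\,\frac{d\xi}{2\pi}$$ for Schwartz functions $f$; for fixed $t$ the operator $f\mapsto S^af(\cdot,t)$ extends to all $f\in H^s$ (as the Fourier multiplier operator with multiplier $e^{it|\xi|^a}$). *)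

(* Defs.v *)
From HB Require Import structures.
From mathcomp Require Export all_boot all_order all_algebra.
From mathcomp Require Export all_classical all_reals all_analysis.
From mathcomp Require Export complex.

Set Implicit Arguments.
Unset Strict Implicit.
Unset Printing Implicit Defensive.
Import Order.TTheory GRing.Theory Num.Theory.
Import numFieldNormedType.Exports.

Local Open Scope classical_set_scope.
Local Open Scope complex_scope.
Local Open Scope ring_scope.

Section ComplexFunctions.
Context {R : realType}.
Local Notation mu := (@lebesgue_measure R).
Implicit Types (f g : R -> R[i]).

Definition re f (x : R) : R := complex.Re (f x).
Definition im f (x : R) : R := complex.Im (f x).

(* The norm `|z| of R[i] is R[i]-valued; this is the R-valued modulus. *)
Definition modulus (z : R[i]) : R := Normc.normc z.

Definition cis (theta : R) : R[i] := @Complex R (cos theta) (sin theta).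

Definition cmeasurable f : Prop :=
  measurable_fun [set: R] (re f) /\ measurable_fun [set: R] (im f).

Definition cintegrable f : Prop :=
  mu.-integrable [set: R] (EFin \o re f) /\
  mu.-integrable [set: R] (EFin \o im f).

Definition cintegral f : R[i] :=
  @Complex R (\int[mu]_x re f x) (\int[mu]_x im f x).

Definition cderiven (n : nat) f (x : R) : R[i] :=
  @Complex R ((re f)^`(n)%classic x) ((im f)^`(n)%classic x).

Definition csmooth f : Prop :=
  forall (n : nat) (x : R),
    derivable (re f)^`(n)%classic x 1 /\ derivable (im f)^`(n)%classic x 1.

Definition fourier f (xi : R) : R[i] :=
  cintegral (fun x => f x * cis (- (x * xi))).

End ComplexFunctions.

Section TemperedDistributions.
Context {R : realType}.
Implicit Types (f g u phi psi : R -> R[i]).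

Definition weighted_deriv (j k : nat) phi (x : R) : R :=
  `|x| ^+ j * modulus (cderiven k phi x).

Definition schwartz phi : Prop :=
  csmooth phi /\
  forall j k : nat, has_ubound (range (weighted_deriv j k phi)).

Definition schwartz_seminorm (j k : nat) phi : R :=
  sup (range (weighted_deriv j k phi)).

(* A distribution is a functional on all functions R -> R[i], of which only
   the values at Schwartz functions are ever used. *)
Definition schwartz_functional : Type := (R -> R[i]) -> R[i].

Definition tempered (T : schwartz_functional) : Prop :=
  (forall (c : R[i]) phi psi, schwartz phi -> schwartz psi ->
     T (fun x => c * phi x + psi x) = c * T phi + T psi) /\
  (exists (N : nat) (C : R), forall phi, schwartz phi ->
     modulus (T phi) <=
       C * \sum_(j < N.+1) \sum_(k < N.+1) schwartz_seminorm j k phi).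

Definition fourier_dist (T : schwartz_functional) : schwartz_functional :=
  fun phi => T (fourier phi).

Definition dist_of_fun g : schwartz_functional :=
  fun phi => cintegral (fun x => g x * phi x).

Definition represented_by (T : schwartz_functional) g : Prop :=
  cmeasurable g /\
  forall phi, schwartz phi ->
    cintegrable (fun x => g x * phi x) /\ T phi = dist_of_fun g phi.

(* The Fourier transform of T is the function g (which is then unique up to
   equality almost everywhere). *)
Definition has_fourier (T : schwartz_functional) g : Prop :=
  represented_by (fourier_dist T) g.

End TemperedDistributions.

Section Schrodinger.
Context {R : realType}.
Local Notation mu := (@lebesgue_measure R).
Implicit Types (f : @schwartz_functional R) (fhat u : R -> R[i]).

(* The H^s norm of a distribution, in terms of its Fourier transform. *)
Definition sobolev_norm (s : R) fhat : \bar R :=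
  ((\int[mu]_xi (((1 + `|xi| ^+ 2) `^ s) * modulus (fhat xi) ^+ 2)%:E)
    `^ 2^-1)%E.

(* f belongs to H^s and fhat is its Fourier transform. *)
Definition in_sobolev (s : R) f fhat : Prop :=
  [/\ tempered f, has_fourier f fhat & (sobolev_norm s fhat < +oo)%E].

(* u is (a representative of) S^a f(., t), the image of f under the Fourier
   multiplier operator with multiplier exp(i t |xi|^a). *)
Definition schrodinger_mean (a t : R) f u : Prop :=
  [/\ tempered (dist_of_fun u),
      represented_by (dist_of_fun u) u
    & exists2 fhat, has_fourier f fhat &
        has_fourier (dist_of_fun u)
          (fun xi => cis (t * `|xi| `^ a) * fhat xi)].

Definition maximal_fun (u : nat -> R -> R[i]) (x : R) : \bar R :=
  ereal_sup [set (modulus (u n x))%:E | n in [set n : nat | (1 <= n)%N]].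

End Schrodinger.

(* Main.v *)
(* Sufficiency.  Write [om = |xi|^a] and let [2^j <= n < 2^(j+1)].  On the frequencies
   [om <= 2^(j gamma)] the phase [n^(-gamma) om] varies by at most one in the block, so the
   maximal function is controlled by telescoping in time and Cauchy-Schwarz.  For
   [om > 2^(j (gamma + 2))] the supremum is replaced by an l2 sum over the [2^j] times.  For the
   frequencies in between, the linearised operator is bounded by [T T^*]: the kernel
   [K(x, t)] of a dyadic shell at frequency [lam] satisfies [|K(x, t)| <= C lam / sqrt (lam |x|)]
   for all [t] (van der Corput), and decays faster for [|x|] large compared with
   [t lam^(a-1)], so that its supremum over [lam^a |t| <= M] has an integral of size [sqrt M];
   the shells are then summed inside a single application of Schur's test, which gives the
   factor [2^j].  In each of the three ranges the sum over [j] is at most a constant times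
   [1 + om^(1 / (gamma + 2)) + |xi|^(2 s)], pointwise in [xi], and
   [om^(1 / (gamma + 2)) = |xi|^(a / (gamma + 2))].  General data are reached by smoothing
   [S^a f] with Gaussians, which are images of Gaussian cut-offs under the Fourier transform,
   and by Fatou's lemma.

   Necessity.  Take [fhat] to be the indicator of [[lam, lam + rho]] with
   [lam^a = N^(gamma + 2)] and [rho] a small multiple of [lam / N].  For [N < n <= 2 N] the
   packet at time [n^(-gamma)] has modulus comparable to [rho] at distance at most a small
   multiple of [1 / rho] from [- a n^(-gamma) lam^(a - 1)], and these [N] neighbourhoods are
   disjoint.  The maximal inequality thus yields [N <= K lam^(2 s)] for all [N]. *)

(* The endpoint [s = a / (2 gamma + 4)] is included, so no logarithm may be lost when the dyadic
   blocks of times are put together. Every estimate therefore bounds the integral of a squared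
   supremum by the integral of [|fhat|^2] against an explicit weight: the squares of the blocks are
   added, and only the weights have to be summed, for one frequency at a time. The critical weights
   decay geometrically in [j] on both sides of the index where [2^(j (gamma + 2))] meets [om]. Each
   block controls only the difference from the mean at time 0, because low frequencies would
   otherwise contribute a fixed amount to every block. The price is the number of blocks with
   [2^(j gamma) < om], of order [log om], which is absorbed because [s > 0]. Curvature, that is
   [a != 1], enters through the van der Corput estimate, whose bound does not involve the time and
   so survives a choice of time that depends on the point. Schur's test with a Gaussian weight also
   gives the Bessel inequality that takes the place of Plancherel's theorem. *)
Require Import Defs.
From mathcomp Require Import ring lra zify measurable_realfun.
Import Order.TTheory GRing.Theory Num.Theory.
Import numFieldNormedType.Exports.
Local Open Scope classical_set_scope.
Local Open Scope complex_scope.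
Local Open Scope ring_scope.
Set Implicit Arguments.
Unset Strict Implicit.
Unset Printing Implicit Defensive.

(** * Complex-valued integrals *)

Section Modulus.
Context {R : realType}.
Implicit Types (z w : R[i]) (r s : R).

Lemma modulus_ge0 z : 0 <= modulus z.
Proof. by case: z => a b; exact: sqrtr_ge0. Qed.

Lemma modulusM z w : modulus (z * w) = modulus z * modulus w.
Proof. exact: Normc.normcM. Qed.

Lemma modulusD z w : modulus (z + w) <= modulus z + modulus w.
Proof. exact: le_normcD. Qed.

Lemma modulusN z : modulus (- z) = modulus z.
Proof. exact: normcN. Qed.

Lemma modulus0 : modulus (0 : R[i]) = 0.
Proof. exact: Normc.normc0. Qed.

Lemma sqr_modulus z : modulus z ^+ 2 = complex.Re z ^+ 2 + complex.Im z ^+ 2.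
Proof. by case: z => a b; rewrite /modulus/= sqr_sqrtr// addr_ge0// sqr_ge0. Qed.

Lemma modulus_cis r : modulus (cis r) = 1.
Proof. by rewrite /modulus/= cos2Dsin2 sqrtr1. Qed.

Lemma modulus_conjc z : modulus (conjc z) = modulus z.
Proof. by case: z => a b; rewrite /modulus/= sqrrN. Qed.

Lemma modulus_real r : modulus r%:C = `|r|.
Proof. by rewrite /modulus/= expr0n/= addr0 sqrtr_sqr. Qed.

Lemma le_modulus z r : 0 <= r -> complex.Re z ^+ 2 + complex.Im z ^+ 2 <= r ^+ 2 ->
  modulus z <= r.
Proof.
move=> r0 h; rewrite -(@ler_pXn2r _ 2)// ?nnegrE// ?modulus_ge0//.
by rewrite sqr_modulus.
Qed.

Lemma Re_le_modulus z : `|complex.Re z| <= modulus z.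
Proof.
rewrite -(@ler_pXn2r _ 2)// ?nnegrE ?normr_ge0// ?modulus_ge0//.
by rewrite real_normK ?num_real// sqr_modulus lerDl sqr_ge0.
Qed.

Lemma Im_le_modulus z : `|complex.Im z| <= modulus z.
Proof.
rewrite -(@ler_pXn2r _ 2)// ?nnegrE ?normr_ge0// ?modulus_ge0//.
by rewrite real_normK ?num_real// sqr_modulus lerDr sqr_ge0.
Qed.

Lemma modulus_le_ReIm z : modulus z <= `|complex.Re z| + `|complex.Im z|.
Proof.
apply: le_modulus; first by rewrite addr_ge0.
rewrite -(real_normK (num_real (complex.Re z))) -(real_normK (num_real (complex.Im z))).
have := normr_ge0 (complex.Re z); have := normr_ge0 (complex.Im z).
by nra.
Qed.

Lemma cisD r s : cis (r + s) = cis r * cis s.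
Proof.
rewrite /cis cosD sinD; simpc; congr Complex.
by rewrite addrC; congr (_ + _); ring.
Qed.

Lemma conjc_cis r : conjc (cis r) = cis (- r).
Proof. by rewrite /cis/= cosN sinN. Qed.

Lemma cis0 : cis 0 = 1 :> R[i].
Proof. by rewrite /cis cos0 sin0. Qed.

Lemma mulc_conjc z : z * conjc z = (modulus z ^+ 2)%:C.
Proof. by case: z => a b; rewrite sqr_modulus/=; simpc; congr Complex; ring. Qed.

Lemma real_complexM r s : (r * s)%:C = r%:C * s%:C :> R[i].
Proof. exact: rmorphM. Qed.

Lemma real_complexD r s : (r + s)%:C = r%:C + s%:C :> R[i].
Proof. exact: rmorphD. Qed.

Lemma cReD z w : complex.Re (z + w) = complex.Re z + complex.Re w.
Proof. by case: z; case: w. Qed.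
Lemma cImD z w : complex.Im (z + w) = complex.Im z + complex.Im w.
Proof. by case: z; case: w. Qed.
Lemma cReN z : complex.Re (- z) = - complex.Re z.
Proof. by case: z. Qed.
Lemma cImN z : complex.Im (- z) = - complex.Im z.
Proof. by case: z. Qed.
Lemma cReM z w : complex.Re (z * w) =
  complex.Re z * complex.Re w - complex.Im z * complex.Im w.
Proof. by case: z; case: w. Qed.
Lemma cImM z w : complex.Im (z * w) =
  complex.Re z * complex.Im w + complex.Im z * complex.Re w.
Proof. by case: z; case: w. Qed.

End Modulus.

Section ComplexMeasurable.
Context {R : realType} {d : measure_display} {T : measurableType d}.
Implicit Types (f g : T -> R[i]) (h : T -> R).

Definition cmeas f : Prop :=
  measurable_fun setT (fun x => complex.Re (f x)) /\
  measurable_fun setT (fun x => complex.Im (f x)).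

Lemma cmeasD f g : cmeas f -> cmeas g -> cmeas (fun x => f x + g x).
Proof.
move=> [f1 f2] [g1 g2]; split.
  under eq_fun do rewrite cReD; exact: measurable_funD.
under eq_fun do rewrite cImD; exact: measurable_funD.
Qed.

Lemma cmeasN f : cmeas f -> cmeas (fun x => - f x).
Proof.
move=> [f1 f2]; split.
  under eq_fun do rewrite cReN; exact: measurableT_comp.
under eq_fun do rewrite cImN; exact: measurableT_comp.
Qed.

Lemma cmeasM f g : cmeas f -> cmeas g -> cmeas (fun x => f x * g x).
Proof.
move=> [f1 f2] [g1 g2]; split.
  under eq_fun do rewrite cReM.
  by apply: measurable_funB; exact: measurable_funM.
under eq_fun do rewrite cImM.
by apply: measurable_funD; exact: measurable_funM.
Qed.

Lemma cmeas_conjc f : cmeas f -> cmeas (fun x => conjc (f x)).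
Proof.
move=> [f1 f2]; split.
  by apply: eq_measurable_fun f1 => x _; case: (f x).
apply: (@eq_measurable_fun _ _ _ _ _ (fun x => - complex.Im (f x))) => [x _|].
  by case: (f x).
exact: measurableT_comp.
Qed.

Lemma cmeas_cst (c : R[i]) : cmeas (fun=> c).
Proof. by split; exact: measurable_cst. Qed.

Lemma cmeas_cis h : measurable_fun setT h -> cmeas (fun x => cis (h x)).
Proof.
move=> mh; split; rewrite /cis/=.
  by apply: measurableT_comp => //; apply: continuous_measurable_fun; exact: continuous_cos.
by apply: measurableT_comp => //; apply: continuous_measurable_fun; exact: continuous_sin.
Qed.

Lemma cmeas_real h : measurable_fun setT h -> cmeas (fun x => (h x)%:C).
Proof. by move=> mh; split => //=; exact: measurable_cst. Qed.

Lemma measurable_modulus f : cmeas f -> measurable_fun setT (fun x => modulus (f x)).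
Proof.
move=> [f1 f2].
apply: (@eq_measurable_fun _ _ _ _ _
  (fun x => Num.sqrt (complex.Re (f x) ^+ 2 + complex.Im (f x) ^+ 2))) => [x _|].
  by rewrite -sqr_modulus sqrtr_sqr ger0_norm// modulus_ge0.
apply: measurableT_comp.
  by apply: continuous_measurable_fun; exact: sqrt_continuous.
by apply: measurable_funD; exact: measurable_funX.
Qed.

End ComplexMeasurable.

Lemma cmeas_comp {R : realType} d d' (T : measurableType d) (T' : measurableType d')
    (f : T -> R[i]) (g : T' -> T) :
  cmeas f -> measurable_fun setT g -> cmeas (f \o g).
Proof.
move=> [f1 f2] mg; split; first exact: (measurableT_comp f1 mg).
exact: (measurableT_comp f2 mg).
Qed.

Section L1.
Context {R : realType}.
Local Notation mu := (@lebesgue_measure R).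
Implicit Types (f g h : R -> R).

Definition L1 f : Prop := mu.-integrable setT (EFin \o f).

Lemma L1_meas f : L1 f -> measurable_fun setT f.
Proof. by move=> /measurable_int/measurable_EFinP. Qed.

Lemma L1D f g : L1 f -> L1 g -> L1 (fun x => f x + g x).
Proof. by move=> h1 h2; exact: (integrableD measurableT h1 h2). Qed.

Lemma L1B f g : L1 f -> L1 g -> L1 (fun x => f x - g x).
Proof. by move=> h1 h2; exact: (integrableB measurableT h1 h2). Qed.

Lemma L1Zl (c : R) f : L1 f -> L1 (fun x => c * f x).
Proof. by move=> h; exact: (integrableZl measurableT c h). Qed.

Lemma L1Zr (c : R) f : L1 f -> L1 (fun x => f x * c).
Proof. by move=> h; exact: (integrableZr measurableT c h). Qed.

Lemma L1_le f g : measurable_fun setT f -> L1 g -> (forall x, `|f x| <= g x) -> L1 f.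
Proof.
move=> mf ig fg; apply: le_integrable ig => //; first exact/measurable_EFinP.
by move=> x _ /=; rewrite lee_fin (le_trans (fg x))// ler_norm.
Qed.

Lemma L1_norm f : L1 f -> L1 (fun x => `|f x|).
Proof. exact: integrable_norm. Qed.

Lemma L1_0 : L1 (fun=> 0).
Proof. exact: integrable0. Qed.

Lemma L1_lty f : measurable_fun setT f -> (forall x, 0 <= f x) ->
  (\int[mu]_x (f x)%:E < +oo)%E -> L1 f.
Proof.
move=> mf f0 fy; apply/integrableP; split; first exact/measurable_EFinP.
rewrite (_ : (fun x => `|(EFin \o f) x|%E) = EFin \o f)//.
by apply/funext => x /=; rewrite ger0_norm.
Qed.

Lemma L1_int_lty f : L1 f -> (\int[mu]_x (f x)%:E < +oo)%E.
Proof. by move=> h; apply: integrable_lty h. Qed.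

Lemma L1_fineK f : L1 f -> ((\int[mu]_x f x)%R)%:E = (\int[mu]_x (f x)%:E)%E.
Proof. by move=> h; rewrite /Rintegral fineK//; apply: integrable_fin_num h. Qed.

Lemma le_Rint f g : L1 f -> L1 g -> (forall x, f x <= g x) ->
  \int[mu]_x f x <= \int[mu]_x g x.
Proof. by move=> *; apply: le_Rintegral. Qed.

Lemma RintD f g : L1 f -> L1 g ->
  \int[mu]_x (f x + g x) = \int[mu]_x f x + \int[mu]_x g x.
Proof. by move=> *; apply: RintegralD. Qed.

Lemma RintB f g : L1 f -> L1 g ->
  \int[mu]_x (f x - g x) = \int[mu]_x f x - \int[mu]_x g x.
Proof. by move=> *; apply: RintegralB. Qed.

Lemma RintZl (c : R) f : L1 f -> \int[mu]_x (c * f x) = c * \int[mu]_x f x.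
Proof. by move=> *; apply: RintegralZl. Qed.

End L1.

Section ComplexIntegral.
Context {R : realType}.
Local Notation mu := (@lebesgue_measure R).
Implicit Types (f g : R -> R[i]) (h : R -> R).

Lemma cintegrable_le f h : cmeas f -> L1 h -> (forall x, modulus (f x) <= h x) ->
  cintegrable f.
Proof.
move=> [f1 f2] ih fh; split.
- by apply: L1_le ih _ => // x; rewrite (le_trans (Re_le_modulus _)).
- by apply: L1_le ih _ => // x; rewrite (le_trans (Im_le_modulus _)).
Qed.

Lemma cintegrable_meas f : cintegrable f -> cmeas f.
Proof. by move=> [h1 h2]; split; [exact: L1_meas h1|exact: L1_meas h2]. Qed.

Lemma cintegrable_modulus f : cintegrable f -> L1 (fun x => modulus (f x)).
Proof.
move=> fi; have mf := cintegrable_meas fi; case: fi => f1 f2.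
apply: (L1_le (g := fun x => `|complex.Re (f x)| + `|complex.Im (f x)|)).
- exact: measurable_modulus.
- by apply: L1D; exact: L1_norm.
- by move=> x; rewrite ger0_norm ?modulus_ge0// modulus_le_ReIm.
Qed.

Lemma cintegrable_dom f g : cmeas f -> cintegrable g ->
  (forall x, modulus (f x) <= modulus (g x)) -> cintegrable f.
Proof. by move=> mf /cintegrable_modulus ig; exact: cintegrable_le ig. Qed.

Lemma cintegrableD f g : cintegrable f -> cintegrable g ->
  cintegrable (fun x => f x + g x).
Proof.
move=> [f1 f2] [g1 g2]; split; rewrite /re /im.
  by under [X in EFin \o X]eq_fun do rewrite cReD; exact: L1D.
by under [X in EFin \o X]eq_fun do rewrite cImD; exact: L1D.
Qed.

Lemma cintegrableZ (c : R[i]) f : cintegrable f -> cintegrable (fun x => c * f x).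
Proof.
move=> fi; apply: (@cintegrable_le _ (fun x => modulus c * modulus (f x))).
- apply: cmeasM; [exact: cmeas_cst|exact: cintegrable_meas].
- by apply: L1Zl; exact: cintegrable_modulus.
- by move=> x; rewrite modulusM.
Qed.

Lemma cintegrableN f : cintegrable f -> cintegrable (fun x => - f x).
Proof.
move=> fi; under [X in cintegrable X]eq_fun do rewrite -mulN1r.
exact: cintegrableZ.
Qed.

Lemma cintegrableB f g : cintegrable f -> cintegrable g ->
  cintegrable (fun x => f x - g x).
Proof. by move=> fi gi; apply: cintegrableD => //; exact: cintegrableN. Qed.

Lemma cintegralD f g : cintegrable f -> cintegrable g ->
  cintegral (fun x => f x + g x) = cintegral f + cintegral g.
Proof.
move=> [f1 f2] [g1 g2]; rewrite /cintegral /re /im; simpc; congr Complex.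
  by under eq_Rintegral do rewrite cReD; exact: RintD.
by under eq_Rintegral do rewrite cImD; exact: RintD.
Qed.

Lemma cintegralZ (c : R[i]) f : cintegrable f ->
  cintegral (fun x => c * f x) = c * cintegral f.
Proof.
move=> [f1 f2]; rewrite /cintegral /re /im.
have [h1 h2] := (L1Zl (complex.Re c) f1, L1Zl (complex.Im c) f2).
have [h3 h4] := (L1Zl (complex.Re c) f2, L1Zl (complex.Im c) f1).
case: c h1 h2 h3 h4 => p q /= h1 h2 h3 h4; simpc; congr Complex.
  by under eq_Rintegral do rewrite cReM/=; rewrite RintB// !RintZl.
by under eq_Rintegral do rewrite cImM/=; rewrite RintD// !RintZl.
Qed.

Lemma cintegralN f : cintegrable f -> cintegral (fun x => - f x) = - cintegral f.
Proof.
move=> fi; rewrite -mulN1r -cintegralZ//; congr cintegral.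
by apply/funext => x; rewrite mulN1r.
Qed.

Lemma cintegralB f g : cintegrable f -> cintegrable g ->
  cintegral (fun x => f x - g x) = cintegral f - cintegral g.
Proof. by move=> fi gi; rewrite cintegralD ?cintegralN//; exact: cintegrableN. Qed.

Lemma cintegral_conjc f : cintegrable f ->
  cintegral (fun x => conjc (f x)) = conjc (cintegral f).
Proof.
move=> [f1 f2]; rewrite /cintegral /re /im/=; congr Complex.
  by apply: eq_Rintegral => x _; case: (f x).
rewrite -mulN1r -RintZl//; apply: eq_Rintegral => x _.
by case: (f x) => /= *; rewrite mulN1r.
Qed.

Lemma cintegral_real h : cintegral (fun x => (h x)%:C) = (\int[mu]_x h x)%:C.
Proof. by rewrite /cintegral /re /im/= Rintegral_cst// mul0r. Qed.

(** With [z] the integral, [|z|^2] is the integral of the real part of [conjc z * f], hence at most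
    [|z|] times the integral of [|f|]. Estimating real and imaginary parts separately would lose a
    constant. *)
Lemma modulus_cintegral f : cintegrable f ->
  modulus (cintegral f) <= \int[mu]_x modulus (f x).
Proof.
move=> fi; set z := cintegral f.
have [z0|z0] := eqVneq (modulus z) 0.
  by rewrite z0; apply: Rintegral_ge0 => x _; exact: modulus_ge0.
have zp : 0 < modulus z by rewrite lt_neqAle eq_sym z0 modulus_ge0.
rewrite -(ler_pM2l zp) -expr2.
have -> : modulus z ^+ 2 = \int[mu]_x complex.Re (conjc z * f x).
  have := cintegralZ (conjc z) fi; rewrite mulrC mulc_conjc.
  by move=> /(congr1 (@complex.Re R)) /= <-.
rewrite -RintZl; last exact: cintegrable_modulus.
apply: le_Rint.
- by case: (cintegrableZ (conjc z) fi).
- by apply: L1Zl; exact: cintegrable_modulus.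
- move=> x; rewrite (le_trans (ler_norm _))// (le_trans (Re_le_modulus _))//.
  by rewrite modulusM modulus_conjc.
Qed.

Lemma cintegrableMbounded f g (M : R) : cintegrable f -> cmeas g ->
  (forall x, modulus (g x) <= M) -> cintegrable (fun x => f x * g x).
Proof.
move=> fi mg gM; apply: (@cintegrable_le _ (fun x => M * modulus (f x))).
- by apply: cmeasM => //; exact: cintegrable_meas.
- by apply: L1Zl; exact: cintegrable_modulus.
- by move=> x; rewrite modulusM mulrC ler_wpM2r// modulus_ge0.
Qed.

End ComplexIntegral.

Section ComplexFubini.
Context {R : realType}.
Local Notation mu := (@lebesgue_measure R).
Implicit Types (p h : R -> R[i]) (e : R * R -> R[i]).

Lemma L1_prod (p h : R -> R) : L1 p -> L1 h ->
  (mu \x mu)%E.-integrable setT (fun z => (p z.1 * h z.2)%:E).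
Proof.
move=> ip ih; have mp := L1_meas ip; have mh := L1_meas ih.
have m : measurable_fun setT (fun z : R * R => (p z.1 * h z.2)%:E).
  apply/measurable_EFinP; apply: measurable_funM.
    exact: measurableT_comp mp measurable_fst.
  exact: measurableT_comp mh measurable_snd.
apply: (proj2 (@integrable12ltyP _ _ (measurableTypeR R) (measurableTypeR R) R mu mu _ m)).
have -> : (\int[mu]_x \int[mu]_y `|(p (x, y).1 * h (x, y).2)%:E|)%E =
    (\int[mu]_x (`|p x| * \int[mu]_y `|h y|)%:E)%E.
  apply: eq_integral => x _ /=; rewrite EFinM L1_fineK; last exact: L1_norm.
  rewrite -ge0_integralZl_EFin//; last first.
    by apply/measurable_EFinP; apply: measurableT_comp.
  by apply: eq_integral => y _; rewrite normrM EFinM.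
by apply: L1_int_lty; apply: L1Zr; exact: L1_norm.
Qed.

Lemma fubini_bounded_half (p h : R -> R) (e : R * R -> R) (M : R) : L1 p -> L1 h ->
  measurable_fun setT e -> (forall z, `|e z| <= M * `|p z.1 * h z.2|) ->
  [/\ (mu \x mu)%E.-integrable setT (EFin \o e),
      (forall x, L1 (fun y => e (x, y))) & L1 (fun x => \int[mu]_y e (x, y))].
Proof.
move=> ip ih me le.
have ie : (mu \x mu)%E.-integrable setT (EFin \o e).
  have := L1_prod (L1Zl M (L1_norm ip)) (L1_norm ih).
  apply: le_integrable => //; first exact/measurable_EFinP.
  move=> z _ /=; rewrite lee_fin (le_trans (le z))// normrM mulrA.
  by rewrite ler_norm.
have i1 x : L1 (fun y => e (x, y)).
  apply: (@L1_le _ _ (fun y => M * (`|p x| * `|h y|))).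
  - exact: measurableT_comp me (pair1_measurable x).
  - by apply: L1Zl; apply: L1Zl; exact: L1_norm.
  - by move=> y; rewrite -normrM; exact: (le (x, y)).
split => //.
have E1 : (fun x => (\int[mu]_y e (x, y))%:E) = fubini_F mu (EFin \o e).
  by apply/funext => x; rewrite L1_fineK.
rewrite /L1 /comp E1; exact: integrable_fubini_F.
Qed.

Lemma fubini_bounded (p h : R -> R) (e : R * R -> R) (M : R) : L1 p -> L1 h ->
  measurable_fun setT e -> (forall z, `|e z| <= M * `|p z.1 * h z.2|) ->
  [/\ \int[mu]_x \int[mu]_y e (x, y) = \int[mu]_y \int[mu]_x e (x, y),
      L1 (fun x => \int[mu]_y e (x, y)),
      L1 (fun y => \int[mu]_x e (x, y)),
      (forall x, L1 (fun y => e (x, y))) & (forall y, L1 (fun x => e (x, y)))].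
Proof.
move=> ip ih me le; have [ie i1 j1] := fubini_bounded_half ip ih me le.
have le' (z : R * R) : `|e (z.2, z.1)| <= M * `|h z.1 * p z.2|.
  by rewrite [h _ * _]mulrC; exact: (le (z.2, z.1)).
have me' : measurable_fun setT (fun z : R * R => e (z.2, z.1)).
  apply: (measurableT_comp me); exact: (measurable_fun_pair measurable_snd measurable_fst).
have [_ i2 j2] := fubini_bounded_half ih ip me' le'.
split; [|exact: j1|exact: j2|exact: i1|exact: i2].
rewrite /Rintegral; congr fine.
transitivity (\int[mu]_x \int[mu]_y ((EFin \o e) (x, y)))%E.
  by apply: eq_integral => x _; rewrite L1_fineK.
rewrite (Fubini ie); apply: eq_integral => y _.
by rewrite L1_fineK//; exact: i2.
Qed.

Lemma cFubini p h e (M : R) : cintegrable p -> cintegrable h -> cmeas e ->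
  (forall z, modulus (e z) <= M) ->
  let E z := p z.1 * h z.2 * e z in
  [/\ cintegral (fun x => cintegral (fun y => E (x, y))) =
      cintegral (fun y => cintegral (fun x => E (x, y))),
      cintegrable (fun x => cintegral (fun y => E (x, y))),
      cintegrable (fun y => cintegral (fun x => E (x, y))),
      (forall x, cintegrable (fun y => E (x, y))) &
      (forall y, cintegrable (fun x => E (x, y)))].
Proof.
move=> ip ih me eM E.
have mp := cintegrable_meas ip; have mh := cintegrable_meas ih.
have [E1 E2] : cmeas E.
  by apply: cmeasM => //; apply: cmeasM;
    [exact: (cmeas_comp mp measurable_fst)|exact: (cmeas_comp mh measurable_snd)].
have EM z : modulus (E z) <= M * `|modulus (p z.1) * modulus (h z.2)|.
  rewrite ger0_norm ?mulr_ge0 ?modulus_ge0// !modulusM mulrC ler_wpM2r//.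
  by rewrite mulr_ge0 ?modulus_ge0.
have Lp := cintegrable_modulus ip; have Lh := cintegrable_modulus ih.
have [r1 r2 r3 r4 r5] := fubini_bounded Lp Lh E1
  (fun z => le_trans (Re_le_modulus (E z)) (EM z)).
have [i1 i2 i3 i4 i5] := fubini_bounded Lp Lh E2
  (fun z => le_trans (Im_le_modulus (E z)) (EM z)).
split; [|exact: (conj r2 i2)|exact: (conj r3 i3)|exact: (fun x => conj (r4 x) (i4 x))
  |exact: (fun y => conj (r5 y) (i5 y))].
by rewrite /cintegral /re /im /= r1 i1.
Qed.

Lemma cFubini_kernel p h e (M : R) : cintegrable p -> cintegrable h -> cmeas e ->
  (forall z, modulus (e z) <= M) ->
  cintegral (fun x => p x * cintegral (fun y => h y * e (x, y))) =
  cintegral (fun y => h y * cintegral (fun x => p x * e (x, y))).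
Proof.
move=> ip ih me eM; have [F _ _ F1 F2] := cFubini ip ih me eM.
transitivity (cintegral (fun x => cintegral (fun y => p x * h y * e (x, y)))).
  congr cintegral; apply/funext => x; rewrite -cintegralZ.
    by congr cintegral; apply/funext => y; rewrite mulrA.
  apply: (cintegrableMbounded ih (M := M)); last by move=> y; exact: eM.
  exact: (cmeas_comp me (pair1_measurable x)).
rewrite F; congr cintegral; apply/funext => y; rewrite -cintegralZ.
  by congr cintegral; apply/funext => x; rewrite /=; ring.
apply: (cintegrableMbounded ip (M := M)); last by move=> x; exact: eM.
exact: (cmeas_comp me (pair2_measurable y)).
Qed.

End ComplexFubini.

Opaque cmeas.
Arguments modulus : simpl never.
Arguments cis : simpl never.
Arguments cintegral : simpl never.
Arguments conjc : simpl never.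

(** * Gaussians and Schur's test *)

Section NonnegIntegral.
Context {R : realType}.
Local Notation mu := (@lebesgue_measure R).
Implicit Types (f g : R -> R).

Lemma le_Ie f g : measurable_fun setT f -> measurable_fun setT g ->
  (forall x, 0 <= f x) -> (forall x, f x <= g x) ->
  (\int[mu]_x (f x)%:E <= \int[mu]_x (g x)%:E)%E.
Proof.
move=> mf mg f0 fg; apply: ge0_le_integral => //.
- by move=> x _; rewrite lee_fin.
- exact/measurable_EFinP.
- exact/measurable_EFinP.
- by move=> x _; rewrite lee_fin.
Qed.

Lemma IeD f g : measurable_fun setT f -> measurable_fun setT g ->
  (forall x, 0 <= f x) -> (forall x, 0 <= g x) ->
  (\int[mu]_x (f x + g x)%:E = \int[mu]_x (f x)%:E + \int[mu]_x (g x)%:E)%E.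
Proof.
move=> mf mg f0 g0; under eq_integral do rewrite EFinD.
apply: ge0_integralD => //.
- by move=> x _; rewrite lee_fin.
- exact/measurable_EFinP.
- by move=> x _; rewrite lee_fin.
- exact/measurable_EFinP.
Qed.

Lemma IeZ (c : R) f : measurable_fun setT f -> 0 <= c -> (forall x, 0 <= f x) ->
  (\int[mu]_x (c * f x)%:E = c%:E * \int[mu]_x (f x)%:E)%E.
Proof.
move=> mf c0 f0; under eq_integral do rewrite EFinM.
apply: ge0_integralZl_EFin => //; first by move=> x _; rewrite lee_fin.
exact/measurable_EFinP.
Qed.

Lemma Ie_ge0 f : (forall x, 0 <= f x) -> (0 <= \int[mu]_x (f x)%:E)%E.
Proof. by move=> f0; apply: integral_ge0 => x _; rewrite lee_fin. Qed.

Lemma Ie_sum (I : Type) (s : seq I) (F : I -> R -> R) :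
  (forall i, measurable_fun setT (F i)) -> (forall i x, 0 <= F i x) ->
  (\int[mu]_x (\sum_(i <- s) F i x)%:E = \sum_(i <- s) \int[mu]_x (F i x)%:E)%E.
Proof.
move=> mF F0; under eq_integral do rewrite -sumEFin.
apply: ge0_integral_sum => //; last by move=> i x _; rewrite lee_fin.
by move=> i; apply/measurable_EFinP; exact: mF.
Qed.

(** Monotone convergence along [[-n, n]]. It removes the truncations that the duality argument and
    the Bessel inequality need. *)
Lemma Ie_exhaust f (B : \bar R) : measurable_fun setT f -> (forall x, 0 <= f x) ->
  (forall n : nat, \int[mu]_(x in `[(- n%:R : R)%R, (n%:R : R)%R]) (f x)%:E <= B)%E ->
  (\int[mu]_x (f x)%:E <= B)%E.
Proof.
move=> mf f0 h.
pose F (n : nat) : set (measurableTypeR R) := `[(- n%:R : R)%R, (n%:R : R)%R]%classic.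
have homoF : {homo F : n m / (n <= m)%N >-> (n <= m)%O}.
  move=> n m nm; apply/subsetPset => x; rewrite /F /= !in_itv/= => /andP[a b].
  have : n%:R <= m%:R :> R by rewrite ler_nat.
  by move=> nm'; apply/andP; split; lra.
have mfF i : measurable_fun (F i) (EFin \o f).
  by apply/measurable_EFinP; apply: measurable_funTS.
have := @ge0_nondecreasing_set_cvg_integral _ _ R F (EFin \o f) mu homoF
  (fun i => measurable_itv _) mfF (fun i x _ => f0 x).
have -> : \bigcup_i F i = setT.
  rewrite -subTset => x _; exists (Num.bound `|x|) => //.
  rewrite /F/= in_itv/= -ler_norml ltW//.
  by apply: archi_boundP; exact: normr_ge0.
move=> /cvg_lim <- //; apply: lime_le.
  apply: ereal_nondecreasing_is_cvgn => n m nm.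
  apply: ge0_subset_integral => //; [exact: measurable_itv|exact: measurable_itv| |].
  - by move=> x _ /=; rewrite lee_fin.
  - by apply/subsetPset; exact: homoF.
by near=> n; exact: h.
Unshelve. all: by end_near. Qed.

Lemma Ie_restrict f (a b : R) : measurable_fun setT f ->
  (\int[mu]_(x in `[a, b]) (f x)%:E = \int[mu]_x (f x * \1_(`[a, b]) x)%:E)%E.
Proof.
move=> mf; rewrite integral_mkcond; apply: eq_integral => x _.
rewrite patchE indicE; case: ifPn => _; first by rewrite mulr1.
by rewrite mulr0.
Qed.

Lemma Ie_Rint f (B : R) : L1 f -> (\int[mu]_x f x <= B) =
  (\int[mu]_x (f x)%:E <= B%:E)%E.
Proof. by move=> h; rewrite -L1_fineK// lee_fin. Qed.

Lemma L1_le_Ie f (B : R) : measurable_fun setT f -> (forall x, 0 <= f x) ->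
  (\int[mu]_x (f x)%:E <= B%:E)%E -> L1 f.
Proof. by move=> mf f0 h; apply: L1_lty => //; exact: le_lt_trans h (ltry _). Qed.

End NonnegIntegral.

Section Gauss.
Context {R : realType}.
Local Notation mu := (@lebesgue_measure R).


Definition gauss (c m x : R) : R := expR (- (c * (x - m) ^+ 2)).

Lemma gauss_gt0 c m x : 0 < gauss c m x.
Proof. exact: expR_gt0. Qed.

Lemma gaussE c m x : 0 < c ->
  gauss c m x = Num.sqrt (pi / c) * normal_pdf m (Num.sqrt (2 * c)^-1) x.
Proof.
move=> c0; have s0 : Num.sqrt (2 * c)^-1 != 0 :> R.
  by rewrite gt_eqF// sqrtr_gt0 invr_gt0 mulr_gt0.
rewrite /normal_pdf (negbTE s0) /normal_peak /normal_fun.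
rewrite sqr_sqrtr ?invr_ge0 ?mulr_ge0 ?ltW//.
have -> : (2 * c)^-1 * pi *+ 2 = pi / c by rewrite -mulr_natr; field; rewrite gt_eqF.
rewrite mulrA mulfV ?mul1r; last by rewrite gt_eqF// sqrtr_gt0 divr_gt0 ?pi_gt0.
by rewrite /gauss -mulr_natr; congr expR; field; rewrite gt_eqF.
Qed.

Lemma measurable_gauss c m : measurable_fun setT (gauss c m).
Proof.
apply: measurableT_comp => //; apply: measurableT_comp => //.
by apply: measurable_funM => //; apply: measurable_funX; exact: measurable_funB.
Qed.

Lemma L1_gauss c m : 0 < c -> L1 (gauss c m).
Proof.
move=> c0; have -> : gauss c m =
    (fun x => Num.sqrt (pi / c) * normal_pdf m (Num.sqrt (2 * c)^-1) x).
  by apply/funext => x; rewrite gaussE.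
by apply: L1Zl; exact: integrable_normal_pdf.
Qed.

Lemma Rint_gauss c m : 0 < c -> \int[mu]_x gauss c m x = Num.sqrt (pi / c).
Proof.
move=> c0; under eq_Rintegral do rewrite gaussE//.
rewrite RintZl; last exact: integrable_normal_pdf.
by rewrite /Rintegral integral_normal_pdf/= mulr1.
Qed.

(** The integral need not be integrable in [y]. Fubini is applied after multiplying by a Gaussian in
    [y], and the Gaussian is then divided out. *)
Lemma cmeas_cintegral (h : R -> R[i]) (e : R * R -> R[i]) (M : R) :
  cintegrable h -> cmeas e -> (forall z, modulus (e z) <= M) ->
  cmeas (fun y => cintegral (fun x => h x * e (x, y))).
Proof.
move=> ih me eM.
have mg : cmeas (fun x : R => (gauss 1 0 x)%:C).
  by apply: cmeas_real; exact: measurable_gauss.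
have ig : cintegrable (fun x : R => (gauss 1 0 x)%:C).
  apply: (@cintegrable_le _ _ (gauss 1 0)) => //; first exact: L1_gauss.
  by move=> x; rewrite modulus_real ger0_norm// ltW// gauss_gt0.
have [_ _ i3 _ _] := cFubini ih ig me eM.
have -> : (fun y => cintegral (fun x => h x * e (x, y))) =
    (fun y => ((gauss 1 0 y)^-1)%:C *
      cintegral (fun x => h x * (gauss 1 0 y)%:C * e (x, y))).
  apply/funext => y; rewrite -cintegralZ; last first.
    have [_ _ _ _ i5] := cFubini ih ig me eM; exact: i5.
  congr cintegral; apply/funext => x.
  rewrite [h x * _ * _]mulrAC mulrCA -rmorphM/= mulVf ?mulr1//.
  by rewrite gt_eqF// gauss_gt0.
apply: cmeasM; last exact: cintegrable_meas.
apply: cmeas_real; under eq_fun do rewrite -expRN.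
apply: measurableT_comp => //; apply: measurableT_comp => //; apply: measurableT_comp => //.
by apply: measurable_funM => //; apply: measurable_funX; exact: measurable_funB.
Qed.

Lemma modulus_cint_kernel (h : R -> R[i]) (g : R -> R[i]) : cintegrable h ->
  cmeas g -> (forall x, modulus (g x) <= 1) ->
  modulus (cintegral (fun x => h x * g x)) <= \int[mu]_x modulus (h x).
Proof.
move=> ih mg g1; have i := cintegrableMbounded ih mg g1.
apply: (le_trans (modulus_cintegral i)); apply: le_Rint.
- exact: cintegrable_modulus.
- exact: cintegrable_modulus.
- by move=> x; rewrite modulusM ler_piMr// modulus_ge0.
Qed.

Lemma le_modulus_cintegral (f : R -> R[i]) : cintegrable f ->
  ((modulus (cintegral f))%:E <= \int[mu]_x (modulus (f x))%:E)%E.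
Proof.
move=> fi; rewrite -L1_fineK; last exact: cintegrable_modulus.
by rewrite lee_fin; exact: modulus_cintegral.
Qed.

End Gauss.

Section Schur.
Context {R : realType}.
Local Notation mu := (@lebesgue_measure R).
Variables (w : R -> R) (e : R * R -> R[i]) (k : R * R -> R) (A : R).
Hypothesis w_L1 : L1 w.
Hypothesis w_ge0 : forall xi, 0 <= w xi.
Hypothesis e_meas : cmeas e.
Hypothesis e_le1 : forall z, modulus (e z) <= 1.
Hypothesis k_meas : measurable_fun setT k.
Hypothesis k_ge0 : forall z, 0 <= k z.
(* [k] dominates the kernel of [T^* T], where [T h xi = sqrt (w xi) * int h(x) e(x, xi) dx]. *)
Hypothesis kernel_le : forall x y,
  modulus (cintegral (fun xi => (w xi)%:C * e (x, xi) * conjc (e (y, xi)))) <= k (x, y).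
Hypothesis k_int1 : forall x, (\int[mu]_y (k (x, y))%:E <= A%:E)%E.
Hypothesis k_int2 : forall y, (\int[mu]_x (k (x, y))%:E <= A%:E)%E.

Let em1 x : cmeas (fun xi => e (x, xi)).
Proof. exact: (cmeas_comp e_meas (pair1_measurable x)). Qed.
Let em2 xi : cmeas (fun x => e (x, xi)).
Proof. exact: (cmeas_comp e_meas (pair2_measurable xi)). Qed.

(** By [p y * p x <= (p x ^+ 2 + p y ^+ 2) / 2] it suffices to integrate [k] in the variable that
    the square does not contain; [F1] and [F2] are the two halves. *)
Lemma schur_bilinear (p : R -> R) : measurable_fun setT p -> (forall x, 0 <= p x) ->
  (\int[mu]_y \int[mu]_x (p y * p x * k (x, y))%:E <=
    A%:E * \int[mu]_x (p x ^+ 2)%:E)%E.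
Proof.
move=> mp p0.
have mp2 : measurable_fun setT (fun x => p x ^+ 2) by exact: measurable_funX.
have mk1 x : measurable_fun setT (fun y => k (x, y)).
  exact: measurableT_comp k_meas (pair1_measurable x).
have mk2 y : measurable_fun setT (fun x => k (x, y)).
  exact: measurableT_comp k_meas (pair2_measurable y).
have mpk : measurable_fun setT (fun z : R * R => p z.1 ^+ 2 * k z).
  by apply: measurable_funM => //; exact: measurableT_comp mp2 measurable_fst.
have mpk' : measurable_fun setT (fun z : R * R => p z.2 ^+ 2 * k z).
  by apply: measurable_funM => //; exact: measurableT_comp mp2 measurable_snd.
have mpp : measurable_fun setT (fun z : R * R => p z.2 * p z.1 * k z).
  apply: measurable_funM => //; apply: measurable_funM.
    exact: measurableT_comp mp measurable_snd.
  exact: measurableT_comp mp measurable_fst.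
pose F1 y := (\int[mu]_x (p x ^+ 2 * k (x, y))%:E)%E.
pose F2 y := (\int[mu]_x (p y ^+ 2 * k (x, y))%:E)%E.
have mF1 : measurable_fun setT F1.
  apply: (@measurable_fun_fubini_tonelli_G _ _ (measurableTypeR R) (measurableTypeR R) R mu
    (fun z => (p z.1 ^+ 2 * k z)%:E)); first exact/measurable_EFinP.
  by move=> z; rewrite lee_fin mulr_ge0// sqr_ge0.
have mF2 : measurable_fun setT F2.
  apply: (@measurable_fun_fubini_tonelli_G _ _ (measurableTypeR R) (measurableTypeR R) R mu
    (fun z => (p z.2 ^+ 2 * k z)%:E)); first exact/measurable_EFinP.
  by move=> z; rewrite lee_fin mulr_ge0// sqr_ge0.
have F10 y : (0 <= F1 y)%E by apply: Ie_ge0 => x; rewrite mulr_ge0// sqr_ge0.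
have F20 y : (0 <= F2 y)%E by apply: Ie_ge0 => x; rewrite mulr_ge0// sqr_ge0.
have B1 : (\int[mu]_y F1 y <= A%:E * \int[mu]_x (p x ^+ 2)%:E)%E.
  rewrite /F1 -(fubini_tonelli (fun z : measurableTypeR R * measurableTypeR R =>
     (p z.1 ^+ 2 * k z)%:E)); last 2 first.
  - exact/measurable_EFinP.
  - by move=> z; rewrite lee_fin mulr_ge0// sqr_ge0.
  have A0 : 0 <= A.
    rewrite -lee_fin (le_trans _ (k_int1 0))//; exact: Ie_ge0.
  rewrite -IeZ//; last by move=> x; exact: sqr_ge0.
  apply: ge0_le_integral => //.
  - by move=> x _; apply: Ie_ge0 => y /=; rewrite mulr_ge0// sqr_ge0.
  - apply: (@measurable_fun_fubini_tonelli_F _ _ (measurableTypeR R) (measurableTypeR R) R mu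
      (fun z => (p z.1 ^+ 2 * k z)%:E)); first exact/measurable_EFinP.
    by move=> z; rewrite lee_fin mulr_ge0// sqr_ge0.
  - by apply/measurable_EFinP; exact: measurable_funM.
  - move=> x _ /=; rewrite IeZ ?sqr_ge0//.
    by rewrite [(A * _)%:E]EFinM muleC lee_wpmul2r// lee_fin sqr_ge0.
have B2 : (\int[mu]_y F2 y <= A%:E * \int[mu]_x (p x ^+ 2)%:E)%E.
  have A0 : 0 <= A.
    rewrite -lee_fin (le_trans _ (k_int1 0))//; exact: Ie_ge0.
  rewrite -IeZ//; last by move=> x; exact: sqr_ge0.
  apply: ge0_le_integral => //.
  - by apply/measurable_EFinP; exact: measurable_funM.
  - move=> y _ /=; rewrite /F2 IeZ ?sqr_ge0//.
    by rewrite [(A * _)%:E]EFinM muleC lee_wpmul2r// lee_fin sqr_ge0.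
have -> : (A%:E * \int[mu]_x (p x ^+ 2)%:E =
   2^-1%:E * (A%:E * \int[mu]_x (p x ^+ 2)%:E + A%:E * \int[mu]_x (p x ^+ 2)%:E))%E.
  set X := (A%:E * _)%E; have X0 : (0 <= X)%E by apply: le_trans B2; apply: integral_ge0.
  rewrite ge0_muleDr// -ge0_muleDl ?lee_fin ?invr_ge0//.
  by rewrite -EFinD (_ : 2^-1 + 2^-1 = 1 :> R) ?mul1e//; lra.
apply: (@le_trans _ _ (2^-1%:E * (\int[mu]_y F1 y + \int[mu]_y F2 y))%E); last first.
  by apply: lee_wpmul2l; [rewrite lee_fin invr_ge0|exact: leeD].
rewrite -ge0_integralD//; last first.
rewrite -ge0_integralZl_EFin ?invr_ge0//; last 2 first.
- by move=> y _; rewrite adde_ge0.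
- exact: emeasurable_funD.
apply: ge0_le_integral => //.
- by move=> y _; apply: Ie_ge0 => x; rewrite mulr_ge0// mulr_ge0.
- apply: (@measurable_fun_fubini_tonelli_G _ _ (measurableTypeR R) (measurableTypeR R) R mu
      (fun z => (p z.2 * p z.1 * k z)%:E)); first exact/measurable_EFinP.
  by move=> z; rewrite lee_fin mulr_ge0// mulr_ge0.
- by apply: measurable_funeM; exact: emeasurable_funD.
- move=> y _; rewrite /F1 /F2 -IeD.
  + rewrite -IeZ ?invr_ge0//.
    * apply: le_Ie.
      - by apply: measurable_funM => //; exact: measurable_funM.
      - apply: measurable_funM => //; apply: measurable_funD; exact: measurable_funM.
      - by move=> x; rewrite mulr_ge0// mulr_ge0.
      - move=> x; rewrite -mulrDl mulrA ler_wpM2r//.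
        by have := sqr_ge0 (p x - p y); lra.
    * by apply: measurable_funD; exact: measurable_funM.
    * by move=> x; rewrite -mulrDl mulr_ge0// addr_ge0// sqr_ge0.
  + exact: measurable_funM.
  + exact: measurable_funM.
  + by move=> x; rewrite mulr_ge0// sqr_ge0.
  + by move=> x; rewrite mulr_ge0// sqr_ge0.
Qed.


Section adjoint.
Variable h : R -> R[i].
Hypothesis ih : cintegrable h.
Let Q xi := cintegral (fun x => h x * e (x, xi)).

Let mQ : cmeas Q.
Proof. exact: (cmeas_cintegral ih e_meas e_le1). Qed.

Let QM xi : modulus (Q xi) <= \int[mu]_x modulus (h x).
Proof. by apply: modulus_cint_kernel => // x; exact: e_le1. Qed.

Let mw : measurable_fun setT w. Proof. exact: L1_meas. Qed.

Lemma schur_L1 : L1 (fun xi => w xi * modulus (Q xi) ^+ 2).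
Proof.
apply: (@L1_le _ _ (fun xi => (\int[mu]_x modulus (h x)) ^+ 2 * w xi)).
- by apply: measurable_funM => //; apply: measurable_funX; exact: measurable_modulus.
- exact: L1Zl.
- move=> xi; rewrite ger0_norm; last by rewrite mulr_ge0 ?sqr_ge0.
  rewrite mulrC; apply: ler_wpM2r => //.
  by rewrite lerXn2r ?nnegrE ?modulus_ge0// ?QM// (le_trans (modulus_ge0 (Q xi))).
Qed.

(** Both factors of [|Q|^2] are expanded and the frequency integral is moved innermost, where it is
    the kernel dominated by [k]. Moduli are taken only afterwards, so the cancellation in the kernel
    is kept. *)
Lemma schur : (\int[mu]_xi (w xi * modulus (Q xi) ^+ 2)%:E <=
    A%:E * \int[mu]_x (modulus (h x) ^+ 2)%:E)%E.
Proof.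
have ip : cintegrable (fun xi => (w xi)%:C * Q xi).
  apply: (@cintegrable_le _ _ (fun xi => (\int[mu]_x modulus (h x)) * w xi)).
  - by apply: cmeasM => //; exact: cmeas_real.
  - exact: L1Zl.
  - by move=> xi; rewrite modulusM modulus_real ger0_norm// mulrC ler_wpM2r.
have ihc : cintegrable (fun y => conjc (h y)).
  apply: (cintegrable_dom _ ih); first by apply: cmeas_conjc; exact: cintegrable_meas.
  by move=> x; rewrite modulus_conjc.
have mec : cmeas (fun z : R * R => conjc (e (z.2, z.1))).
  apply: cmeas_conjc; apply: (cmeas_comp e_meas).
  exact: (measurable_fun_pair measurable_snd measurable_fst).
have mec' : cmeas (fun z : R * R => e (z.2, z.1)).
  apply: (cmeas_comp e_meas).
  exact: (measurable_fun_pair measurable_snd measurable_fst).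
have E1 : (\int[mu]_xi (w xi * modulus (Q xi) ^+ 2))%:C =
    cintegral (fun y => conjc (h y) * cintegral (fun xi => (w xi)%:C * Q xi * conjc (e (y, xi)))).
  rewrite -(cFubini_kernel ip ihc mec (M := 1)); last first.
    by move=> z; rewrite modulus_conjc.
  rewrite -cintegral_real; congr cintegral; apply/funext => xi.
  have -> : (w xi * modulus (Q xi) ^+ 2)%:C = (w xi)%:C * (Q xi * conjc (Q xi)).
    by rewrite mulc_conjc rmorphM.
  rewrite mulrA; congr (_ * _).
  rewrite -cintegral_conjc; last exact: cintegrableMbounded ih (em2 xi) (fun x => e_le1 _).
  by congr cintegral; apply/funext => x; rewrite rmorphM.
have iwe y : cintegrable (fun xi => (w xi)%:C * conjc (e (y, xi))).
  apply: (@cintegrable_le _ _ w) => //.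
  - by apply: cmeasM; [exact: cmeas_real|exact: cmeas_conjc].
  - by move=> xi; rewrite modulusM modulus_real ger0_norm// modulus_conjc ler_piMr.
have E2 y : cintegral (fun xi => (w xi)%:C * Q xi * conjc (e (y, xi))) =
    cintegral (fun x => h x * cintegral (fun xi => (w xi)%:C * e (x, xi) * conjc (e (y, xi)))).
  transitivity (cintegral (fun xi => (w xi)%:C * conjc (e (y, xi)) * Q xi)).
    by congr cintegral; apply/funext => xi; rewrite mulrAC.
  rewrite (cFubini_kernel (iwe y) ih mec' (fun z => e_le1 _)).
  congr cintegral; apply/funext => x; congr (_ * _).
  by congr cintegral; apply/funext => xi; rewrite mulrAC.
pose J y := cintegral (fun xi => (w xi)%:C * Q xi * conjc (e (y, xi))).
have mJ : cmeas J by exact: (cmeas_cintegral ip mec (M := 1) (fun z => eq_ind_r (fun t => t <= 1) (e_le1 _) (modulus_conjc _))).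
have JM y : modulus (J y) <= \int[mu]_xi modulus ((w xi)%:C * Q xi).
  apply: modulus_cint_kernel => //; first exact: cmeas_conjc.
  by move=> x; rewrite modulus_conjc.
have ihJ : cintegrable (fun y => conjc (h y) * J y) by exact: cintegrableMbounded ihc mJ JM.
have JE y : ((modulus (J y))%:E <= \int[mu]_x (modulus (h x) * k (x, y))%:E)%E.
  rewrite /J E2.
  pose K x := cintegral (fun xi => (w xi)%:C * e (x, xi) * conjc (e (y, xi))).
  have KE x : K x = cintegral (fun xi => (w xi)%:C * conjc (e (y, xi)) * e (x, xi)).
    by congr cintegral; apply/funext => xi; rewrite mulrAC.
  have mK : cmeas K.
    have -> : K = fun x => cintegral (fun xi => (w xi)%:C * conjc (e (y, xi)) * e (x, xi)).
      by apply/funext.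
    exact: (cmeas_cintegral (iwe y) mec' (M := 1)).
  have KM x : modulus (K x) <= \int[mu]_xi modulus ((w xi)%:C * conjc (e (y, xi))).
    by rewrite KE; apply: modulus_cint_kernel.
  apply: (le_trans (le_modulus_cintegral (cintegrableMbounded ih mK KM))).
  apply: le_Ie.
  - by apply: measurable_modulus; apply: cmeasM => //; exact: cintegrable_meas.
  - apply: measurable_funM; last exact: measurableT_comp k_meas (pair2_measurable y).
    by apply: measurable_modulus; exact: cintegrable_meas.
  - by move=> x; exact: modulus_ge0.
  - by move=> x; rewrite modulusM ler_wpM2l ?modulus_ge0//; exact: kernel_le.
have mh : measurable_fun setT (fun x => modulus (h x)).
  by apply: measurable_modulus; exact: cintegrable_meas.
rewrite -L1_fineK; last exact: schur_L1.
have I0 : 0 <= \int[mu]_xi (w xi * modulus (Q xi) ^+ 2).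
  by apply: Rintegral_ge0 => xi _; rewrite mulr_ge0// sqr_ge0.
rewrite -(ger0_norm I0) -modulus_real E1.
apply: (le_trans (le_modulus_cintegral ihJ)).
apply: le_trans (schur_bilinear mh (fun x => modulus_ge0 _)).
apply: ge0_le_integral => //.
- by move=> y _; rewrite lee_fin modulus_ge0.
- by apply/measurable_EFinP; apply: measurable_modulus; exact: cintegrable_meas.
- apply: (@measurable_fun_fubini_tonelli_G _ _ (measurableTypeR R) (measurableTypeR R) R mu
      (fun z => (modulus (h z.2) * modulus (h z.1) * k z)%:E)).
    apply/measurable_EFinP; apply: measurable_funM => //; apply: measurable_funM.
      exact: measurableT_comp mh measurable_snd.
    exact: measurableT_comp mh measurable_fst.
  by move=> z; rewrite lee_fin mulr_ge0// mulr_ge0// modulus_ge0.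
- move=> y _; rewrite modulusM modulus_conjc EFinM.
  have -> : (\int[mu]_x (modulus (h y) * modulus (h x) * k (x, y))%:E =
      (modulus (h y))%:E * \int[mu]_x (modulus (h x) * k (x, y))%:E)%E.
    rewrite -IeZ ?modulus_ge0//.
    - by apply: eq_integral => x _; rewrite mulrA.
    - by apply: measurable_funM => //; exact: measurableT_comp k_meas (pair2_measurable y).
    - by move=> x; rewrite mulr_ge0// modulus_ge0.
  by rewrite lee_wpmul2l// lee_fin modulus_ge0.
Qed.

End adjoint.

(** Duality: tested against its own truncated conjugate [h], the integral [I] of [|G|^2] over
    [[-r, r]] becomes the integral of [g * Q], and [schur] bounds the weighted norm of [Q] by
    [A * I]. The truncation makes [I] finite, so that half of it can be absorbed. *)
Lemma schur_dual_bounded (g : R -> R[i]) (rho : R -> R) (r : R) : cintegrable g ->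
  0 < A -> L1 rho -> (forall xi, 0 <= rho xi) ->
  (forall xi, modulus (g xi) ^+ 2 <= w xi * rho xi) ->
  (\int[mu]_x (modulus (cintegral (fun xi => g xi * e (x, xi))) ^+ 2 * \1_(`[- r, r]) x)%:E <=
    A%:E * \int[mu]_xi (rho xi)%:E)%E.
Proof.
move=> ig A0 irho rho0 gw; pose D : set R := `[- r, r]%classic.
pose G x := cintegral (fun xi => g xi * e (x, xi)).
have mec' : cmeas (fun z : R * R => e (z.2, z.1)).
  apply: (cmeas_comp e_meas).
  exact: (measurable_fun_pair measurable_snd measurable_fst).
have mG : cmeas G by exact: (cmeas_cintegral ig mec' (M := 1)).
have GM x : modulus (G x) <= \int[mu]_xi modulus (g xi).
  by apply: modulus_cint_kernel.
pose N := \int[mu]_xi modulus (g xi).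
have N0 : 0 <= N by apply: Rintegral_ge0 => xi _; exact: modulus_ge0.
have mD : measurable_fun setT (\1_D : R -> R) by apply: measurable_indic; exact: measurable_itv.
have iD : L1 (\1_D : R -> R) by exact: integrable_indic_itv.
have D01 x : 0 <= (\1_D x : R) <= 1.
  by rewrite indicE; case: (_ \in _); rewrite ?lexx ?ler01.
pose h x := conjc (G x) * (\1_D x)%:C.
have mh : cmeas h by apply: cmeasM; [exact: cmeas_conjc|exact: cmeas_real].
have ih : cintegrable h.
  apply: (@cintegrable_le _ _ (fun x => N * \1_D x)) => //; first exact: L1Zl.
  move=> x; rewrite modulusM modulus_conjc modulus_real ger0_norm; last by case/andP: (D01 x).
  by rewrite ler_wpM2r//; case/andP: (D01 x).
have hh x : modulus (h x) ^+ 2 = modulus (G x) ^+ 2 * \1_D x.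
  rewrite modulusM modulus_conjc modulus_real indicE.
  by case: (x \in D); rewrite /= ?normr1 ?normr0 ?mulr1// mulr0 expr0n/= mulr0.
have iGG : L1 (fun x => modulus (G x) ^+ 2 * \1_D x).
  apply: (@L1_le _ _ (fun x => N ^+ 2 * \1_D x)).
  - by apply: measurable_funM => //; apply: measurable_funX; exact: measurable_modulus.
  - exact: L1Zl.
  - move=> x; rewrite normrM ger0_norm ?sqr_ge0// ger0_norm; last by case/andP: (D01 x).
    apply: ler_wpM2r; first by case/andP: (D01 x).
    by rewrite lerXn2r ?nnegrE ?modulus_ge0.
pose Q xi := cintegral (fun x => h x * e (x, xi)).
have mQ : cmeas Q by exact: (cmeas_cintegral ih e_meas (M := 1)).
have QM xi : modulus (Q xi) <= \int[mu]_x modulus (h x) by apply: modulus_cint_kernel.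
have SQ := schur ih; have LQ := schur_L1 ih.
rewrite -/D -/G -L1_fineK// -L1_fineK// -EFinM lee_fin.
pose I := \int[mu]_x (modulus (G x) ^+ 2 * \1_D x).
pose P := \int[mu]_xi rho xi; change (I <= A * P).
have IE : I%:C = cintegral (fun xi => g xi * Q xi).
  rewrite /I -cintegral_real.
  transitivity (cintegral (fun x => h x * G x)).
    congr cintegral; apply/funext => x.
    by rewrite real_complexM -mulc_conjc /h; ring.
  rewrite -(cFubini_kernel ih ig e_meas e_le1).
  by [].
have SQ' : \int[mu]_xi (w xi * modulus (Q xi) ^+ 2) <= A * I.
  rewrite -lee_fin L1_fineK// EFinM /I L1_fineK//; apply: (le_trans SQ).
  by rewrite lee_wpmul2l ?lee_fin ?(ltW A0)//; under eq_integral do rewrite hh.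
have I0 : 0 <= I.
  apply: Rintegral_ge0 => x _; rewrite mulr_ge0 ?sqr_ge0//; by case/andP: (D01 x).
(* The AM-GM inequality with weight [A]: by [SQ'] the part containing [Q] then contributes at most
   [I / 2]. *)
have : I <= \int[mu]_xi (2^-1 * (A^-1 * (w xi * modulus (Q xi) ^+ 2) + A * rho xi)).
  rewrite -(ger0_norm I0) -modulus_real IE.
  have igQ := cintegrableMbounded ig mQ QM.
  apply: (le_trans (modulus_cintegral igQ)).
  apply: le_Rint; first exact: cintegrable_modulus.
    by apply: L1Zl; apply: L1D; exact: L1Zl.
  move=> xi; rewrite modulusM.
  have q0 := modulus_ge0 (Q xi); have g0 := modulus_ge0 (g xi).
  have := gw xi; set q := modulus (Q xi) in q0 *; set t := modulus (g xi) in g0 *.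
  have := rho0 xi; have := w_ge0 xi; move: (rho xi) (w xi) => p v v0 p0 tp.
  have X0 : 0 <= A^-1 * (v * q ^+ 2) + A * p.
    by rewrite addr_ge0// mulr_ge0// ?invr_ge0 ?(ltW A0)// mulr_ge0// sqr_ge0.
  rewrite -(@ler_pXn2r _ 2)// ?nnegrE ?mulr_ge0// ?invr_ge0//.
  have -> : (2^-1 * (A^-1 * (v * q ^+ 2) + A * p)) ^+ 2 =
     q ^+ 2 * (v * p) + (2^-1 * (A^-1 * (v * q ^+ 2) - A * p)) ^+ 2.
    by field; rewrite gt_eqF.
  rewrite exprMn mulrC (le_trans (ler_wpM2l (sqr_ge0 q) tp))// lerDl sqr_ge0//.
rewrite RintZl; last by apply: L1D; exact: L1Zl.
rewrite RintD; [|exact: L1Zl|exact: L1Zl].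
rewrite !RintZl// -/P => IP.
have : A^-1 * \int[mu]_xi (w xi * modulus (Q xi) ^+ 2) <= I.
  by rewrite ler_pdivrMl.
move: IP; set T := \int[mu]_xi (w xi * _); lra.
Qed.

(** [rho] stands for [|g|^2 / w] without a division at the zeros of [w]. *)
Lemma schur_dual (g : R -> R[i]) (rho : R -> R) : cintegrable g ->
  0 < A -> measurable_fun setT rho -> (forall xi, 0 <= rho xi) ->
  (forall xi, modulus (g xi) ^+ 2 <= w xi * rho xi) ->
  (\int[mu]_x (modulus (cintegral (fun xi => g xi * e (x, xi))) ^+ 2)%:E <=
    A%:E * \int[mu]_xi (rho xi)%:E)%E.
Proof.
move=> ig A0 mrho rho0 gw.
have [|rhoy] := ltP (\int[mu]_xi (rho xi)%:E)%E +oo%E; last first.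
  by rewrite (le_trans (leey _))// (_ : \int[mu]_xi _ = +oo)%E ?gt0_muley ?lte_fin//;
    apply/eqP; rewrite -leye_eq.
move=> /(L1_lty mrho rho0) irho.
have mec' : cmeas (fun z : R * R => e (z.2, z.1)).
  apply: (cmeas_comp e_meas).
  exact: (measurable_fun_pair measurable_snd measurable_fst).
have mG : measurable_fun setT (fun x => modulus (cintegral (fun xi => g xi * e (x, xi))) ^+ 2).
  apply: measurable_funX; apply: measurable_modulus.
  exact: (cmeas_cintegral ig mec' (M := 1)).
apply: Ie_exhaust => //; first by move=> x; exact: sqr_ge0.
by move=> n; rewrite Ie_restrict//; exact: schur_dual_bounded.
Qed.

End Schur.

(** * The Fourier transform of a Gaussian and the Bessel inequality *)

Section Calculus.
Context {R : realType}.
Implicit Types (f g : R -> R) (x : R).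

Lemma derD f g x a b : is_derive x 1 f a -> is_derive x 1 g b ->
  is_derive x 1 (fun y => f y + g y) (a + b).
Proof. by move=> hf hg; exact: is_deriveD. Qed.

Lemma derN f x a : is_derive x 1 f a -> is_derive x 1 (fun y => - f y) (- a).
Proof. by move=> hf; exact: is_deriveN. Qed.

Lemma derB f g x a b : is_derive x 1 f a -> is_derive x 1 g b ->
  is_derive x 1 (fun y => f y - g y) (a - b).
Proof. by move=> hf hg; exact: is_deriveB. Qed.

Lemma derM f g x a b : is_derive x 1 f a -> is_derive x 1 g b ->
  is_derive x 1 (fun y => f y * g y) (a * g x + f x * b).
Proof.
move=> hf hg; have := @is_deriveM R _ f g x 1 a b hf hg.
by move=> h; apply: (is_derive_eq h); rewrite addrC ![_ *: _]mulrC/=; congr (_ + _);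
  rewrite mulrC.
Qed.

Lemma der_cst (c : R) x : is_derive x 1 (fun=> c) 0.
Proof. exact: is_derive_cst. Qed.

Lemma der_id x : is_derive x 1 (fun y => y) 1.
Proof. exact: is_derive_id. Qed.

Lemma derZ (c : R) f x a : is_derive x 1 f a -> is_derive x 1 (fun y => c * f y) (c * a).
Proof.
by move=> hf; have := derM (der_cst c x) hf; rewrite mul0r add0r.
Qed.

Lemma der_comp (h : R -> R) f x a b : is_derive (f x) 1 h a -> is_derive x 1 f b ->
  is_derive x 1 (fun y => h (f y)) (a * b).
Proof. by move=> hh hf; exact: is_derive1_comp. Qed.

Lemma der_cos f x a : is_derive x 1 f a ->
  is_derive x 1 (fun y => cos (f y)) (- sin (f x) * a).
Proof. by move=> hf; exact: (der_comp (is_derive_cos _) hf). Qed.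

Lemma der_sin f x a : is_derive x 1 f a ->
  is_derive x 1 (fun y => sin (f y)) (cos (f x) * a).
Proof. by move=> hf; exact: (der_comp (is_derive_sin _) hf). Qed.

Lemma der_exp f x a : is_derive x 1 f a ->
  is_derive x 1 (fun y => expR (f y)) (expR (f x) * a).
Proof. by move=> hf; exact: (der_comp (is_derive_expR _) hf). Qed.

Lemma der_atan f x a : is_derive x 1 f a ->
  is_derive x 1 (fun y => atan (f y)) ((1 + f x ^+ 2)^-1 * a).
Proof. by move=> hf; exact: (der_comp (is_derive1_atan _) hf). Qed.

Lemma der_V f x a : f x != 0 -> is_derive x 1 f a ->
  is_derive x 1 (fun y => (f y)^-1) (- a / f x ^+ 2).
Proof.
move=> fx0 hf; apply: (is_derive_eq (is_deriveV fx0 hf)).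
by rewrite /GRing.scale/= mulNr mulrC mulNr.
Qed.

Lemma der_powR (p x : R) : 0 < x ->
  is_derive x 1 (fun y => y `^ p) (p * x `^ (p - 1)).
Proof. by move=> x0; exact: is_derive1_powR. Qed.

Lemma der_X f x a n : is_derive x 1 f a ->
  is_derive x 1 (fun y => f y ^+ n) (n%:R * f x ^+ n.-1 * a).
Proof.
move=> hf; elim: n => [|n ih].
  by rewrite !mul0r; exact: der_cst.
under eq_fun do rewrite exprS.
apply: (is_derive_eq (derM hf ih)).
case: n {ih} => [|n]/=; first by rewrite expr0; ring.
by rewrite exprS -[in RHS]natr1; ring.
Qed.

Lemma der_cont f x a : is_derive x 1 f a -> {for x, continuous f}.
Proof. by move=> [h _]; apply: differentiable_continuous; exact/derivable1_diffP. Qed.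

End Calculus.

Section FTC.
Context {R : realType}.
Local Notation mu := (@lebesgue_measure R).
Implicit Types (F f g : R -> R).

Lemma cont_within (a b : R) f : (forall x, a <= x <= b -> {for x, continuous f}) ->
  {within `[a, b], continuous f}.
Proof.
move=> h; apply: continuous_in_subspaceT => x.
by rewrite inE/= in_itv/=; exact: h.
Qed.

Lemma cont_integrable (a b : R) f : (forall x, a <= x <= b -> {for x, continuous f}) ->
  mu.-integrable `[a, b] (EFin \o f).
Proof.
by move=> h; apply: continuous_compact_integrable; [exact: segment_compact|exact: cont_within].
Qed.

Lemma FTC2 (a b : R) F f : a <= b ->
  (forall x, a <= x <= b -> is_derive x 1 F (f x)) ->
  (forall x, a <= x <= b -> {for x, continuous f}) ->
  \int[mu]_(x in `[a, b]) f x = F b - F a.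
Proof.
rewrite le_eqVlt => /predU1P[->|ab] dF cf.
  by rewrite set_itv1 Rintegral_set1 subrr.
rewrite /Rintegral (continuous_FTC2 ab (cont_within cf) (F := F))//.
- split.
  + move=> x; rewrite in_itv/= => /andP[ax xb].
    by have [] := dF x; first by rewrite !ltW.
  + by apply: cvg_at_right_filter; apply: (der_cont (dF a _)); rewrite lexx ltW.
  + by apply: cvg_at_left_filter; apply: (der_cont (dF b _)); rewrite lexx ltW.
- move=> x; rewrite in_itv/= => /andP[ax xb].
  by rewrite derive1E; apply: derive_val; apply: dF; rewrite !ltW.
Qed.

End FTC.

Section DCT.
Context {R : realType}.
Local Notation mu := (@lebesgue_measure R).

Lemma RintDCT (f_ : nat -> R -> R) (f g : R -> R) :
  (forall n, measurable_fun setT (f_ n)) -> measurable_fun setT f ->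
  {ae mu, forall x, f_ n x @[n --> \oo] --> f x} -> L1 g ->
  (forall n x, `|f_ n x| <= g x) ->
  L1 f /\ (\int[mu]_x f_ n x @[n --> \oo] --> \int[mu]_x f x).
Proof.
move=> mf_ mf cf ig fg.
have [] := @dominated_convergence _ _ R mu setT measurableT (fun n => EFin \o f_ n)
  (EFin \o f) (EFin \o g) _ _ _ ig.
- by move=> n; apply/measurable_EFinP; exact: mf_.
- by apply/measurable_EFinP; exact: mf.
- apply: (@filterS _ _ (ae_filter_ringOfSetsType mu) _ _ _ cf) => x h _; apply: cvg_EFin => //; exact: nearW.
- by apply: aeW => x n _ /=; rewrite lee_fin.
move=> If _ h; split=> //.
have h' : (\int[mu]_x (f_ n x)%:E)%E @[n --> \oo] --> (\int[mu]_x f x)%:E.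
  by rewrite L1_fineK.
exact: (fine_cvg h').
Qed.

(** The fundamental theorem on [[-n, n]] followed by dominated convergence, so that [F] has to
    vanish only along the integers. *)
Lemma Rint_deriv0 (F f : R -> R) :
  (forall x : R, is_derive x (1 : R) F (f x)) -> continuous f -> L1 f ->
  F n%:R @[n --> \oo] --> 0 -> F (- n%:R) @[n --> \oo] --> 0 ->
  \int[mu]_x f x = 0.
Proof.
move=> dF cf If F1 F2.
have mf := L1_meas If.
have [_ h] : L1 f /\ (\int[mu]_x (f x * \1_(`[(- n%:R)%R, (n%:R)%R]) x) @[n --> \oo] -->
    \int[mu]_x f x).
  apply: (@RintDCT _ _ (fun x => `|f x|)) => //.
  - by move=> n; apply: measurable_funM => //; apply: measurable_indic; exact: measurable_itv.
  - apply: aeW => x; apply: cvg_near_cst; near=> n.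
    rewrite indicE mem_set ?mulr1//= in_itv/= -ler_norml.
    by near: n; exact: nbhs_infty_ger.
  - exact: L1_norm.
  - move=> n x; rewrite normrM indicE; case: (_ \in _); rewrite ?normr1 ?mulr1//.
    by rewrite normr0 mulr0.
have E n : \int[mu]_x (f x * \1_(`[(- n%:R)%R, (n%:R)%R]) x) = F n%:R - F (- n%:R).
  have nn : - n%:R <= n%:R :> R by apply: (@le_trans _ _ 0); rewrite ?ler0n// oppr_le0 ler0n.
  rewrite -(@FTC2 _ _ _ F f nn (fun x _ => dF x) (fun x _ => cf x)).
  rewrite [RHS]Rintegral_mkcond; apply: eq_Rintegral => x _.
  by rewrite patchE indicE; case: ifPn => _; rewrite ?mulr1 ?mulr0.
have {}h : F n%:R - F (- n%:R) @[n --> \oo] --> \int[mu]_x f x.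
  by apply: cvg_trans h; apply: near_eq_cvg; apply: nearW => n; rewrite E.
have h0 : F n%:R - F (- n%:R) @[n --> \oo] --> (0 - 0 : R) by exact: cvgB.
by rewrite subr0 in h0; exact: (cvg_unique _ h h0).
Unshelve. all: by end_near. Qed.


Lemma L1_mul_bounded (f g : R -> R) (M : R) : L1 f -> measurable_fun setT g ->
  (forall x, `|g x| <= M) -> L1 (fun x => f x * g x).
Proof.
move=> If mg gM; apply: (@L1_le _ _ (fun x => M * `|f x|)).
- by apply: measurable_funM => //; exact: L1_meas.
- by apply: L1Zl; exact: L1_norm.
- by move=> x; rewrite normrM mulrC ler_wpM2r.
Qed.

End DCT.

Section GaussFourier.
Context {R : realType}.
Local Notation mu := (@lebesgue_measure R).
Variable c : R.
Hypothesis c0 : 0 < c.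

Lemma der_gauss0 (x : R) : is_derive x (1 : R) (gauss c 0) (- (2 * c * x) * gauss c 0 x).
Proof.
have h : is_derive x (1 : R) (fun y : R => - (c * (y - 0) ^+ 2)) (- (c * (2%:R * (x - 0) ^+ 1 * (1 - 0)))).
  by apply: derN; apply: derZ; apply: (der_X 2); exact: (derB (der_id x) (der_cst 0 x)).
by apply: (is_derive_eq (der_exp h)); rewrite /gauss; ring.
Qed.

(** Half of the Gaussian absorbs the factor [|x|]: since [expR t >= 1 + t], it is enough that [(1 +
    2 / c) (1 + c x^2 / 2) >= 1 + x^2 >= |x|]. *)
Lemma gauss_mulx_le (x : R) : `|x| * gauss c 0 x <= (1 + 2 / c) * gauss (c / 2) 0 x.
Proof.
have -> : gauss c 0 x = gauss (c / 2) 0 x * gauss (c / 2) 0 x.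
  by rewrite /gauss -expRD; congr expR; field.
rewrite mulrA; apply: ler_wpM2r; first by rewrite ltW ?gauss_gt0.
rewrite /gauss subr0 expRN ler_pdivrMr ?expR_gt0//.
apply: (@le_trans _ _ ((1 + 2 / c) * (1 + c / 2 * x ^+ 2))); last first.
  rewrite ler_wpM2l ?expR_ge1Dx// addr_ge0// divr_ge0// ltW//.
have -> : x ^+ 2 = `|x| ^+ 2 by rewrite real_normK// num_real.
have x0 := normr_ge0 x; move: `|x| x0 => y y0.
have -> : (1 + 2 / c) * (1 + c / 2 * y ^+ 2) = 1 + y ^+ 2 + (2 / c + c / 2 * y ^+ 2).
  by field; rewrite gt_eqF.
have : 0 <= 2 / c + c / 2 * y ^+ 2.
  by rewrite addr_ge0// ?divr_ge0 ?mulr_ge0 ?sqr_ge0// ?divr_ge0// ltW.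
have := sqr_ge0 (y - 1); nra.
Qed.

Lemma L1_mulx_gauss : L1 (fun x => x * gauss c 0 x).
Proof.
apply: (@L1_le _ _ (fun x => (1 + 2 / c) * gauss (c / 2) 0 x)).
- by apply: measurable_funM => //; exact: measurable_gauss.
- by apply: L1Zl; apply: L1_gauss; rewrite divr_gt0.
- by move=> x; rewrite normrM (ger0_norm (ltW (gauss_gt0 _ _ _))) gauss_mulx_le.
Qed.

Lemma cvg_gauss_infty : gauss c 0 n%:R @[n --> \oo] --> (0 : R).
Proof.
have h : (c * (n%:R : R))^-1 @[n --> \oo] --> (0 : R).
  have -> : (fun n : nat => (c * (n%:R : R))^-1) = (fun n => c^-1 * (n%:R)^-1).
    by apply/funext => n; rewrite invfM.
  rewrite -[X in _ --> X](mulr0 c^-1); apply: cvgMr => //.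
  by rewrite -cvg_shiftS; exact: cvg_harmonic.
apply: (squeeze_cvgr _ (cvg_cst 0) h); near=> n.
have n0 : (0 < n)%N by near: n; exact: nbhs_infty_gt.
rewrite ltW ?gauss_gt0//= /gauss subr0 expRN lef_pV2 ?posrE ?expR_gt0 ?mulr_gt0 ?ltr0n//.
apply: (le_trans _ (expR_ge1Dx _)); rewrite ler_wpDl//.
apply: ler_wpM2l; first exact: ltW.
by rewrite -natrX ler_nat -[leqLHS]expn1 leq_pexp2l.
Unshelve. all: by end_near. Qed.

(** The shift [theta] treats the real part ([theta = 0]) and the imaginary part ([theta = - pi / 2])
    of the transform at once. *)
Let Y (theta xi : R) := \int[mu]_x (gauss c 0 x * cos (x * xi + theta)).

Let cosb (y : R) : `|cos y| <= 1.
Proof. by rewrite ler_norml cos_geN1 cos_le1. Qed.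
Let sinb (y : R) : `|sin y| <= 1.
Proof. by rewrite ler_norml sin_geN1 sin_le1. Qed.

Let mcos (theta xi : R) : measurable_fun setT (fun x : R => cos (x * xi + theta)).
Proof.
apply: (measurableT_comp (f := cos)).
  by apply: continuous_measurable_fun; exact: continuous_cos.
by apply: measurable_funD => //; exact: measurable_funM.
Qed.

Let msin (theta xi : R) : measurable_fun setT (fun x : R => sin (x * xi + theta)).
Proof.
apply: (measurableT_comp (f := sin)).
  by apply: continuous_measurable_fun; exact: continuous_sin.
by apply: measurable_funD => //; exact: measurable_funM.
Qed.

Let dphase (x xi theta : R) : is_derive x (1 : R) (fun y : R => y * xi + theta) xi.
Proof.
have := derD (derM (der_id x) (der_cst xi x)) (der_cst theta x).
by rewrite mulr0 addr0 mul1r addr0.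
Qed.
Let dphase' (x xi theta : R) : is_derive xi (1 : R) (fun y : R => x * y + theta) x.
Proof.
have := derD (derZ x (der_id xi)) (der_cst theta xi).
by rewrite addr0 mulr1.
Qed.

Let Y_ibp (theta xi : R) :
  \int[mu]_x (- (x * gauss c 0 x * sin (x * xi + theta))) = - (xi / (2 * c)) * Y theta xi.
Proof.
have I1 : L1 (fun x => x * gauss c 0 x * sin (x * xi + theta)).
  exact: (L1_mul_bounded L1_mulx_gauss (msin _ _) (fun x => sinb _)).
have I2 : L1 (fun x => gauss c 0 x * cos (x * xi + theta)).
  exact: (L1_mul_bounded (L1_gauss 0 c0) (mcos _ _) (fun x => cosb _)).
have := @Rint_deriv0 _ (fun x => gauss c 0 x * sin (x * xi + theta))
  (fun x => - (2 * c) * (x * gauss c 0 x * sin (x * xi + theta)) +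
     xi * (gauss c 0 x * cos (x * xi + theta))).
have dF (x : R) : is_derive x (1 : R) (fun x => gauss c 0 x * sin (x * xi + theta))
   (- (2 * c) * (x * gauss c 0 x * sin (x * xi + theta)) +
     xi * (gauss c 0 x * cos (x * xi + theta))).
  apply: (is_derive_eq (derM (der_gauss0 x) (der_sin (dphase x xi theta)))); ring.
move=> /(_ dF) h; have {h} : \int[mu]_x (- (2 * c) * (x * gauss c 0 x * sin (x * xi + theta)) +
     xi * (gauss c 0 x * cos (x * xi + theta))) = 0.
  apply: h.
  - move=> x; have d1 := derM (derM (der_id x) (der_gauss0 x)) (der_sin (dphase x xi theta)).
    have d2 := derM (der_gauss0 x) (der_cos (dphase x xi theta)).
    exact: (der_cont (derD (derZ (- (2 * c)) d1) (derZ xi d2))).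
  - by apply: L1D; exact: L1Zl.
  - apply/norm_cvg0P; apply: (squeeze_cvgr _ (cvg_cst 0) cvg_gauss_infty).
    near=> n; rewrite normr_ge0/= normrM (ger0_norm (ltW (gauss_gt0 _ _ _))).
    by rewrite ler_piMr// ltW// gauss_gt0.
  - apply/norm_cvg0P; apply: (squeeze_cvgr _ (cvg_cst 0) cvg_gauss_infty).
    near=> n; rewrite normr_ge0/= normrM (ger0_norm (ltW (gauss_gt0 _ _ _))).
    rewrite (_ : gauss c 0 (- n%:R) = gauss c 0 n%:R); last by rewrite /gauss !subr0 sqrrN.
    by rewrite ler_piMr// ltW// gauss_gt0.
rewrite RintD; [|exact: L1Zl|exact: L1Zl].
rewrite !RintZl// -/(Y theta xi).
have -> : \int[mu]_x (- (x * gauss c 0 x * sin (x * xi + theta))) =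
   - \int[mu]_x (x * gauss c 0 x * sin (x * xi + theta)).
  by under eq_Rintegral do rewrite -mulN1r; rewrite RintZl// mulN1r.
rewrite mulNr; move: (\int[mu]_x _) => S h.
have e : xi * Y theta xi = 2 * c * S by lra.
have -> : - (xi / (2 * c)) * Y theta xi = - ((xi * Y theta xi) / (2 * c)) by ring.
by rewrite e; field; rewrite gt_eqF.
Unshelve. all: by end_near. Qed.

(** Differentiation under the integral produces the factor [x * gauss], a multiple of the derivative
    of the Gaussian, which [Y_ibp] integrates by parts. The result is a linear differential equation
    for [Y]. *)
Let dY (theta xi : R) : is_derive xi (1 : R) (Y theta) (- (xi / (2 * c)) * Y theta xi).
Proof.
rewrite -Y_ibp.
pose f (t x : R) := gauss c 0 x * cos (x * t + theta).
have df (t x : R) : is_derive t (1 : R) (f ^~ x) (- (x * gauss c 0 x * sin (x * t + theta))).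
  by apply: (is_derive_eq (derZ (gauss c 0 x) (der_cos (dphase' x t theta)))); ring.
have I : (`](xi - 1), (xi + 1)[%classic : set R) xi by rewrite /= in_itv/=; apply/andP; split; lra.
have A1 (t : R) : `](xi - 1), (xi + 1)[%classic t -> mu.-integrable setT (EFin \o f t).
  move=> _; exact: (L1_mul_bounded (L1_gauss 0 c0) (mcos _ _) (fun x => cosb _)).
have A2 (t : R) (y : measurableTypeR R) : `](xi - 1), (xi + 1)[%classic t -> setT y -> derivable (f ^~ y) t 1.
  by move=> _ _; have [] := df t y.
have A3 (t : R) (y : measurableTypeR R) : `](xi - 1), (xi + 1)[%classic t -> setT y ->
    `|partial1of2 f t y| <= `|y * gauss c 0 y|.
  move=> _ _; rewrite partial1of2E (@derive_val _ _ _ _ _ _ _ (df t y)) normrN normrM.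
  by rewrite ler_piMr.
have A4 := @differentiation_under_integral R _ (measurableTypeR R) mu f setT measurableT
  xi (xi - 1) (xi + 1) I A1 A2 _ (fun y => normr_ge0 _) (L1_norm L1_mulx_gauss) A3.
have A5 := @derivable_under_integral R _ (measurableTypeR R) mu f setT measurableT
  xi (xi - 1) (xi + 1) I A1 A2 _ (fun y => normr_ge0 _) (L1_norm L1_mulx_gauss) A3.
split; first exact: A5.
rewrite -derive1E A4; apply: eq_Rintegral => x _.
by rewrite partial1of2E (@derive_val _ _ _ _ _ _ _ (df xi x)).
Qed.

(** By [dY] the product of [Y] with [expR (xi^2 / (4 c))] has derivative zero, so its value is the
    one at [xi = 0]. *)
Lemma fourier_gauss_cos (theta xi : R) :
  \int[mu]_x (gauss c 0 x * cos (x * xi + theta)) =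
  Num.sqrt (pi / c) * cos theta * expR (- (xi ^+ 2 / (4 * c))).
Proof.
pose E (t : R) := expR (t ^+ 2 / (4 * c)).
have dE (t : R) : is_derive t (1 : R) E (E t * (2%:R * t / (4 * c))).
  apply: der_exp.
  apply: (is_derive_eq (derM (der_X 2 (der_id t)) (der_cst (4 * c)^-1 t))).
  by rewrite /=; ring.
have cst : Y theta xi * E xi = Y theta 0 * E 0.
  apply: (@is_derive_0_is_cst _ (fun t => Y theta t * E t)) => t.
  apply: (is_derive_eq (derM (dY theta t) (dE t))).
  by field; rewrite gt_eqF.
have Y0 : Y theta 0 = Num.sqrt (pi / c) * cos theta.
  rewrite /Y; under eq_Rintegral do rewrite mulr0 add0r mulrC.
  by rewrite RintZl; [rewrite Rint_gauss// mulrC|exact: L1_gauss].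
have E0 : E 0 = 1 by rewrite /E expr0n/= mul0r expR0.
have En0 : E xi != 0 by rewrite gt_eqF// expR_gt0.
have -> : expR (- (xi ^+ 2 / (4 * c))) = (E xi)^-1 by rewrite expRN.
by rewrite -Y0 -/(Y theta xi) -(mulfK En0 (Y theta xi)) cst E0 mulr1.
Qed.

Lemma fourier_gauss (xi : R) :
  cintegral (fun x => (gauss c 0 x)%:C * cis (x * xi)) =
  (Num.sqrt (pi / c) * expR (- (xi ^+ 2 / (4 * c))))%:C.
Proof.
rewrite /cintegral /re /im; congr Complex.
  have := fourier_gauss_cos 0 xi; rewrite cos0 mulr1 => <-.
  by apply: eq_Rintegral => x _; rewrite cReM /cis/= mul0r subr0 addr0.
have h := fourier_gauss_cos (- (pi / 2)) xi; rewrite cosN cos_pihalf mulr0 mul0r in h.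
rewrite -[RHS]h.
apply: eq_Rintegral => x _; rewrite cImM /cis/= mul0r addr0.
by rewrite cosD cosN sinN cos_pihalf sin_pihalf mulr0 mulrN1 opprK add0r.
Qed.

End GaussFourier.

Section Bessel.
Context {R : realType}.
Local Notation mu := (@lebesgue_measure R).

Lemma cmeas_cisM : cmeas (fun z : R * R => cis (z.1 * z.2)).
Proof. by apply: cmeas_cis; exact: measurable_funM. Qed.

Lemma modulus_cis_le1 (r : R) : modulus (cis r) <= 1.
Proof. by rewrite modulus_cis. Qed.

(** Schur's test with a Gaussian weight in frequency: the kernel is a Gaussian in [x - y], whose
    mass is [2 * pi] whatever the value of [eps]. *)
Lemma bessel_gauss (eps : R) (h : R -> R[i]) : 0 < eps -> cintegrable h ->
  (\int[mu]_xi (gauss eps 0 xi * modulus (cintegral (fun x => h x * cis (x * xi))) ^+ 2)%:E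
   <= (2 * pi)%:E * \int[mu]_x (modulus (h x) ^+ 2)%:E)%E.
Proof.
move=> eps0 ih; pose s := Num.sqrt (pi / eps).
have e4 : 0 < (4 * eps)^-1 by rewrite invr_gt0 mulr_gt0.
pose k (z : R * R) := s * gauss (4 * eps)^-1 z.1 z.2.
have s0 : 0 <= s by exact: sqrtr_ge0.
have kE x y : k (x, y) = s * gauss (4 * eps)^-1 y x.
  by rewrite /k /gauss/= -[y - x]opprB sqrrN.
have ki y : (\int[mu]_x (s * gauss (4 * eps)^-1 y x)%:E = (2 * pi)%:E)%E.
  rewrite -L1_fineK; last by apply: L1Zl; exact: L1_gauss.
  rewrite RintZl; last exact: L1_gauss.
  rewrite Rint_gauss// -sqrtrM ?divr_ge0 ?pi_ge0 ?ltW//.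
  have -> : pi / eps * (pi / (4 * eps)^-1) = (2 * pi) ^+ 2 :> R by field; rewrite gt_eqF.
  by rewrite sqrtr_sqr ger0_norm// mulr_ge0// pi_ge0.
apply: (@schur _ (gauss eps 0) (fun z => cis (z.1 * z.2)) k (2 * pi)) => //.
- exact: L1_gauss.
- by move=> xi; rewrite ltW// gauss_gt0.
- exact: cmeas_cisM.
- by move=> z; exact: modulus_cis_le1.
- apply: measurable_funM => //; apply: measurableT_comp => //; apply: measurableT_comp => //.
  by apply: measurable_funM => //; apply: measurable_funX; exact: measurable_funB.
- by move=> z; rewrite mulr_ge0// ltW// gauss_gt0.
- move=> x y.
  have -> : (fun xi => (gauss eps 0 xi)%:C * cis ((x, xi).1 * (x, xi).2) * conjc (cis ((y, xi).1 * (y, xi).2))) =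
      (fun xi => (gauss eps 0 xi)%:C * cis (xi * (x - y))).
    apply/funext => xi; rewrite conjc_cis -mulrA -cisD; congr (_ * cis _).
    by rewrite /=; ring.
  rewrite fourier_gauss// modulus_real ger0_norm; last by rewrite mulr_ge0 ?expR_ge0.
  rewrite kE /gauss/s le_eqVlt; apply/orP; left; apply/eqP; congr (_ * expR (- _)).
  exact: mulrC.
- by move=> x; rewrite /k/= ki.
- by move=> y; under eq_integral do rewrite kE; rewrite ki.
Qed.

(** The Plancherel constant [2 * pi], times the loss [expR 1] incurred when the Gaussian weight is
    removed. *)
Definition bessel_cst : R := expR 1 * (2 * pi).

Lemma bessel (h : R -> R[i]) : cintegrable h ->
  (\int[mu]_xi (modulus (cintegral (fun x => h x * cis (x * xi))) ^+ 2)%:E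
   <= bessel_cst%:E * \int[mu]_x (modulus (h x) ^+ 2)%:E)%E.
Proof.
move=> ih.
have mQ : measurable_fun setT (fun xi => modulus (cintegral (fun x => h x * cis (x * xi))) ^+ 2).
  apply: measurable_funX; apply: measurable_modulus.
  by apply: (cmeas_cintegral ih cmeas_cisM (M := 1)) => z; exact: modulus_cis_le1.
apply: Ie_exhaust => //; first by move=> x; exact: sqr_ge0.
move=> n; rewrite Ie_restrict//.
(* For this width [eps * x^2 <= 1] on [[-n, n]], so the Gaussian is at least [expR (-1)] there. *)
have eps0 : 0 < (1 + (n%:R : R) ^+ 2)^-1 by rewrite invr_gt0 ltr_pwDl// sqr_ge0.
rewrite /bessel_cst EFinM -muleA.
apply: le_trans (lee_wpmul2l _ (bessel_gauss eps0 ih)); last by rewrite lee_fin expR_ge0.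
rewrite -IeZ ?expR_ge0//; last 2 first.
- by apply: measurable_funM => //; exact: measurable_gauss.
- by move=> x; rewrite mulr_ge0 ?sqr_ge0// ltW// gauss_gt0.
apply: le_Ie.
- by apply: measurable_funM => //; apply: measurable_indic; exact: measurable_itv.
- by apply: measurable_funM => //; apply: measurable_funM => //; exact: measurable_gauss.
- by move=> x; rewrite mulr_ge0 ?sqr_ge0// indicE; case: (_ \in _).
- move=> x; rewrite indicE; have [|_] := boolP (x \in _); last first.
    by rewrite mulr0 mulr_ge0 ?expR_ge0// mulr_ge0 ?sqr_ge0// ltW// gauss_gt0.
  rewrite inE/= in_itv/= -ler_norml => xn.
  rewrite mulr1 mulrA ler_peMl ?sqr_ge0//.
  rewrite /gauss subr0 -expRD -[leLHS]expR0 ler_expR subr_ge0.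
  rewrite mulrC ler_pdivrMr ?mul1r; last by rewrite ltr_pwDl// sqr_ge0.
  rewrite (@le_trans _ _ (n%:R ^+ 2))//; last by rewrite lerDr.
  by rewrite -[x ^+ 2]real_normK ?num_real// lerXn2r ?nnegrE.
Qed.

End Bessel.

(** * Convergence of Gaussian averages *)

Section ApproximateIdentity.
Context {R : realType}.
Local Notation mu := (@lebesgue_measure R).

(** The heat kernel at time [1 / (4 (n + 1))]. *)
Definition heat (n : nat) (x y : R) : R := Num.sqrt (n.+1%:R / pi) * gauss n.+1%:R x y.

Lemma heat_gt0 n x y : 0 < heat n x y.
Proof. by rewrite mulr_gt0 ?gauss_gt0// sqrtr_gt0 divr_gt0 ?pi_gt0. Qed.

Lemma measurable_heat n x : measurable_fun setT (heat n x).
Proof. by apply: measurable_funM => //; exact: measurable_gauss. Qed.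

Lemma L1_heat n x : L1 (heat n x).
Proof. by apply: L1Zl; exact: L1_gauss. Qed.

Lemma Rint_heat n x : \int[mu]_y heat n x y = 1.
Proof.
rewrite RintZl; last exact: L1_gauss.
rewrite Rint_gauss// -sqrtrM ?divr_ge0 ?pi_ge0//.
by rewrite mulrA mulfVK ?gt_eqF ?pi_gt0// divff ?sqrtr1// gt_eqF.
Qed.

Lemma heat_le n x y : heat n x y <= Num.sqrt (n.+1%:R / pi) * gauss 1 x y.
Proof.
rewrite /heat ler_wpM2l ?sqrtr_ge0// /gauss ler_expR lerN2 mul1r.
by rewrite ler_peMl ?sqr_ge0// ler1n.
Qed.

Lemma L1_mul_heat (f : R -> R) n x : measurable_fun setT f ->
  L1 (fun y => f y * gauss 1 x y) -> L1 (fun y => f y * heat n x y).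
Proof.
move=> mf If; apply: (@L1_le _ _ (fun y => Num.sqrt (n.+1%:R / pi) * `|f y * gauss 1 x y|)).
- by apply: measurable_funM => //; exact: measurable_heat.
- by apply: L1Zl; exact: L1_norm.
- move=> y; rewrite [`|f y * heat _ _ _|]normrM [`|f y * gauss _ _ _|]normrM.
  rewrite (ger0_norm (ltW (heat_gt0 _ _ _))) (ger0_norm (ltW (gauss_gt0 _ _ _))).
  rewrite [leRHS]mulrCA; apply: ler_wpM2l => //; exact: heat_le.
Qed.

Lemma heat_superlevel n x s : 0 < s ->
  exists r : R, forall y, (s < heat n x y) = (`|x - y| < r).
Proof.
move=> s0; pose N := Num.sqrt (n.+1%:R / pi) : R.
have N0 : 0 < N by rewrite sqrtr_gt0 divr_gt0 ?pi_gt0.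
have E y : (s < heat n x y) = (`|x - y| ^+ 2 < ln (N / s) / n.+1%:R).
  rewrite /heat -/N -ltr_pdivrMl// mulrC /gauss -(@lnK _ (s / N)) ?posrE ?divr_gt0//.
  rewrite ltr_expR ltrNr ltr_pdivlMr// mulrC -lnV ?posrE ?divr_gt0// invf_div.
  by rewrite -[`|_|]distrC real_normK ?num_real.
have [l0|l0] := ltP 0 (ln (N / s) / n.+1%:R).
  exists (Num.sqrt (ln (N / s) / n.+1%:R)) => y; rewrite E.
  rewrite -{1}(sqr_sqrtr (ltW l0)) ltr_pXn2r// ?nnegrE ?sqrtr_ge0//.
exists 0 => y; rewrite E [RHS]ltNge normr_ge0 /=; apply/negbTE; rewrite -leNgt.
by rewrite (le_trans l0)// sqr_ge0.
Qed.

Section near.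
Variables (x eta r1 : R) (v : R -> R).
Hypothesis mv : measurable_fun setT v.
Hypothesis v0 : forall y, 0 <= v y.
Hypothesis v_ball : forall r : R, 0 < r -> r <= r1 ->
  (\int[mu]_(y in ball x r) (v y)%:E <= eta%:E * mu (ball x r))%E.
Hypothesis eta0 : 0 <= eta.

Let mball (r : R) : measurable (ball x r : set (measurableTypeR R)).
Proof. exact: measurable_ball. Qed.

(** Superlevel sets of the kernel are balls of arbitrary radius, while [v_ball] covers only radii up
    to [r1]. Cutting [v] to the ball of radius [r1] replaces [r] by the smaller of the two. *)
Let v_ball_min (r : R) :
  (\int[mu]_y (v y * \1_(ball x r1) y * \1_(ball x r) y)%:E <=
   eta%:E * \int[mu]_y (\1_(ball x r) y)%:E)%E.
Proof.
rewrite integral_indic//= setIT.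
have [r0|r0] := leP r 0.
  rewrite (_ : ball x r = set0); last exact/ball0.
  rewrite measure0 mule0; under eq_integral do rewrite indic0 /= mulr0.
  by rewrite integral0.
have [r10|r10] := leP r1 0.
  rewrite (_ : ball x r1 = set0); last exact/ball0.
  under eq_integral do rewrite indic0 /= mulr0 mul0r.
  by rewrite integral0 mule_ge0.
pose m := Num.min r1 r.
have m0 : 0 < m by rewrite lt_min r10.
have -> : (\int[mu]_y (v y * \1_(ball x r1) y * \1_(ball x r) y)%:E =
  \int[mu]_(y in ball x m) (v y)%:E)%E.
  rewrite [RHS]integral_mkcond; apply: eq_integral => y _.
  rewrite patchE !indicE.
  have -> : (y \in (ball x m : set R)) = (y \in (ball x r1 : set R)) && (y \in (ball x r : set R)).
    apply/idP/andP; rewrite !inE /ball/= /m lt_min; first by move/andP.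
    by move=> [-> ->].
  by case: (y \in (ball x r1 : set R)); case: (y \in (ball x r : set R)); rewrite /= ?mulr1 ?mulr0 ?mul0r.
apply: (le_trans (v_ball m0 _)); first by rewrite /m ge_min lexx.
apply: lee_wpmul2l; first by rewrite lee_fin.
apply: le_measure; rewrite ?inE; [exact: mball|exact: mball|].
by apply: le_ball; rewrite /m ge_min lexx orbT.
Qed.

(* Layer cake: the superlevel sets of the kernel are balls centred at [x]. *)
Lemma heat_near n : (\int[mu]_y (v y * \1_(ball x r1) y * heat n x y)%:E <= eta%:E)%E.
Proof.
pose A := [set z : R * R | (0 < z.2) && (z.2 < heat n x z.1)].
have mA : measurable (A : set (measurableTypeR R * measurableTypeR R)).
  have mb : measurable_fun setT (fun z : measurableTypeR R * measurableTypeR R =>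
      (0 < z.2) && (z.2 < heat n x z.1)).
    apply: measurable_and.
      apply: measurable_fun_ltr => //; exact: measurable_snd.
    apply: measurable_fun_ltr; first exact: measurable_snd.
    exact: (measurableT_comp (measurable_heat n x) measurable_fst).
  have := mb measurableT [set true] I; rewrite setTI.
  by congr measurable; apply/seteqP; split => z /=.
pose a (z : R * R) : R := \1_A z.
have ma : measurable_fun setT a by exact: measurable_indic.
have ay y : (\int[mu]_s (a (y, s))%:E = (heat n x y)%:E)%E.
  rewrite (_ : (fun s => (a (y, s))%:E) = (fun s => (\1_(`]0%R, heat n x y[%classic) s)%:E)).
    rewrite integral_indic//= ?setIT.
    rewrite lebesgue_measure_itv/= lte_fin heat_gt0 oppr0 ?adde0//.
  apply/funext => s; rewrite /a !indicE; congr ((_ : bool)%:R%:E).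
have as_ s : (\int[mu]_y (v y * \1_(ball x r1) y * a (y, s))%:E <=
    eta%:E * \int[mu]_y (a (y, s))%:E)%E.
  have [s0|s0] := ltP 0 s; last first.
    rewrite (_ : (fun y => (v y * \1_(ball x r1) y * a (y, s))%:E) = cst 0%E); last first.
      apply/funext => y; have yA : ((y, s) \in A) = false.
        by apply/negbTE; rewrite notin_setE /A/= ltNge s0.
      have aE : a (y, s) = 0 by rewrite /a indicE yA.
      by rewrite aE mulr0.
    by rewrite integral0 mule_ge0 ?lee_fin//; apply: integral_ge0 => y _; rewrite lee_fin.
  have [r hr] := heat_superlevel n x s0.
  have aE y : a (y, s) = \1_(ball x r) y.
    rewrite /a !indicE; congr ((_ : bool)%:R).
    by apply/idP/idP; rewrite !inE /A/= s0 /= hr /ball.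
  by under eq_integral do rewrite aE; under [in leRHS]eq_integral do rewrite aE.
have mv1 : measurable_fun setT (fun y => v y * \1_(ball x r1) y).
  by apply: measurable_funM => //; apply: measurable_indic; exact: mball.
have v10 y : 0 <= v y * \1_(ball x r1) y by rewrite mulr_ge0.
have mva : measurable_fun setT (fun z : R * R => v z.1 * \1_(ball x r1) z.1 * a z).
  by apply: measurable_funM => //; exact: (measurableT_comp mv1 measurable_fst).
have -> : (\int[mu]_y (v y * \1_(ball x r1) y * heat n x y)%:E =
    \int[mu]_y \int[mu]_s (v y * \1_(ball x r1) y * a (y, s))%:E)%E.
  apply: eq_integral => y _; rewrite IeZ ?ay ?EFinM//.
  exact: (measurableT_comp ma (pair1_measurable y)).
rewrite (fubini_tonelli (fun z : measurableTypeR R * measurableTypeR R =>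
   (v z.1 * \1_(ball x r1) z.1 * a z)%:E)); last 2 first.
- exact/measurable_EFinP.
- by move=> z; rewrite lee_fin mulr_ge0.
have mGa : measurable_fun setT (fun s : R => \int[mu]_y (a (y, s))%:E)%E.
  apply: (@measurable_fun_fubini_tonelli_G _ _ (measurableTypeR R) (measurableTypeR R) R mu
    (fun z => (a z)%:E)); first exact/measurable_EFinP.
  by move=> z; rewrite lee_fin.
apply: (@le_trans _ _ (\int[mu]_s (eta%:E * \int[mu]_y (a (y, s))%:E))%E).
  apply: ge0_le_integral => //.
  - by move=> s _; apply: integral_ge0 => y _; rewrite lee_fin mulr_ge0.
  - apply: (@measurable_fun_fubini_tonelli_G _ _ (measurableTypeR R) (measurableTypeR R) R mu
      (fun z => (v z.1 * \1_(ball x r1) z.1 * a z)%:E)); first exact/measurable_EFinP.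
    by move=> z; rewrite lee_fin mulr_ge0.
  - exact: measurable_funeM.
rewrite ge0_integralZl_EFin//; last by move=> s _; apply: integral_ge0 => y _; rewrite lee_fin.
rewrite -(fubini_tonelli (fun z : measurableTypeR R * measurableTypeR R => (a z)%:E)); last 2 first.
- exact/measurable_EFinP.
- by move=> z; rewrite lee_fin.
under eq_integral do rewrite ay.
by rewrite -L1_fineK ?Rint_heat ?mule1//; exact: L1_heat.
Qed.

End near.

(** One unit of the exponent is kept as [gauss 1 x y], against which the data are integrable; this
    is why the index is [n.+1]. The rest is [expR (- t)] with [t >= (n + 1) r^2], and
    [expR (- t) <= 4 / t^2] outweighs the normalising factor, which is at most
    [n + 2 <= 2 (n + 1)]. *)
Lemma heat_far n (x r y : R) : 0 < r -> r <= `|y - x| ->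
  heat n.+1 x y <= 8 / r ^+ 4 * (n.+1%:R)^-1 * gauss 1 x y.
Proof.
move=> r0 ry; rewrite /heat.
have -> : gauss n.+2%:R x y = expR (- (n.+1%:R * (y - x) ^+ 2)) * gauss 1 x y.
  by rewrite /gauss -expRD; congr expR; rewrite -[n.+2%:R]natr1; ring.
rewrite mulrA; apply: ler_wpM2r; first by rewrite ltW ?gauss_gt0.
set t := n.+1%:R * r ^+ 2 : R.
have t0 : 0 < t by rewrite mulr_gt0// exprn_gt0.
have e1 : expR (- (n.+1%:R * (y - x) ^+ 2)) <= 4 / t ^+ 2.
  apply: (@le_trans _ _ (expR (- t))).
    rewrite ler_expR lerN2 ler_wpM2l// -[(y - x) ^+ 2]real_normK ?num_real//.
    by rewrite lerXn2r ?nnegrE// ltW.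
  rewrite expRN -[leRHS]invrK lef_pV2 ?posrE ?expR_gt0//; last first.
    by rewrite invr_gt0 divr_gt0// exprn_gt0.
  have -> : expR t = expR (t / 2) ^+ 2 by rewrite expr2 -expRD; congr expR; field.
  have -> : (4 / t ^+ 2)^-1 = (t / 2) ^+ 2 by field; rewrite gt_eqF.
  rewrite lerXn2r ?nnegrE ?expR_ge0// ?divr_ge0 ?ltW//.
  by rewrite (lt_le_trans _ (expR_ge1Dx _))// ltrDr.
have e2 : Num.sqrt (n.+2%:R / pi) <= n.+2%:R :> R.
  rewrite -[leRHS](ger0_norm (ler0n R n.+2)) -sqrtr_sqr ler_sqrt ?sqr_ge0//.
  rewrite ler_pdivrMr ?pi_gt0//.
  have := @pi_ge2 R; have : 2 <= n.+2%:R :> R by rewrite ler_nat.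
  by move: (n.+2%:R) pi => N p hN hp; nra.
apply: (le_trans (ler_pM (sqrtr_ge0 _) (expR_ge0 _) e2 e1)).
have -> : 8 / r ^+ 4 / n.+1%:R = 2 * n.+1%:R * (4 / t ^+ 2) :> R.
  by rewrite /t; field; rewrite ?gt_eqF// nat1r gt_eqF.
apply: ler_wpM2r; first by rewrite divr_ge0// sqr_ge0.
by rewrite -natrM ler_nat mul2n -addnn addSn addnS ltnS ltnS leq_addr.
Qed.

Lemma gauss_locally_integrable (f : R -> R) : measurable_fun setT f ->
  L1 (fun y => f y * gauss 1 0 y) -> locally_integrable setT f.
Proof.
move=> mf If; split => //; first exact: openT.
move=> K _ cK; have [M [_ hM]] := compact_bounded cK.
have {hM} := hM (`|M| + 1) _; rewrite /globally/= => hM.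
have hK y : K y -> `|y| <= `|M| + 1.
  by apply: hM; rewrite (le_lt_trans (ler_norm _))// ltrDl.
have mK : measurable (K : set (measurableTypeR R)) by exact: compact_measurable.
pose B := expR ((`|M| + 1) ^+ 2).
apply: (@le_lt_trans _ _ (\int[mu]_(y in K) (B * `|f y * gauss 1 0 y|)%:E)%E).
  apply: ge0_le_integral => //.
  - by apply/measurable_EFinP; apply: measurable_funTS; exact: measurableT_comp.
  - apply/measurable_EFinP; apply: measurable_funTS; apply: measurable_funM => //.
    by apply: measurableT_comp => //; exact: L1_meas.
  - move=> y Ky; rewrite lee_fin normrM mulrCA ler_peMr//.
    rewrite ger0_norm ?(ltW (gauss_gt0 _ _ _))// /B /gauss -expRD -[leLHS]expR0 ler_expR.
    rewrite subr0 mul1r subr_ge0 -[y ^+ 2]real_normK ?num_real//.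
    by rewrite lerXn2r ?nnegrE ?addr_ge0// hK.
have IB := L1Zl B (L1_norm If).
apply: le_lt_trans (L1_int_lty IB).
apply: ge0_subset_integral => //; first by apply/measurable_EFinP; exact: L1_meas IB.
by move=> y _; rewrite lee_fin mulr_ge0// expR_ge0.
Qed.

(** Convergence holds at every Lebesgue point: inside a ball on which the averages of [|f - f x|]
    are small, [heat_near] applies, and the contribution from outside is of order [1 / n].
    Integrability against Gaussians only is what functions representing tempered distributions
    provide. *)
Theorem heat_cvg (f : R -> R) : measurable_fun setT f ->
  (forall x, L1 (fun y => f y * gauss 1 x y)) ->
  {ae mu, forall x, \int[mu]_y (f y * heat n x y) @[n --> \oo] --> f x}.
Proof.
move=> mf If.
have := lebesgue_differentiation (gauss_locally_integrable mf (If 0)).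
apply: (@filterS _ _ (ae_filter_ringOfSetsType mu)) => x hx.
pose v y := `|f y - f x|.
have mv : measurable_fun setT v by apply: measurableT_comp => //; exact: measurable_funB.
have Iv : L1 (fun y => v y * gauss 1 x y).
  apply: (@L1_le _ _ (fun y => `|f y * gauss 1 x y| + `|f x| * gauss 1 x y)).
  - by apply: measurable_funM => //; exact: measurable_gauss.
  - by apply: L1D; [exact: L1_norm|apply: L1Zl; exact: L1_gauss].
  - move=> y; rewrite /v !normrM normr_id (ger0_norm (ltW (gauss_gt0 _ _ _))) -mulrDl.
    by rewrite ler_wpM2r ?(ltW (gauss_gt0 _ _ _))// ler_normB.
have E n : `|\int[mu]_y (f y * heat n x y) - f x| <= \int[mu]_y (v y * heat n x y).
  have I1 := L1_mul_heat n mf (If x).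
  have I2 : L1 (fun y => f x * heat n x y) by apply: L1Zl; exact: L1_heat.
  have -> : f x = \int[mu]_y (f x * heat n x y).
    by rewrite RintZl ?Rint_heat ?mulr1//; exact: L1_heat.
  rewrite -RintB//.
  have I3 := L1B I1 I2.
  apply: (le_trans (le_normr_Rintegral measurableT I3)).
  apply: le_Rint; [exact: L1_norm|exact: L1_mul_heat|].
  move=> y; rewrite -mulrBl normrM (ger0_norm (ltW (heat_gt0 _ _ _))).
  by [].
apply/cvgrPdist_le => eta eta0.
have eta2 : 0 < eta / 2 by rewrite divr_gt0.
move/fine_cvgP : hx => [hfin /cvgrPdist_le /(_ _ eta2) hd].
have [r1 r10 hr1] : exists2 r1 : R, 0 < r1 & forall r, 0 < r -> r <= r1 ->
    (\int[mu]_(y in ball x r) (v y)%:E <= (eta / 2)%:E * mu (ball x r))%E.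
  have : \forall r \near (0 : R)^'+, (davg f x r <= (eta / 2)%:E)%E.
    near=> r.
    have h1 : davg f x r \is a fin_num by near: r.
    have h2 : `|0 - fine (davg f x r)| <= eta / 2 by near: r.
    rewrite -(fineK h1) lee_fin; apply: le_trans h2; rewrite sub0r normrN.
    exact: ler_norm.
  (* The neighbourhood gives radii strictly below [d]; halving allows [r <= r1]. *)
  move=> [d /= d0 hd']; exists (d / 2); first by rewrite divr_gt0.
  move=> r r0 rd; have h : (davg f x r <= (eta / 2)%:E)%E.
    apply: hd' => //=; rewrite sub0r normrN gtr0_norm//.
    by rewrite (le_lt_trans rd)// ltr_pdivrMr// ltr_pMr// ltr1n.
  have mb : mu (ball x r) = (r *+ 2)%:E by rewrite lebesgue_measure_ball// ltW.
  move: h; rewrite /davg /iavg mb inver mulrn_eq0/= (gt_eqF r0) => h.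
  by rewrite muleC -lee_pdivrMl// mulrn_wgt0.
have v0 y : 0 <= v y by exact: normr_ge0.
pose B := \int[mu]_y (v y * gauss 1 x y).
have B0 : 0 <= B by apply: Rintegral_ge0 => y _; rewrite mulr_ge0// ltW// gauss_gt0.
have hcv : (8 / r1 ^+ 4 * B) * n.+1%:R^-1 @[n --> \oo] --> (0 : R).
  by rewrite -[X in _ --> X](mulr0 (8 / r1 ^+ 4 * B)); apply: cvgMr => //; exact: cvg_harmonic.
have : \forall n \near \oo, `|f x - \int[mu]_y (f y * heat n.+1 x y)| <= eta.
  move/cvgrPdist_le : hcv => /(_ _ eta2) hcv.
  near=> n.
  have hn : `|0 - (8 / r1 ^+ 4 * B) * n.+1%:R^-1| <= eta / 2 by near: n.
  rewrite distrC (le_trans (E _))// [leRHS]splitr.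
  have Ivh := L1_mul_heat n.+1 mv Iv.
  rewrite (_ : (fun y => v y * heat n.+1 x y) = (fun y => v y * \1_(ball x r1) y * heat n.+1 x y +
     v y * \1_(~` ball x r1) y * heat n.+1 x y)); last first.
    by apply/funext => y; rewrite !indicE in_setC; case: (_ \in _) => /=; ring.
  have mb : measurable (ball x r1 : set (measurableTypeR R)) by exact: measurable_ball.
  have J1 : L1 (fun y => v y * \1_(ball x r1) y * heat n.+1 x y).
    under [X in L1 X]eq_fun do rewrite mulrAC.
    apply: (L1_mul_bounded (M := 1) Ivh); first exact: measurable_indic.
    by move=> y; rewrite indicE; case: (_ \in _); rewrite ?normr1 ?normr0.
  have J2 : L1 (fun y => v y * \1_(~` ball x r1) y * heat n.+1 x y).
    under [X in L1 X]eq_fun do rewrite mulrAC.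
    apply: (L1_mul_bounded (M := 1) Ivh); first by apply: measurable_indic; exact: measurableC.
    by move=> y; rewrite indicE; case: (_ \in _); rewrite ?normr1 ?normr0.
  rewrite RintD//; apply: lerD.
    rewrite Ie_Rint//; apply: heat_near => //; last exact: ltW.
  apply: le_trans hn; rewrite sub0r normrN ger0_norm; last first.
    by rewrite mulr_ge0// ?invr_ge0// mulr_ge0// divr_ge0// exprn_ge0// ltW.
  rewrite mulrAC -RintZl//; apply: le_Rint => //; first exact: L1Zl.
  move=> y; rewrite indicE in_setC.
  have [|] := boolP (y \in (ball x r1 : set R)).
    rewrite /= mulr0 mul0r => _; apply: mulr_ge0.
        by rewrite mulr_ge0// ?invr_ge0// divr_ge0// exprn_ge0// ltW.
      by apply: mulr_ge0 => //; exact: ltW (gauss_gt0 _ _ _).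
  rewrite notin_setE /ball/= => /negP; rewrite -leNgt => h.
  rewrite mulr1 [leRHS]mulrCA; apply: ler_wpM2l; first exact: normr_ge0.
  by apply: heat_far => //; rewrite distrC.
(* The estimate was proved for [heat n.+1], hence the shift of the index. *)
move=> [N _ hN]; exists N.+1 => // -[|n] //= nN; exact: hN.
Unshelve. all: by end_near. Qed.


Lemma heat_cvgC (f : R -> R[i]) : cmeas f ->
  (forall x, cintegrable (fun y => f y * (gauss 1 x y)%:C)) ->
  {ae mu, forall x, modulus (cintegral (fun y => f y * (heat n x y)%:C) - f x) @[n --> \oo] --> (0 : R)}.
Proof.
move=> mf If.
have [mf1 mf2] : measurable_fun setT (re f) /\ measurable_fun setT (im f) by exact: mf.
have E1 (h : R -> R) : re (fun y => f y * (h y)%:C) = fun y => re f y * h y.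
  by apply/funext => y; rewrite /re cReM/= mulr0 subr0.
have E2 (h : R -> R) : im (fun y => f y * (h y)%:C) = fun y => im f y * h y.
  by apply/funext => y; rewrite /im cImM/= mulr0 add0r.
have I1 x : L1 (fun y => re f y * gauss 1 x y) by rewrite -E1; case: (If x).
have I2 x : L1 (fun y => im f y * gauss 1 x y) by rewrite -E2; case: (If x).
have h1 := heat_cvg mf1 I1; have h2 := heat_cvg mf2 I2.
apply: (@filterS2 _ _ (ae_filter_ringOfSetsType mu) _ _ _ _ h1 h2) => x {}h1 {}h2.
have h3 : `|\int[mu]_y (re f y * heat n x y) - re f x| + `|\int[mu]_y (im f y * heat n x y) - im f x|
    @[n --> \oo] --> (0 : R).
  rewrite -[X in _ --> X](addr0 0); apply: cvgD.
    by apply/norm_cvg0P; rewrite -(subrr (re f x)); apply: cvgB => //; exact: cvg_cst.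
  by apply/norm_cvg0P; rewrite -(subrr (im f x)); apply: cvgB => //; exact: cvg_cst.
apply: (squeeze_cvgr _ (cvg_cst 0) h3); near=> n.
rewrite modulus_ge0/=; apply: (le_trans (modulus_le_ReIm _)).
by rewrite cReD cReN cImD cImN /cintegral/= E1 E2.
Unshelve. all: by end_near. Qed.

End ApproximateIdentity.

(** * Oscillatory integrals of van der Corput type *)

Section Continuity.
Context {R : realType}.
Implicit Types (f g : R -> R) (x : R).

Lemma contD f g x : {for x, continuous f} -> {for x, continuous g} ->
  {for x, continuous (fun y => f y + g y)}.
Proof. by move=> cf cg; exact: cvgD. Qed.

Lemma contN f x : {for x, continuous f} -> {for x, continuous (fun y => - f y)}.
Proof. by move=> cf; exact: cvgN. Qed.

Lemma contM f g x : {for x, continuous f} -> {for x, continuous g} ->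
  {for x, continuous (fun y => f y * g y)}.
Proof. by move=> cf cg; exact: cvgM. Qed.

Lemma contV f x : f x != 0 -> {for x, continuous f} -> {for x, continuous (fun y => (f y)^-1)}.
Proof. by move=> fx cf; exact: cvgV. Qed.

Lemma cont_comp (h : R -> R) f x : {for x, continuous f} -> {for f x, continuous h} ->
  {for x, continuous (fun y => h (f y))}.
Proof. by move=> cf ch; exact: (continuous_comp cf ch). Qed.

Lemma cont_cst (c : R) x : {for x, continuous (fun=> c)}.
Proof. exact: cvg_cst. Qed.

Lemma cont_id x : {for x, continuous (fun y : R => y)}.
Proof. exact: cvg_id. Qed.

Lemma cont_cos f x : {for x, continuous f} -> {for x, continuous (fun y => cos (f y))}.
Proof. by move=> cf; apply: cont_comp => //; exact: continuous_cos. Qed.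

Lemma cont_sin f x : {for x, continuous f} -> {for x, continuous (fun y => sin (f y))}.
Proof. by move=> cf; apply: cont_comp => //; exact: continuous_sin. Qed.

Lemma cont_norm f x : {for x, continuous f} -> {for x, continuous (fun y => `|f y|)}.
Proof. by move=> cf; apply: cvg_norm. Qed.

Lemma cont_powR (p x : R) : 0 < x -> {for x, continuous (fun y => y `^ p)}.
Proof. by move=> x0; exact: (der_cont (der_powR p x0)). Qed.

Lemma cont_bounded (a b : R) f : a <= b -> (forall x, a <= x <= b -> {for x, continuous f}) ->
  exists2 B, 0 <= B & forall x, a <= x <= b -> `|f x| <= B.
Proof.
move=> ab cf; have cn : {within `[a, b], continuous (fun y => `|f y|)}.
  by apply: cont_within => x xab; apply: cont_norm; exact: cf.
have [c _ hc] := EVT_max ab cn; exists `|f c|; first exact: normr_ge0.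
by move=> x xab; apply: hc; rewrite in_itv.
Qed.

End Continuity.

Section Oscillatory.
Context {R : realType}.
Local Notation mu := (@lebesgue_measure R).

(** Integration by parts in comparison form: [g] is an exact derivative with integral zero, so [f]
    may be replaced by [f - g], and the bound [h] of the difference is integrated through its
    primitive [H]. *)
Lemma Rint_compare (b e : R) (f g h G H : R -> R) : b <= e ->
  (forall x, b <= x <= e -> {for x, continuous f}) ->
  (forall x, b <= x <= e -> {for x, continuous g}) ->
  (forall x, b <= x <= e -> {for x, continuous h}) ->
  (forall x, b <= x <= e -> is_derive x (1 : R) G (g x)) ->
  (forall x, b <= x <= e -> is_derive x (1 : R) H (h x)) ->
  G b = G e -> (forall x, b <= x <= e -> `|f x - g x| <= h x) ->
  `|\int[mu]_(x in `[b, e]) f x| <= H e - H b.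
Proof.
move=> be cf cg ch dG dH Gbe fgh.
have mI : measurable (`[b, e]%classic : set (measurableTypeR R)) by exact: measurable_itv.
have If := cont_integrable cf; have Ig := cont_integrable cg; have Ih := cont_integrable ch.
have cfg x : b <= x <= e -> {for x, continuous (fun y => f y - g y)}.
  by move=> xbe; apply: contD; [exact: cf|apply: contN; exact: cg].
have Ifg := cont_integrable cfg.
have -> : \int[mu]_(x in `[b, e]) f x = \int[mu]_(x in `[b, e]) (f x - g x).
  by rewrite RintegralB// (FTC2 be dG cg) Gbe subrr subr0.
apply: (le_trans (le_normr_Rintegral mI Ifg)).
rewrite -(FTC2 be dH ch); apply: le_Rintegral; [exact: mI| |exact: Ih|].
  by apply: cont_integrable => x xbe; apply: cont_norm; exact: cfg.
by move=> x; rewrite /= in_itv/=; exact: fgh.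
Qed.

Variable a : R.
Hypothesis a0 : 0 < a.
Hypothesis a1 : a != 1.

Definition phase (x t c xi : R) : R := x * xi + t * xi `^ a + c.

Lemma der_phase (x t c xi : R) : 0 < xi ->
  is_derive xi (1 : R) (phase x t c) (x + t * (a * xi `^ (a - 1))).
Proof.
move=> xi0.
have := derD (derD (derZ x (der_id xi)) (derZ t (der_powR a xi0))) (der_cst c xi).
by rewrite mulr1 addr0.
Qed.

Lemma cont_phase (x t c xi : R) : 0 < xi -> {for xi, continuous (phase x t c)}.
Proof. by move=> xi0; exact: (der_cont (der_phase x t c xi0)). Qed.

Section vdc.
Variables (psi dpsi : R -> R).
Hypothesis psi1 : psi 1 = 0.
Hypothesis psi4 : psi 4 = 0.
Hypothesis psi_der : forall xi : R, 1 <= xi <= 4 -> is_derive xi (1 : R) psi (dpsi xi).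
Hypothesis dpsi_cont : forall xi : R, 1 <= xi <= 4 -> {for xi, continuous dpsi}.

(* The frequency variable that linearises the time oscillation is [om = xi^a]; the derivative
   of the phase with respect to [om] is [P], whose own derivative does not depend on [t]. With
   [D = |x|] one writes [1 = P q + D / (P^2 + D)] where [q = P / (P^2 + D)], integrates the
   first term by parts and recognises the derivative of [atan (P / sqrt D)] in all others. *)
Lemma van_der_corput : exists2 C : R, 0 < C & forall x t c : R, x != 0 ->
  `|\int[mu]_(xi in `[1, 4]) (a * xi `^ (a - 1) * psi xi * cos (phase x t c xi))| <=
    C / Num.sqrt `|x|.
Proof.
have pos (xi : R) : 1 <= xi <= 4 -> 0 < xi by move=> /andP[h _]; exact: lt_le_trans h.
have le14 : 1 <= 4 :> R by lra.
have psi_cont xi : 1 <= xi <= 4 -> {for xi, continuous psi} by move=> h; exact: (der_cont (psi_der h)).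
have [B1 B10 hB1] := cont_bounded le14 psi_cont.
have [B2 B20 hB2] := cont_bounded le14 dpsi_cont.
(* [B3] bounds the ratio of [D * (a * xi^(a - 1))] to [|dP xi|]. The division by [|1 - a|] is where
   the curvature of the phase enters. *)
have [B3 B30 hB3] : exists2 B, 0 <= B & forall xi : R, 1 <= xi <= 4 -> `|a ^+ 2 / `|1 - a| * xi `^ (2 * a - 1)| <= B.
  apply: cont_bounded => // xi /pos xi0; apply: contM; [exact: cont_cst|exact: cont_powR].
pose E := B1 * (B3 + 1).
have E0 : 0 <= E by rewrite mulr_ge0// addr_ge0.
exists (2 * B2 + 4 * E + 1).
  by rewrite ltr_wpDl// addr_ge0// mulr_ge0.
move=> x t c x0.
pose D : R := `|x|; have D0 : 0 < D by rewrite normr_gt0.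
pose d : R := Num.sqrt D; have d0 : 0 < d by rewrite sqrtr_gt0.
have d2 : d ^+ 2 = D by rewrite sqr_sqrtr// ltW.
pose P (xi : R) : R := t + x / a * xi `^ (1 - a).
pose dP (xi : R) : R := x / a * ((1 - a) * xi `^ (- a)).
have PD (xi : R) : 0 < P xi ^+ 2 + D by rewrite ltr_wpDl// sqr_ge0.
have derP (xi : R) : 1 <= xi <= 4 -> is_derive xi (1 : R) P (dP xi).
  move=> /pos xi0; have := derD (der_cst t xi) (derZ (x / a) (der_powR (1 - a) xi0)).
  by rewrite add0r (_ : 1 - a - 1 = - a)//; lra.
have contP (xi : R) : 1 <= xi <= 4 -> {for xi, continuous P} by move=> h; exact: (der_cont (derP _ h)).
have contdP (xi : R) : 1 <= xi <= 4 -> {for xi, continuous dP}.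
  move=> /pos xi0; apply: contM; first exact: cont_cst.
  by apply: contM; [exact: cont_cst|exact: cont_powR].
(* [dP] has a constant sign, so [|dP| / (P^2 + D)] has the primitive [sg * atan (P / d) / d]. *)
pose sg := Num.sg (x * (1 - a)).
have a1' : 1 - a != 0 by rewrite subr_eq0 eq_sym.
have sgP (xi : R) : 1 <= xi <= 4 -> sg * dP xi = `|dP xi|.
  move=> /pos xi0; rewrite /dP !normrM normfV (gtr0_norm a0).
  have -> : `|xi `^ (- a)| = xi `^ (- a) by rewrite ger0_norm// powR_ge0.
  have -> : sg * (x / a * ((1 - a) * xi `^ (- a))) = (sg * (x * (1 - a))) / a * xi `^ (- a).
    by field; rewrite gt_eqF.
  by rewrite /sg -normrEsg normrM; ring.
pose q (xi : R) : R := P xi / (P xi ^+ 2 + D).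
pose dq (xi : R) : R := dP xi * (D - P xi ^+ 2) / (P xi ^+ 2 + D) ^+ 2.
have derq (xi : R) : 1 <= xi <= 4 -> is_derive xi (1 : R) q (dq xi).
  move=> h; have dp := derP _ h.
  have n0 : P xi ^+ 2 + D != 0 by rewrite gt_eqF.
  have := derM dp (@der_V _ (fun y => P y ^+ 2 + D) xi _ n0 (derD (der_X 2 dp) (der_cst D xi))).
  by move=> h'; apply: (is_derive_eq h'); rewrite /dq; field.
have contq (xi : R) : 1 <= xi <= 4 -> {for xi, continuous q} by move=> h; exact: (der_cont (derq _ h)).
have contPD (xi : R) : 1 <= xi <= 4 -> {for xi, continuous (fun y => (P y ^+ 2 + D)^-1)}.
  move=> h; apply: contV; first by rewrite gt_eqF.
  by apply: contD; [apply: contM; exact: contP|exact: cont_cst].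
have contdq (xi : R) : 1 <= xi <= 4 -> {for xi, continuous dq}.
  move=> h; apply: contM.
    apply: contM; first exact: contdP.
    by apply: contD; [exact: cont_cst|apply: contN; apply: contM; exact: contP].
  apply: contV; first by rewrite gt_eqF// exprn_gt0.
  by apply: contM; (apply: contD; [apply: contM; exact: contP|exact: cont_cst]).
pose H (xi : R) : R := B2 / (2 * d) * xi + E * (sg * (d^-1 * atan (d^-1 * P xi))).
pose h (xi : R) : R := B2 / (2 * d) + E * (sg * dP xi * (P xi ^+ 2 + D)^-1).
pose G (xi : R) : R := sin (phase x t c xi) * (q xi * psi xi).
pose g (xi : R) : R := cos (phase x t c xi) * (x + t * (a * xi `^ (a - 1))) * (q xi * psi xi) +
   sin (phase x t c xi) * (dq xi * psi xi + q xi * dpsi xi).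
have derG (xi : R) : 1 <= xi <= 4 -> is_derive xi (1 : R) G (g xi).
  move=> xih; have xi0 := pos _ xih.
  exact: (derM (der_sin (der_phase x t c xi0)) (derM (derq _ xih) (psi_der xih))).
have derH (xi : R) : 1 <= xi <= 4 -> is_derive xi (1 : R) H (h xi).
  move=> xih; have xi0 := pos _ xih.
  have := derD (derZ (B2 / (2 * d)) (der_id xi))
    (derZ E (derZ sg (derZ d^-1 (der_atan (derZ d^-1 (derP _ xih)))))).
  move=> h'; apply: (is_derive_eq h'); rewrite /h mulr1; congr (_ + E * _).
  have n1 : P xi ^+ 2 + d ^+ 2 != 0 by rewrite d2 gt_eqF.
  have n2 : d != 0 by rewrite gt_eqF.
  have n3 : 1 + (d^-1 * P xi) ^+ 2 != 0 by rewrite gt_eqF// ltr_pwDl// sqr_ge0.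
  have n4 : d ^+ 2 + P xi ^+ 2 != 0 by rewrite addrC.
  by rewrite -d2; field; rewrite ?n1 ?n2 ?n3 ?n4.
have contcos (xi : R) : 1 <= xi <= 4 -> {for xi, continuous (fun xi => cos (phase x t c xi))}.
  by move=> /pos xi0; apply: cont_cos; exact: cont_phase.
have contsin (xi : R) : 1 <= xi <= 4 -> {for xi, continuous (fun xi => sin (phase x t c xi))}.
  by move=> /pos xi0; apply: cont_sin; exact: cont_phase.
have contpow (xi : R) : 1 <= xi <= 4 -> {for xi, continuous (fun xi => a * xi `^ (a - 1))}.
  by move=> /pos xi0; apply: contM; [exact: cont_cst|exact: cont_powR].
have := @Rint_compare 1 4 (fun xi => a * xi `^ (a - 1) * psi xi * cos (phase x t c xi)) g h G H le14.
have K1 (xi : R) : 1 <= xi <= 4 -> {for xi, continuous (fun xi => a * xi `^ (a - 1) * psi xi * cos (phase x t c xi))}.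
  move=> xih; apply: contM; last exact: contcos.
  by apply: contM; [exact: contpow|exact: psi_cont].
have K2 (xi : R) : 1 <= xi <= 4 -> {for xi, continuous g}.
  move=> xih; apply: contD.
    apply: contM; last by apply: contM; [exact: contq|exact: psi_cont].
    apply: contM; first exact: contcos.
    by apply: contD; [exact: cont_cst|apply: contM; [exact: cont_cst|exact: contpow]].
  apply: contM; first exact: contsin.
  by apply: contD; apply: contM; [exact: contdq|exact: psi_cont|exact: contq|exact: dpsi_cont].
have K3 (xi : R) : 1 <= xi <= 4 -> {for xi, continuous h}.
  move=> xih; apply: contD; first exact: cont_cst.
  apply: contM; first exact: cont_cst.
  apply: contM; last exact: contPD.
  by apply: contM; [exact: cont_cst|exact: contdP].
have K4 : G 1 = G 4 by rewrite /G psi1 psi4 !mulr0.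
have K5 (xi : R) : 1 <= xi <= 4 -> `|a * xi `^ (a - 1) * psi xi * cos (phase x t c xi) - g xi| <= h xi.
  move=> xih; have xi0 := pos _ xih.
  have phE : x + t * (a * xi `^ (a - 1)) = P xi * (a * xi `^ (a - 1)).
    rewrite /P mulrDl; rewrite addrC; congr (_ + _).
    have -> : x / a * xi `^ (1 - a) * (a * xi `^ (a - 1)) = x * (xi `^ (1 - a) * xi `^ (a - 1)).
      by field; rewrite gt_eqF.
    rewrite -powRD; last by rewrite (gt_eqF xi0) implybT.
    by rewrite (_ : 1 - a + (a - 1) = 0) ?powRr0 ?mulr1//; lra.
  have fg : a * xi `^ (a - 1) * psi xi * cos (phase x t c xi) - g xi =
     cos (phase x t c xi) * (D / (P xi ^+ 2 + D) * (a * xi `^ (a - 1) * psi xi))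
     - sin (phase x t c xi) * (dq xi * psi xi + q xi * dpsi xi).
    by rewrite /g phE /q; field; rewrite gt_eqF.
  rewrite fg; set Ka := cos _; set Kb := sin _.
  have Ka1 : `|Ka| <= 1 by rewrite ler_norml cos_geN1 cos_le1.
  have Kb1 : `|Kb| <= 1 by rewrite ler_norml sin_geN1 sin_le1.
  have T1 : `|D / (P xi ^+ 2 + D) * (a * xi `^ (a - 1) * psi xi)| <=
      B1 * B3 * (`|dP xi| * (P xi ^+ 2 + D)^-1).
    have -> : D / (P xi ^+ 2 + D) * (a * xi `^ (a - 1) * psi xi) =
       psi xi * (D * (a * xi `^ (a - 1))) * (P xi ^+ 2 + D)^-1 by ring.
    rewrite normrM [X in _ * X <= _]gtr0_norm ?invr_gt0// [leRHS]mulrA.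
    apply: ler_wpM2r; first by rewrite invr_ge0 ltW.
    rewrite normrM -mulrA; apply: ler_pM; rewrite ?normr_ge0 ?hB1//.
    have -> : `|D * (a * xi `^ (a - 1))| = `|dP xi| * (a ^+ 2 / `|1 - a| * xi `^ (2 * a - 1)).
      rewrite ger0_norm; last by rewrite mulr_ge0 ?(ltW D0)// mulr_ge0 ?(ltW a0)// powR_ge0.
      rewrite /dP !normrM normfV (gtr0_norm a0) -/D.
      have -> : `|xi `^ (- a)| = xi `^ (- a) by rewrite ger0_norm// powR_ge0.
      have -> : xi `^ (a - 1) = xi `^ (- a) * xi `^ (2 * a - 1).
        by rewrite -powRD ?(gt_eqF xi0) ?implybT//; congr (_ `^ _); lra.
      have n1 : `|1 - a| != 0 by rewrite normr_eq0.
      have n2 : a != 0 by rewrite gt_eqF.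
      by field; rewrite n1 n2.
    rewrite mulrC ler_wpM2r ?normr_ge0//.
    by apply: le_trans (ler_norm _) (hB3 _ xih).
  have T2 : `|dq xi * psi xi| <= B1 * (`|dP xi| * (P xi ^+ 2 + D)^-1).
    rewrite normrM mulrC; apply: ler_pM; rewrite ?normr_ge0 ?hB1//.
    rewrite /dq !normrM -mulrA ler_wpM2l ?normr_ge0//.
    rewrite normfV (gtr0_norm (exprn_gt0 2 (PD xi))) ler_pdivrMr ?exprn_gt0//.
    have -> : (P xi ^+ 2 + D)^-1 * (P xi ^+ 2 + D) ^+ 2 = P xi ^+ 2 + D by field; rewrite gt_eqF.
    by rewrite ler_norml; have := sqr_ge0 (P xi); move: (P xi ^+ 2) => y y0; apply/andP; split; lra.
  have T3 : `|q xi * dpsi xi| <= B2 / (2 * d).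
    rewrite normrM mulrC; apply: ler_pM; rewrite ?normr_ge0 ?hB2//.
    rewrite /q normrM normfV (gtr0_norm (PD xi)) ler_pdivrMr// mulrC ler_pdivlMr ?mulr_gt0//.
    have -> : P xi ^+ 2 = `|P xi| ^+ 2 by rewrite real_normK ?num_real.
    by rewrite -d2; have := sqr_ge0 (`|P xi| - d); move: `|P xi| => y; nra.
  rewrite /h sgP// /E; apply: (le_trans (ler_normB _ _)).
  rewrite [`|Ka * _|]normrM [`|Kb * _|]normrM.
  have T4 := ler_normD (dq xi * psi xi) (q xi * dpsi xi).
  set X := `|dP xi| * _ in T1 T2 *.
  have -> : B1 * (B3 + 1) * X = B1 * B3 * X + B1 * X by ring.
  apply: (@le_trans _ _ (B1 * B3 * X + (B1 * X + B2 / (2 * d)))); last by rewrite le_eqVlt; apply/orP; left; apply/eqP; ring.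
  apply: lerD.
    by apply: le_trans T1; rewrite ler_piMl// normr_ge0.
  apply: (@le_trans _ _ (1 * `|dq xi * psi xi + q xi * dpsi xi|)).
    by rewrite ler_wpM2r// normr_ge0.
  by rewrite mul1r (le_trans T4)// lerD.
move=> /(_ K1 K2 K3 derG derH K4 K5) /le_trans; apply.
have sg1 : `|sg| <= 1 by rewrite /sg normr_sg; case: (_ != 0).
rewrite /H.
set p4 := atan (d^-1 * P 4); set p1 := atan (d^-1 * P 1).
have -> : B2 / (2 * d) * 4 + E * (sg * (d^-1 * p4)) - (B2 / (2 * d) * 1 + E * (sg * (d^-1 * p1))) =
   (3 / 2 * B2 + E * (sg * (p4 - p1))) / d by field; rewrite gt_eqF.
rewrite -/d ler_wpM2r ?invr_ge0 ?(ltW d0)//.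
(* Two values of the arctangent differ by less than [pi <= 4], however large [t] and [x] are; this
   is the uniformity in [t]. *)
have hp : sg * (p4 - p1) <= 4.
  apply: (le_trans (ler_norm _)); rewrite normrM.
  apply: (@le_trans _ _ (1 * `|p4 - p1|)); first by rewrite ler_wpM2r.
  rewrite mul1r ler_norml.
  have h1 := atan_ltpi2 (d^-1 * P 4); have h2 := atan_gtNpi2 (d^-1 * P 4).
  have h3 := atan_ltpi2 (d^-1 * P 1); have h4 := atan_gtNpi2 (d^-1 * P 1).
  have hpi : @pi R <= 4 by have := @pihalf_02 R; move=> /andP[_]; lra.
  rewrite -/p4 in h1 h2; rewrite -/p1 in h3 h4; apply/andP; split; lra.
have : E * (sg * (p4 - p1)) <= E * 4 by rewrite ler_wpM2l.
move: (E * (sg * _)) => Y; lra.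
Qed.

End vdc.


(** The square makes [dbump] vanish at 1 and 4 too, so that van der Corput applies once more after
    an integration by parts. *)
Definition bump (xi : R) : R := ((xi - 1) * (4 - xi)) ^+ 2.
Definition dbump (xi : R) : R := 2 * ((xi - 1) * (4 - xi)) * (5 - 2 * xi).
Definition ddbump (xi : R) : R := 2 * (5 - 2 * xi) ^+ 2 - 4 * ((xi - 1) * (4 - xi)).

Lemma der_bump xi : is_derive xi (1 : R) bump (dbump xi).
Proof.
have h1 := derB (der_id xi) (der_cst 1 xi); have h2 := derB (der_cst 4 xi) (der_id xi).
by apply: (is_derive_eq (der_X 2 (derM h1 h2))); rewrite /dbump/=; ring.
Qed.

Lemma der_dbump xi : is_derive xi (1 : R) dbump (ddbump xi).
Proof.
have h1 := derB (der_id xi) (der_cst 1 xi); have h2 := derB (der_cst 4 xi) (der_id xi).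
have h3 := derB (der_cst 5 xi) (derZ 2 (der_id xi)).
by apply: (is_derive_eq (derM (derZ 2 (derM h1 h2)) h3)); rewrite /ddbump/=; ring.
Qed.

Lemma cont_ddbump (xi : R) : {for xi, continuous ddbump}.
Proof.
have h1 : {for xi, continuous (fun y : R => 5 - 2 * y)}.
  by apply: contD; [exact: cont_cst|apply: contN; apply: contM; [exact: cont_cst|exact: cont_id]].
apply: contD; first by apply: contM; [exact: cont_cst|apply: contM].
apply: contN; apply: contM; first exact: cont_cst.
apply: contM; apply: contD; rewrite ?[(fun _ => _ : R)]/=; [exact: cont_id|exact: cont_cst|exact: cont_cst|].
by apply: contN; exact: cont_id.
Qed.

Lemma bump_ge0 xi : 0 <= bump xi.
Proof. exact: sqr_ge0. Qed.

Lemma bump1 : bump 1 = 0. Proof. by rewrite /bump subrr mul0r expr0n. Qed.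
Lemma bump4 : bump 4 = 0. Proof. by rewrite /bump subrr mulr0 expr0n. Qed.
Lemma dbump1 : dbump 1 = 0. Proof. by rewrite /dbump subrr mul0r mulr0 mul0r. Qed.
Lemma dbump4 : dbump 4 = 0. Proof. by rewrite /dbump subrr !mulr0 mul0r. Qed.

Let pos (xi : R) : 1 <= xi <= 4 -> 0 < xi.
Proof. by move=> /andP[h _]; exact: lt_le_trans h. Qed.

(** The amplitude [psi = xi^(1 - a) * v / a] cancels the Jacobian factor [a * xi^(a - 1)] in
    [van_der_corput]. *)
Let vdc_weight (v dv : R -> R) : v 1 = 0 -> v 4 = 0 ->
  (forall xi : R, is_derive xi (1 : R) v (dv xi)) -> (forall xi : R, {for xi, continuous dv}) ->
  exists2 C : R, 0 < C & forall x t c : R, x != 0 ->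
  `|\int[mu]_(xi in `[1, 4]) (v xi * cos (phase x t c xi))| <= C / Num.sqrt `|x|.
Proof.
move=> v1 v4 dvv cdv.
pose u (xi : R) : R := a^-1 * xi `^ (1 - a).
pose du (xi : R) : R := a^-1 * ((1 - a) * xi `^ (1 - a - 1)).
have hu (xi : R) : 1 <= xi <= 4 -> is_derive xi (1 : R) u (du xi).
  by move=> /pos xi0; apply: derZ; exact: der_powR.
have cdu (xi : R) : 1 <= xi <= 4 -> {for xi, continuous du}.
  move=> /pos xi0; rewrite /du; apply: contM; first exact: cont_cst.
  by apply: contM; [exact: cont_cst|exact: cont_powR].
have z1 : u 1 * v 1 = 0 by rewrite v1 mulr0.
have z4 : u 4 * v 4 = 0 by rewrite v4 mulr0.
have d1 (xi : R) : 1 <= xi <= 4 -> is_derive xi (1 : R) (fun y => u y * v y) (du xi * v xi + u xi * dv xi).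
  by move=> h; exact: derM (hu _ h) (dvv xi).
have c1 (xi : R) : 1 <= xi <= 4 -> {for xi, continuous (fun y => du y * v y + u y * dv y)}.
  move=> h; apply: contD; apply: contM; [exact: cdu|exact: der_cont (dvv xi)|exact: der_cont (hu _ h)|exact: cdv].
have [C C0 hC] := van_der_corput z1 z4 d1 c1.
exists C => // x t c x0; have := hC x t c x0.
congr (`|_| <= _); apply: eq_Rintegral => xi.
rewrite inE/= in_itv/= => /pos xi0; congr (_ * _).
rewrite /u; have -> : a * xi `^ (a - 1) * (a^-1 * xi `^ (1 - a) * v xi) = (xi `^ (a - 1) * xi `^ (1 - a)) * v xi.
  by field; rewrite gt_eqF.
rewrite -powRD ?(gt_eqF xi0) ?implybT//.
by rewrite (_ : a - 1 + (1 - a) = 0) ?powRr0 ?mul1r//; lra.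
Qed.

(** Of size [(1 + y)^(-1/2)] up to [y = M] and [M * y^(-3/2)] beyond, written as one formula with an
    elementary primitive. *)
Definition majorant (M y : R) : R := M / ((M + 1 + y) * Num.sqrt (1 + y)).

(** Three regimes in [y = |x|]: the trivial bound for [y <= 1], van der Corput for [y <= M], and one
    integration by parts for [y > M]. The latter expresses [x] times the integral through [t] times
    an integral with amplitude [a * xi^(a - 1) * bump] and one with amplitude [dbump]; van der
    Corput bounds both, and [|t| <= M]. *)
Lemma bump_kernel_bound : exists2 C : R, 0 < C & forall x t c M : R, 1 <= M -> `|t| <= M ->
  `|\int[mu]_(xi in `[1, 4]) (bump xi * cos (phase x t c xi))| <= C * majorant M `|x|.
Proof.
have h92 : 9 / 2 <= 5 :> R by lra.
have cbump xi := der_cont (der_bump xi); have cdbump xi := der_cont (der_dbump xi).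
have le14 : 1 <= 4 :> R by lra.
have [C0 C00 h0] := vdc_weight bump1 bump4 der_bump cdbump.
have [C1 C10 h1] := van_der_corput bump1 bump4 (fun xi _ => der_bump xi) (fun xi _ => cdbump xi).
have [C2 C20 h2] := vdc_weight dbump1 dbump4 der_dbump cont_ddbump.
have [B B0 hB] := cont_bounded le14 (fun xi _ => cbump xi).
(* The factor 5 exceeds [3 * (3 / 2)], which comes from [M + 1 + y <= 3 max(M, y)] and
   [sqrt (1 + y) <= 3/2 max(1, sqrt y)]. *)
exists (5 * (C0 + C1 + C2 + 3 * B)).
  by lra.
move=> x t c M M1 tM; set I := `| _ |; set C := C0 + C1 + C2 + 3 * B.
have I0 : 0 <= I by exact: normr_ge0.
have C_ge : [/\ C0 <= C, C1 + C2 <= C & 3 * B <= C].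
  by rewrite /C; split; lra.
have [CC0 CC1 CC2] := C_ge.
have cph (x' t' c' xi : R) : 1 <= xi <= 4 -> {for xi, continuous (fun xi => cos (phase x' t' c' xi))}.
  by move=> /pos xi0; apply: cont_cos; exact: cont_phase.
have sph (x' t' c' xi : R) : 1 <= xi <= 4 -> {for xi, continuous (fun xi => sin (phase x' t' c' xi))}.
  by move=> /pos xi0; apply: cont_sin; exact: cont_phase.
have cpow (xi : R) : 1 <= xi <= 4 -> {for xi, continuous (fun xi => a * xi `^ (a - 1))}.
  by move=> /pos xi0; apply: contM; [exact: cont_cst|exact: cont_powR].
have trivial_bound : I <= C.
  apply: le_trans CC2.
  have := @Rint_compare 1 4 (fun xi => bump xi * cos (phase x t c xi)) (fun=> 0) (fun=> B)
    (fun=> 0) (fun xi => B * xi) le14 _ _ _ _ _ _ _.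
  have -> : B * 4 - B * 1 = 3 * B by ring.
  apply.
  - by move=> xi h; apply: contM; [exact: cbump|exact: cph].
  - by move=> xi _; exact: cont_cst.
  - by move=> xi _; exact: cont_cst.
  - by move=> xi _; have := derZ B (der_id xi); rewrite mulr1.
  - by [].
  - move=> xi h; rewrite subr0 normrM -[leRHS]mulr1 ler_pM ?normr_ge0 ?hB//.
    by rewrite ler_norml cos_geN1 cos_le1.
have vdc_bound : x != 0 -> I * Num.sqrt `|x| <= C.
  move=> x0; rewrite -ler_pdivlMr ?sqrtr_gt0 ?normr_gt0//.
  by apply: (le_trans (h0 x t c x0)); rewrite ler_wpM2r// invr_ge0 sqrtr_ge0.
have ibp_bound : x != 0 -> I * `|x| * Num.sqrt `|x| <= C * M.
  move=> x0; rewrite -ler_pdivlMr ?sqrtr_gt0 ?normr_gt0//.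
  have k1 (xi : R) : 1 <= xi <= 4 -> {for xi, continuous (fun xi => x * (bump xi * cos (phase x t c xi)))}.
    by move=> h; apply: contM; [exact: cont_cst|apply: contM; [exact: cbump|exact: cph]].
  have k2 (xi : R) : 1 <= xi <= 4 -> {for xi, continuous (fun xi => t * (a * xi `^ (a - 1) * bump xi * cos (phase x t c xi)))}.
    move=> h; apply: contM; first exact: cont_cst.
    by apply: contM; [apply: contM; [exact: cpow|exact: cbump]|exact: cph].
  have k3 (xi : R) : 1 <= xi <= 4 -> {for xi, continuous (fun xi => dbump xi * cos (phase x t (c - pi / 2) xi))}.
    by move=> h; apply: contM; [exact: cdbump|exact: cph].
  have mI : measurable (`[1, 4]%classic : set (measurableTypeR R)) by exact: measurable_itv.
  (* The boundary terms vanish with [bump]. The sine that multiplies [dbump] is written as a cosine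
     with phase shifted by [pi / 2], to which [h2] applies. *)
  have F : \int[mu]_(xi in `[1, 4]) (x * (bump xi * cos (phase x t c xi)) +
     t * (a * xi `^ (a - 1) * bump xi * cos (phase x t c xi)) + dbump xi * cos (phase x t (c - pi / 2) xi)) = 0.
    transitivity (sin (phase x t c 4) * bump 4 - sin (phase x t c 1) * bump 1); last first.
      by rewrite bump1 bump4 !mulr0 subrr.
    apply: (@FTC2 _ 1 4 (fun xi => sin (phase x t c xi) * bump xi) _ le14).
    - move=> xi h; apply: (is_derive_eq (derM (der_sin (der_phase x t c (pos h))) (der_bump xi))).
      have -> : cos (phase x t (c - pi / 2) xi) = sin (phase x t c xi).
        by rewrite /phase addrA cosB cos_pihalf sin_pihalf mulr0 mulr1 add0r.
      by ring.
    - by move=> xi h; apply: contD; [apply: contD; [exact: k1|exact: k2]|exact: k3].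
  have i1 := cont_integrable k1; have i2 := cont_integrable k2; have i3 := cont_integrable k3.
  have i12 : mu.-integrable `[1, 4] (EFin \o (fun xi => x * (bump xi * cos (phase x t c xi)) +
     t * (a * xi `^ (a - 1) * bump xi * cos (phase x t c xi)))).
    by apply: cont_integrable => xi h; apply: contD; [exact: k1|exact: k2].
  move: F; rewrite RintegralD// RintegralD//.
  rewrite RintegralZl//; last first.
    by apply: cont_integrable => xi h; apply: contM; [exact: cbump|exact: cph].
  rewrite RintegralZl//; last first.
    by apply: cont_integrable => xi h; apply: contM; [apply: contM; [exact: cpow|exact: cbump]|exact: cph].
  have := h1 x t c x0; have := h2 x t (c - pi / 2) x0; rewrite /I.
  set J2 := \int[mu]_(xi in _) (dbump xi * _); set J1 := \int[mu]_(xi in _) (a * _ * _ * _).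
  set J0 := \int[mu]_(xi in _) (bump xi * _); set s := Num.sqrt _ => hJ2 hJ1 E.
  have s0 : 0 < s by rewrite sqrtr_gt0 normr_gt0.
  rewrite -normrM mulrC; have -> : x * J0 = - (t * J1 + J2) by lra.
  rewrite normrN; apply: (le_trans (ler_normD _ _)); rewrite normrM.
  have e1 : `|t| * `|J1| <= M * (C1 / s) by rewrite ler_pM.
  have e2 : `|J2| <= M * (C2 / s).
    by apply: (le_trans hJ2); rewrite ler_peMl// divr_ge0// ltW.
  apply: (@le_trans _ _ (M * ((C1 + C2) / s))); first by rewrite mulrDl mulrDr lerD.
  rewrite [leRHS]mulrAC [leRHS]mulrC ler_wpM2l//; first by lra.
  by rewrite ler_wpM2r// invr_ge0 ltW.
rewrite /majorant; set y := `|x| in vdc_bound ibp_bound *.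
have y0 : 0 <= y by exact: normr_ge0.
set s := Num.sqrt (1 + y).
have s0 : 0 < s by rewrite sqrtr_gt0; lra.
have s2 : s ^+ 2 = 1 + y by rewrite sqr_sqrtr//; lra.
have My : 0 < M + 1 + y by lra.
have Cg : 0 < C by rewrite /C; lra.
have fin : 9 / 2 * (C * M) <= 5 * C * M.
  rewrite -[leRHS]mulrA; apply: ler_wpM2r; last exact: h92.
  by rewrite mulr_ge0 ?(ltW Cg)// (le_trans ler01).
rewrite mulrA ler_pdivlMr ?mulr_gt0//.
have [y1|y1] := leP y 1.
  have hs : s <= 3 / 2.
    by rewrite -(@ler_pXn2r _ 2) ?nnegrE ?(ltW s0) ?divr_ge0//; rewrite s2; lra.
  apply: le_trans fin; have -> : 9 / 2 * (C * M) = C * ((3 * M) * (3 / 2)) by ring.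
  apply: ler_pM => //; first by rewrite mulr_ge0// ltW.
  by apply: ler_pM; rewrite ?(ltW My) ?(ltW s0)//; lra.
have x0 : x != 0 by rewrite -normr_gt0 -/y; lra.
set r := Num.sqrt y in vdc_bound ibp_bound.
have r0 : 0 < r by rewrite sqrtr_gt0; lra.
have r2 : r ^+ 2 = y by rewrite sqr_sqrtr.
have hs : s <= 3 / 2 * r.
  rewrite -(@ler_pXn2r _ 2) ?nnegrE ?(ltW s0) ?mulr_ge0 ?divr_ge0 ?(ltW r0)//.
  by rewrite exprMn s2 r2; lra.
have [yM|yM] := leP y M.
  have := vdc_bound x0 => hI.
  apply: (@le_trans _ _ (I * ((3 * M) * (3 / 2 * r)))).
    apply: ler_wpM2l => //; apply: ler_pM; rewrite ?(ltW My) ?(ltW s0)//; lra.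
  have -> : I * (3 * M * (3 / 2 * r)) = 9 / 2 * M * (I * r) by ring.
  apply: le_trans fin; rewrite [C * M]mulrC [9 / 2 * (M * C)]mulrA.
  by apply: ler_wpM2l => //; rewrite mulr_ge0// (le_trans ler01).
have := ibp_bound x0 => hI.
apply: (@le_trans _ _ (I * ((3 * y) * (3 / 2 * r)))).
  apply: ler_wpM2l => //; apply: ler_pM; rewrite ?(ltW My) ?(ltW s0)//; lra.
have -> : I * (3 * y * (3 / 2 * r)) = 9 / 2 * (I * y * r) by ring.
by apply: le_trans fin; apply: ler_wpM2l.
Qed.

End Oscillatory.

(** * The integral of the majorant *)

Section Majorant.
Context {R : realType}.
Local Notation mu := (@lebesgue_measure R).
Variables (M lam : R).
Hypothesis M1 : 1 <= M.
Hypothesis lam0 : 0 < lam.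

Let lx (x : R) : 0 <= lam * `|x|. Proof. by rewrite mulr_ge0// ltW. Qed.
Let M0 : 0 < M. Proof. exact: lt_le_trans M1. Qed.

Lemma majorant_ge0 (y : R) : 0 <= y -> 0 <= majorant M y.
Proof.
by move=> y0; rewrite divr_ge0 ?(ltW M0)// mulr_ge0 ?sqrtr_ge0// addr_ge0// addr_ge0// ltW.
Qed.

Lemma cont_majorant (x : R) : {for x, continuous (fun x : R => majorant M (lam * `|x|))}.
Proof.
rewrite /majorant; have c1 : {for x, continuous (fun x : R => lam * `|x|)}.
  by apply: contM; [exact: cont_cst|apply: cont_norm; exact: cont_id].
apply: contM; first exact: cont_cst.
apply: contV.
  rewrite gt_eqF// mulr_gt0 ?sqrtr_gt0//; last by rewrite ltr_pwDl.
  by rewrite ltr_wpDr// addr_gt0.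
apply: contM; first by apply: contD => //; exact: cont_cst.
apply: cont_comp; first by apply: contD => //; exact: cont_cst.
exact: sqrt_continuous.
Qed.

Lemma continuous_majorant : continuous (fun x : R => majorant M (lam * `|x|)).
Proof. by move=> x; exact: cont_majorant. Qed.

(** With [u = sqrt ((1 + lam x) / M)] the majorant is [2 * sqrt M / lam] times the derivative of
    [atan u]. *)
Let F (x : R) : R := 2 * Num.sqrt M / lam * atan (Num.sqrt ((1 + lam * x) / M)).

Let arg0 (x : R) : 0 <= x -> 0 < (1 + lam * x) / M.
Proof. by move=> x0; rewrite divr_gt0// ltr_pwDl// mulr_ge0// ltW. Qed.

Let der_F (x : R) : 0 <= x -> is_derive x (1 : R) F (majorant M (lam * x)).
Proof.
move=> x0; have h0 := arg0 x0.
have d1 := derM (derD (der_cst 1 x) (derZ lam (der_id x))) (der_cst M^-1 x).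
have d2 := derZ (2 * Num.sqrt M / lam) (der_atan (@der_comp _ Num.sqrt (fun y => (1 + lam * y) / M) x _ _ (is_derive1_sqrt h0) d1)).
apply: (is_derive_eq d2); rewrite /majorant sqr_sqrtr ?(ltW h0)//.
rewrite sqrtrM; last by rewrite addr_ge0// mulr_ge0// ltW.
have y0 : 0 < 1 + lam * x by rewrite ltr_pwDl// mulr_ge0// ltW.
rewrite sqrtrV ?(ltW M0)//.
set s := Num.sqrt M; set u := Num.sqrt (1 + lam * x).
have s0 : s != 0 by rewrite gt_eqF// sqrtr_gt0.
have u0 : u != 0 by rewrite gt_eqF// sqrtr_gt0.
have s2 : M = s ^+ 2 by rewrite sqr_sqrtr// ltW.
have n1 : s ^+ 2 + 1 + lam * x != 0 by rewrite -s2 gt_eqF// -addrA addr_gt0.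
have n2 : lam != 0 by rewrite gt_eqF.
rewrite s2; field; rewrite ?s0 ?u0 ?n1 ?n2 //=.
Qed.

(** The prefactor [lam] makes the bound independent of scale. The constant is two half-lines, times
    [2 * sqrt M] from the primitive, times [pi / 2 <= 2]. *)
Lemma majorant_int : (\int[mu]_x (lam * majorant M (lam * `|x|))%:E <= (8 * Num.sqrt M)%:E)%E.
Proof.
have mj : measurable_fun setT (fun x : R => majorant M (lam * `|x|)).
  by apply: continuous_measurable_fun; exact: continuous_majorant.
rewrite IeZ ?(ltW lam0)//; last by move=> x; exact: majorant_ge0.
rewrite ge0_symfun_integralT; last 3 first.
- by move=> x; exact: majorant_ge0.
- exact: continuous_majorant.
- by move=> x /=; rewrite normrN.
have -> : [set x : R | 0 <= x] = `[0, +oo[%classic.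
  by apply/seteqP; split => x /=; rewrite in_itv/= andbT.
have hn (n : nat) : (\int[mu]_(x in `[(0 : R)%R, (n.+1%:R : R)%R]) (majorant M (lam * `|x|))%:E <= (4 * Num.sqrt M / lam)%:E)%E.
  have n0 : 0 <= n.+1%:R :> R by rewrite ler0n.
  have cm x : 0 <= x <= n.+1%:R -> {for x, continuous (fun x : R => majorant M (lam * `|x|))}.
    by move=> _; exact: continuous_majorant.
  rewrite -[leLHS]fineK; last first.
    by apply: integrable_fin_num => //; exact: (cont_integrable cm).
  rewrite lee_fin -/(Rintegral _ _ _).
  have -> : \int[mu]_(x in `[0, n.+1%:R]) majorant M (lam * `|x|) = F n.+1%:R - F 0.
    have dF (x : R) : 0 <= x <= n.+1%:R -> is_derive x (1 : R) F (majorant M (lam * `|x|)).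
      by move=> /andP[x0 _]; have := der_F x0; rewrite (ger0_norm x0).
    exact: (FTC2 n0 dF cm).
  rewrite /F -mulrBr.
  have h1 := atan_ltpi2 (Num.sqrt ((1 + lam * n.+1%:R) / M)).
  have h0 : 0 <= atan (Num.sqrt ((1 + lam * 0) / M)).
    by rewrite -[leLHS](@atan0 R); apply: le_atan; exact: sqrtr_ge0.
  have := @pihalf_02 R => /andP[_ h2].
  have -> : 4 * Num.sqrt M / lam = 2 * Num.sqrt M / lam * 2 by ring.
  apply: ler_wpM2l; last by lra.
  by rewrite divr_ge0 ?(ltW lam0)// mulr_ge0// sqrtr_ge0.
have h : (\int[mu]_(x in `[0%R, +oo[) (majorant M (lam * `|x|))%:E <= (4 * Num.sqrt M / lam)%:E)%E.
  rewrite ge0_integral_ereal_sup//.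
    by apply: ge_ereal_sup => _ [n _ <-]; exact: hn.
  by move=> x; exact: majorant_ge0.
apply: (@le_trans _ _ (lam%:E * (2%:E * (4 * Num.sqrt M / lam)%:E))%E).
  by apply: lee_wpmul2l; [rewrite lee_fin ltW|apply: lee_wpmul2l; rewrite ?lee_fin].
rewrite -!EFinM lee_fin le_eqVlt; apply/orP; left; apply/eqP; field.
by rewrite gt_eqF.
Qed.

End Majorant.

(** * Kernels localised to a dyadic shell of frequencies *)

Section TwoSidedKernel.
Context {R : realType}.
Local Notation mu := (@lebesgue_measure R).
Variable a : R.
Hypothesis a0 : 0 < a.
Hypothesis a1 : a != 1.

Lemma Rint_scale (lam : R) (G : R -> R) : 0 < lam ->
  (forall x, lam <= x <= 4 * lam -> {for x, continuous G}) ->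
  \int[mu]_(x in `[lam, 4 * lam]) G x = lam * \int[mu]_(y in `[1, 4]) G (lam * y).
Proof.
move=> l0 cG; pose F (y : R) := lam * y.
have dF (y : R) : is_derive y (1 : R) F lam.
  by have := derZ lam (der_id y); rewrite mulr1.
have F' : F^`()%classic = fun=> lam.
  by apply/funext => y; rewrite derive1E; exact: derive_val.
have cF (y : R) : {for y, continuous F} by exact: (der_cont (dF y)).
have cGF (y : R) : 1 <= y <= 4 -> {for y, continuous (fun y => G (lam * y))}.
  move=> /andP[y1 y4]; apply: cont_comp; first exact: cF.
  apply: cG; apply/andP; split; first by rewrite -[leLHS]mulr1 ler_wpM2l// ltW.
  by rewrite mulrC ler_wpM2r// ltW.
have E := @integration_by_substitution_increasing R F G 1 4.
have F1 : F 1 = lam by rewrite /F mulr1.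
have F4 : F 4 = 4 * lam by rewrite /F mulrC.
rewrite F1 F4 F' in E.
rewrite -RintegralZl//; last exact: cont_integrable.
rewrite /Rintegral; congr fine; rewrite E.
- by apply: eq_integral => y _ /=; rewrite /GRing.mul/= -[RHS]/((lam * G (lam * y))%:E) mulrC.
- by lra.
- by move=> x y _ _ xy; rewrite /F ltr_pM2l.
- by move=> y _; exact: cont_cst.
- exact: is_cvg_cst.
- exact: is_cvg_cst.
- split.
  + by move=> y _; have [] := dF y.
  + by apply: cvg_at_right_filter; exact: cF.
  + by apply: cvg_at_left_filter; exact: cF.
- exact: cont_within.
Qed.

(** [bump] is a polynomial, so the indicator is what confines it to the shell. *)
Definition shell (lam xi : R) : R := bump (`|xi| / lam) * \1_(`[lam, 4 * lam]) `|xi|.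

Lemma shell_ge0 lam xi : 0 <= shell lam xi.
Proof. by rewrite mulr_ge0 ?bump_ge0// indicE. Qed.

Lemma shell_split (lam xi : R) : 0 < lam -> shell lam xi =
  bump (xi / lam) * \1_(`[lam, 4 * lam]) xi + bump (- xi / lam) * \1_(`[- (4 * lam), - lam]) xi.
Proof.
move=> l0; rewrite /shell !indicE.
have [x0|x0] := leP 0 xi.
  rewrite ger0_norm// [X in _ + _ * X](_ : _ = 0) ?mulr0 ?addr0//.
  by rewrite memNset//= in_itv/=; apply/negP; rewrite negb_and -!ltNge; apply/orP; right; lra.
rewrite ltr0_norm// [X in _ * X + _](_ : _ = 0) ?mulr0 ?add0r//; last first.
  by rewrite memNset//= in_itv/=; apply/negP; rewrite negb_and -!ltNge; apply/orP; left; lra.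
congr (_ * (_ : bool)%:R); apply/idP/idP; rewrite !inE/= !in_itv/= => /andP[h1 h2]; apply/andP; split; lra.
Qed.

Lemma L1_restrict (f : R -> R) (b e : R) : (forall x, b <= x <= e -> {for x, continuous f}) ->
  L1 (fun x => f x * \1_(`[b, e]) x).
Proof.
move=> cf; have mI : measurable (`[b, e]%classic : set (measurableTypeR R)) by exact: measurable_itv.
have := (@integrable_mkcond _ (measurableTypeR R) R mu `[b, e]%classic (EFin \o f) mI).1 (cont_integrable cf).
congr (integrable _ _); apply/funext => x; rewrite patchE /= indicE.
by case: ifPn => _; rewrite ?mulr1 ?mulr0.
Qed.

Lemma Rint_restrict (f : R -> R) (b e : R) :
  \int[mu]_(x in `[b, e]) f x = \int[mu]_x (f x * \1_(`[b, e]) x).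
Proof.
rewrite Rintegral_mkcond; apply: eq_Rintegral => x _.
by rewrite patchE indicE; case: ifPn => _; rewrite ?mulr1 ?mulr0.
Qed.

Let cb (lam s x t c : R) (xi : R) : 0 < xi ->
  {for xi, continuous (fun xi => cos (phase a x t c xi) * bump (xi / lam))}.
Proof.
move=> xi0; apply: contM; first by apply: cont_cos; exact: cont_phase.
apply: cont_comp; last by exact: (der_cont (der_bump _)).
by apply: contM; [exact: cont_id|exact: cont_cst].
Qed.

(** Negative frequencies are reflected, which turns [x] into [- x] because [|xi|^a] is even.
    Rescaling both halves to [[1, 4]] turns the time into [lam^a * t]. The shift [c] serves real and
    imaginary parts alike. *)
Lemma shell_cos (lam x t c : R) : 0 < lam ->
  L1 (fun xi => shell lam xi * cos (x * xi + t * `|xi| `^ a + c)) /\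
  \int[mu]_xi (shell lam xi * cos (x * xi + t * `|xi| `^ a + c)) =
  lam * (\int[mu]_(xi in `[1, 4]) (bump xi * cos (phase a (lam * x) (lam `^ a * t) c xi)) +
         \int[mu]_(xi in `[1, 4]) (bump xi * cos (phase a (lam * - x) (lam `^ a * t) c xi))).
Proof.
move=> l0.
pose f (x xi : R) : R := cos (phase a x t c xi) * bump (xi / lam).
have cf (x' xi : R) : lam <= xi <= 4 * lam -> {for xi, continuous (f x')}.
  by move=> /andP[h _]; apply: cb => //; exact: lt_le_trans h.
have cf' (xi : R) : - (4 * lam) <= xi <= - lam -> {for xi, continuous (fun xi => f (- x) (- xi))}.
  move=> h; apply: cont_comp; first by apply: contN; exact: cont_id.
  by apply: cf; move/andP: h => [h1 h2]; apply/andP; split; lra.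
have E : (fun xi => shell lam xi * cos (x * xi + t * `|xi| `^ a + c)) =
    (fun xi => f x xi * \1_(`[lam, 4 * lam]) xi + f (- x) (- xi) * \1_(`[- (4 * lam), - lam]) xi).
  apply/funext => xi; rewrite shell_split// mulrDl; congr (_ + _).
    rewrite indicE; have [|_] := boolP (xi \in _); last by rewrite !mulr0 mul0r.
    rewrite inE/= in_itv/= => /andP[h _]; rewrite !mulr1 mulrC /f /phase ger0_norm//.
    by apply: le_trans h; exact: ltW.
  rewrite indicE; have [|_] := boolP (xi \in _); last by rewrite !mulr0 mul0r.
  rewrite inE/= in_itv/= => /andP[_ h]; rewrite !mulr1 mulrC /f /phase ltr0_norm ?mulrNN//.
  by apply: (le_lt_trans h); rewrite oppr_lt0.
have I1 := L1_restrict (cf x); have I2 := L1_restrict cf'.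
rewrite E; split; first exact: L1D.
rewrite RintD// -!Rint_restrict mulrDr; congr (_ + _).
  rewrite Rint_scale//; last exact: cf.
  congr (_ * _); apply: eq_Rintegral => y; rewrite inE/= in_itv/= => /andP[y1 _].
  have y0 : 0 <= y by apply: le_trans y1.
  rewrite /f mulrC [lam * y / lam]mulrAC divff ?gt_eqF// mul1r; congr (_ * cos _).
  by rewrite /phase powRM ?(ltW l0)//; ring.
have -> : \int[mu]_(xi in `[- (4 * lam), - lam]) f (- x) (- xi) = \int[mu]_(xi in `[lam, 4 * lam]) f (- x) xi.
  rewrite /Rintegral; congr fine.
  rewrite (@integration_by_substitution_oppr _ (fun xi => f (- x) (- xi)) lam (4 * lam)).
  - by apply: eq_integral => y _ /=; rewrite opprK.
  - by lra.
  - exact: cont_within.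
rewrite Rint_scale//; last exact: cf.
congr (_ * _); apply: eq_Rintegral => y; rewrite inE/= in_itv/= => /andP[y1 _].
have y0 : 0 <= y by apply: le_trans y1.
rewrite /f mulrC [lam * y / lam]mulrAC divff ?gt_eqF// mul1r; congr (_ * cos _).
by rewrite /phase powRM ?(ltW l0)//; ring.
Qed.

(** The bound involves [t] only through [lam^a * |t| <= M], so it remains valid when a different
    time is chosen at each point. *)
Lemma shell_kernel : exists2 C : R, 0 < C & forall lam x t M : R, 0 < lam -> 1 <= M ->
  lam `^ a * `|t| <= M ->
  cintegrable (fun xi => (shell lam xi)%:C * cis (x * xi + t * `|xi| `^ a)) /\
  modulus (cintegral (fun xi => (shell lam xi)%:C * cis (x * xi + t * `|xi| `^ a))) <=
    C * (lam * majorant M (lam * `|x|)).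
Proof.
have [C C0 hC] := bump_kernel_bound a0 a1; exists (4 * C); first by rewrite mulr_gt0.
move=> lam x t M l0 M1 tM.
have bound c : `|\int[mu]_xi (shell lam xi * cos (x * xi + t * `|xi| `^ a + c))| <=
    2 * C * (lam * majorant M (lam * `|x|)).
  have [_ ->] := shell_cos x t c l0.
  have tM' : `|lam `^ a * t| <= M by rewrite normrM ger0_norm ?powR_ge0.
  have b1 := hC (lam * x) (lam `^ a * t) c M M1 tM'.
  have b2 := hC (lam * - x) (lam `^ a * t) c M M1 tM'.
  rewrite !normrM ?normrN (gtr0_norm l0) in b1 b2.
  rewrite normrM (gtr0_norm l0).
  have -> : 2 * C * (lam * majorant M (lam * `|x|)) = lam * (C * majorant M (lam * `|x|) + C * majorant M (lam * `|x|)) by ring.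
  apply: ler_wpM2l; first exact: ltW.
  by apply: (le_trans (ler_normD _ _)); apply: lerD.
have E1 : re (fun xi => (shell lam xi)%:C * cis (x * xi + t * `|xi| `^ a)) =
    (fun xi => shell lam xi * cos (x * xi + t * `|xi| `^ a + 0)).
  by apply/funext => xi; rewrite /re cReM/= mul0r subr0 addr0.
have E2 : im (fun xi => (shell lam xi)%:C * cis (x * xi + t * `|xi| `^ a)) =
    (fun xi => shell lam xi * cos (x * xi + t * `|xi| `^ a + (- (pi / 2)))).
  apply/funext => xi; rewrite /im cImM/= mul0r addr0; congr (_ * _).
  by rewrite cosB cos_pihalf sin_pihalf mulr0 mulr1 add0r.
split.
  split; rewrite ?E1 ?E2.
    by have [] := shell_cos x t 0 l0.
  by have [] := shell_cos x t (- (pi / 2)) l0.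
apply: (le_trans (modulus_le_ReIm _)).
have -> : 4 * C * (lam * majorant M (lam * `|x|)) =
  2 * C * (lam * majorant M (lam * `|x|)) + 2 * C * (lam * majorant M (lam * `|x|)) by ring.
by apply: lerD; rewrite /cintegral/= ?E1 ?E2; exact: bound.
Qed.

End TwoSidedKernel.

(** * The linearised maximal function at intermediate frequencies *)

Section Selection.
Context {R : realType}.

(** Linearises a finite maximum. Comparing the candidates one after another keeps measurable both
    the chosen time and the value of [Phi] at it. *)
Lemma measurable_argmax (Phi : R -> R -> R) (t : nat -> R) (m : nat) :
  (forall s, measurable_fun setT (Phi s)) ->
  exists tau : R -> R, [/\ measurable_fun setT tau,
    measurable_fun setT (fun x => Phi (tau x) x),
    (forall x, exists2 n, (n <= m)%N & tau x = t n) &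
    forall n x, (n <= m)%N -> Phi (t n) x <= Phi (tau x) x].
Proof.
move=> mPhi; elim: m => [|m [tau [m1 m2 h1 h2]]].
  exists (fun=> t 0%N); split => //.
  - by move=> x; exists 0%N.
  - by move=> n x; rewrite leqn0 => /eqP ->.
pose b x := Phi (tau x) x < Phi (t m.+1) x.
have mb : measurable_fun setT b by exact: measurable_fun_ltr.
exists (fun x => if b x then t m.+1 else tau x); split.
- exact: measurable_fun_ifT.
- rewrite (_ : (fun x => Phi (if b x then t m.+1 else tau x) x) =
    (fun x => if b x then Phi (t m.+1) x else Phi (tau x) x)).
    exact: measurable_fun_ifT.
  by apply/funext => x; case: (b x).
- move=> x; case: (b x); first by exists m.+1.
  by have [n nm ->] := h1 x; exists n => //; exact: leqW.
- move=> n x; rewrite leq_eqVlt => /predU1P[->|]; last first.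
    rewrite ltnS => /(h2 n x) h; case: ifPn => // bx.
    by rewrite (le_trans h)// ltW.
  by case: ifPn => // bx; rewrite leNgt.
Qed.

End Selection.

Section Wave.
Context {R : realType}.
Local Notation mu := (@lebesgue_measure R).
Variable a : R.
Hypothesis a0 : 0 < a.
Hypothesis a1 : a != 1.

(** The Schrödinger mean without the factor [1 / (2 * pi)], which reappears in [mean_limit] and
    [modulus_packet]. *)
Definition wave (g : R -> R[i]) (t x : R) : R[i] :=
  cintegral (fun xi => g xi * cis (x * xi + t * `|xi| `^ a)).

Lemma measurable_om : measurable_fun setT (fun xi : R => `|xi| `^ a).
Proof.
have mn : measurable_fun setT (fun x : R => `|x|) by exact: measurableT_comp.
exact: (measurableT_comp (measurable_powR a) mn).
Qed.

Lemma cmeas_phase (tau : R -> R) : measurable_fun setT tau ->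
  cmeas (fun z : R * R => cis (z.1 * z.2 + tau z.1 * `|z.2| `^ a)).
Proof.
move=> mt; apply: cmeas_cis; apply: measurable_funD; first exact: measurable_funM.
apply: measurable_funM; first exact: (measurableT_comp mt measurable_fst).
exact: (measurableT_comp measurable_om measurable_snd).
Qed.

Lemma cmeas_phase1 (t x : R) : cmeas (fun xi : R => cis (x * xi + t * `|xi| `^ a)).
Proof.
apply: cmeas_cis; apply: measurable_funD; first exact: measurable_funM.
by apply: measurable_funM => //; exact: measurable_om.
Qed.

Lemma cintegrable_wave g t x : cintegrable g ->
  cintegrable (fun xi => g xi * cis (x * xi + t * `|xi| `^ a)).
Proof.
move=> ig; apply: (cintegrableMbounded ig (M := 1)); first exact: cmeas_phase1.
by move=> xi; rewrite modulus_cis.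
Qed.

Lemma cmeas_wave_select g (tau : R -> R) : cintegrable g -> measurable_fun setT tau ->
  cmeas (fun x => wave g (tau x) x).
Proof.
move=> ig mt.
have mec' : cmeas (fun z : R * R => cis (z.2 * z.1 + tau z.2 * `|z.1| `^ a)).
  exact: (cmeas_comp (cmeas_phase mt) (measurable_fun_pair measurable_snd measurable_fst)).
by apply: (cmeas_cintegral ig mec' (M := 1)) => z; rewrite modulus_cis.
Qed.

Lemma cmeas_wave g t : cintegrable g -> cmeas (wave g t).
Proof. by move=> ig; exact: (@cmeas_wave_select g (fun=> t)). Qed.

Lemma waveD g h t x : cintegrable g -> cintegrable h ->
  wave (fun xi => g xi + h xi) t x = wave g t x + wave h t x.
Proof.
move=> ig ih; rewrite -cintegralD; [|exact: cintegrable_wave|exact: cintegrable_wave].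
by congr cintegral; apply/funext => xi; rewrite mulrDl.
Qed.

Definition sqmod (z : R[i]) : R := modulus z ^+ 2.

Lemma sqmod_ge0 z : 0 <= sqmod z. Proof. exact: sqr_ge0. Qed.

Lemma measurable_sqmod (f : R -> R[i]) : cmeas f -> measurable_fun setT (fun x => sqmod (f x)).
Proof. by move=> mf; apply: measurable_funX; exact: measurable_modulus. Qed.

Lemma sqmodD z w : sqmod (z + w) <= 2 * sqmod z + 2 * sqmod w.
Proof.
rewrite /sqmod; have h := modulusD z w; have hz := modulus_ge0 z; have hw := modulus_ge0 w.
have h0 := modulus_ge0 (z + w).
apply: (@le_trans _ _ ((modulus z + modulus w) ^+ 2)).
  by rewrite lerXn2r ?nnegrE ?addr_ge0.
have := sqr_ge0 (modulus z - modulus w); nra.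
Qed.

Lemma wave_bessel g t : cintegrable g ->
  (\int[mu]_x (sqmod (wave g t x))%:E <= (bessel_cst : R)%:E * \int[mu]_xi (sqmod (g xi))%:E)%E.
Proof.
move=> ig.
have igt : cintegrable (fun xi => g xi * cis (t * `|xi| `^ a)).
  apply: (cintegrableMbounded ig (M := 1)).
    by apply: cmeas_cis; apply: measurable_funM => //; exact: measurable_om.
  by move=> xi; rewrite modulus_cis.
have := bessel igt.
rewrite (_ : (fun x => (modulus (g x * cis (t * `|x| `^ a)) ^+ 2)%:E) = (fun xi => (sqmod (g xi))%:E)).
  apply: le_trans; rewrite le_eqVlt; apply/orP; left; apply/eqP; apply: eq_integral => x _.
  congr ((modulus _ ^+ 2)%:E); congr cintegral; apply/funext => xi.
  by rewrite -mulrA -cisD addrC [x * xi]mulrC.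
by apply/funext => xi; rewrite modulusM modulus_cis mulr1.
Qed.

Lemma modulus_cisB (r s : R) : modulus (cis r - cis s) <= 2 * `|r - s|.
Proof.
have lip (f df : R -> R) : (forall x : R, is_derive x (1 : R) f (df x)) -> (forall x, `|df x| <= 1) ->
    `|f r - f s| <= `|r - s|.
  move=> hf hdf; wlog rs : r s / r <= s.
    move=> H; have [|/ltW] := leP r s; first exact: H.
    by rewrite distrC [`|r - s|]distrC; exact: H.
  have cf : {within `[r, s], continuous f} by apply: cont_within => x _; exact: (der_cont (hf x)).
  have [c _ E] := MVT_segment rs (fun x _ => hf x) cf.
  rewrite distrC E [`|r - s|]distrC normrM -[leRHS]mul1r ler_wpM2r//.
apply: (le_trans (modulus_le_ReIm _)); rewrite mulrDl mul1r.
rewrite cReD cReN cImD cImN /=; apply: lerD.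
  apply: (lip cos (fun x => - sin x)) => x; rewrite normrN ler_norml.
  by rewrite sin_geN1 sin_le1.
apply: (lip sin cos) => x; rewrite ler_norml.
by rewrite cos_geN1 cos_le1.
Qed.

Lemma geometric_le (q : R) (m : nat) : 0 <= q -> q < 1 -> \sum_(i < m) q ^+ i <= (1 - q)^-1.
Proof.
move=> q0 q1; have h : 0 < 1 - q by rewrite subr_gt0.
rewrite -[leRHS]mul1r ler_pdivlMr// mulrC.
have := subrX1 q m; have : 0 <= q ^+ m by rewrite exprn_ge0.
move: (\sum_(i < m) _) (q ^+ m) => S Q; nra.
Qed.


Lemma Ie_shift (G : R -> R) (x0 : R) : continuous G -> (forall x, 0 <= G x) ->
  (\int[mu]_y (G (y - x0))%:E = \int[mu]_y (G y)%:E)%E.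
Proof.
move=> cG G0; pose F (y : R) := y - x0.
have dF (y : R) : is_derive y (1 : R) F 1.
  by have := derB (der_id y) (der_cst x0 y); rewrite subr0.
have F' : F^`()%classic = fun=> 1.
  by apply/funext => y; rewrite derive1E; exact: derive_val.
rewrite (@increasing_ge0_integration_by_substitutionT R F G)//.
- by apply: eq_integral => y _; rewrite F' /= mulr1.
- by move=> x y; rewrite /F ltrD2r.
- by rewrite F'; exact: cst_continuous.
- by rewrite F'; exact: is_cvg_cst.
- by rewrite F'; exact: is_cvg_cst.
- exact: cvg_addrr_Ny.
- exact: cvg_addrr.
Qed.

Lemma cintegral_sum_le (I : nat) (F : nat -> R -> R[i]) (b : nat -> R) :
  (forall i, (i < I)%N -> cintegrable (F i) /\ modulus (cintegral (F i)) <= b i) ->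
  cintegrable (fun xi => \sum_(i < I) F i xi) /\
  modulus (cintegral (fun xi => \sum_(i < I) F i xi)) <= \sum_(i < I) b i.
Proof.
elim: I => [|I IH] h.
  have -> : (fun xi : R => \sum_(i < 0) F i xi) = (fun=> (0 : R)%:C).
    by apply/funext => xi; rewrite big_ord0.
  have i0 : cintegrable (fun=> (0 : R)%:C) by split; exact: L1_0.
  by split => //; rewrite cintegral_real big_ord0 Rintegral_cst// mul0r modulus_real normr0.
have [i1 h1] := IH (fun i iI => h i (leqW iI)); have [i2 h2] := h I (ltnSn I).
have -> : (fun xi : R => \sum_(i < I.+1) F i xi) = (fun xi => \sum_(i < I) F i xi + F I xi).
  by apply/funext => xi; rewrite big_ord_recr.
split; first exact: cintegrableD.
rewrite cintegralD// big_ord_recr/=; apply: (le_trans (modulusD _ _)); exact: lerD.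
Qed.

Lemma L1_sum (I : nat) (F : nat -> R -> R) : (forall i, (i < I)%N -> L1 (F i)) ->
  L1 (fun xi => \sum_(i < I) F i xi).
Proof.
elim: I => [|I IH] h.
  have -> : (fun xi : R => \sum_(i < 0) F i xi) = (fun=> 0).
    by apply/funext => xi; rewrite big_ord0.
  exact: L1_0.
have -> : (fun xi : R => \sum_(i < I.+1) F i xi) = (fun xi => \sum_(i < I) F i xi + F I xi).
  by apply/funext => xi; rewrite big_ord_recr.
by apply: L1D; [exact: (IH (fun i iI => h i (leqW iI)))|exact: h].
Qed.

(** The endpoints have ratio two, so the dyadic dilates of this interval leave no gaps. *)
Lemma bump_ge1 (u : R) : 3 / 2 <= u <= 3 -> 1 <= bump u.
Proof.
move=> /andP[u1 u2]; rewrite /bump; have h : 1 <= (u - 1) * (4 - u) by nra.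
nra.
Qed.

Lemma powR_small (r : R) (x : R) : 0 < r -> r < 1 -> 0 < x ->
  exists I : nat, x * r ^+ I < 1.
Proof.
move=> r0 r1 x0; have : r ^+ n @[n --> \oo] --> 0 by apply: cvg_expr; rewrite gtr0_norm.
move=> /cvgrPdist_lt /(_ x^-1); rewrite invr_gt0 => /(_ x0) [I _ /(_ I (leqnn I))] /=.
rewrite sub0r normrN ger0_norm ?exprn_ge0 ?(ltW r0)// => h; exists I.
by rewrite -(mulfV (lt0r_neq0 x0)) ltr_pM2l.
Qed.

Lemma powRX (x p : R) (n : nat) : 0 <= x -> (x ^+ n) `^ p = (x `^ p) ^+ n.
Proof.
move=> x0; rewrite -(powR_mulrn n x0) -(powR_mulrn n (powR_ge0 x p)).
by rewrite -!powRrM mulrC.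
Qed.

Section BlockB.
Variables (sg L T : R).
Hypotheses (sg0 : 0 < sg) (sg2 : sg < 2^-1) (L0 : 0 < L) (T0 : 0 < T).

(** Halving [xi] multiplies [|xi|^a] by [r]. The coefficients of the shells grow by [c > 1] while
    the square roots of the kernel integrals shrink, and [th < 1] is the ratio that results; it is
    below one because [sg < 1 / 2]. *)
Let r : R := 2^-1 `^ a.
Let th : R := r `^ (2^-1 - sg).
Let c : R := r `^ (- sg).
Let xi0 : R := L `^ a^-1.
(** The division by 3 puts the frequencies between [xi0 / 2^(i + 1)] and [xi0 / 2^i] at [[3/2, 3]]
    in units of [lam i], where [bump] is at least one. *)
Let lam (i : nat) : R := xi0 * 2^-1 ^+ i / 3.

Let half0 : 0 < 2^-1 :> R. Proof. by rewrite invr_gt0 ltr0n. Qed.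
Let r0 : 0 < r. Proof. exact: powR_gt0. Qed.
Let r1 : r < 1.
Proof. have e1 : 1 `^ a = 1 :> R by rewrite powR1.
by rewrite -[ltRHS]e1; apply: gt0_ltr_powR; rewrite ?nnegrE ?(ltW half0)// invf_lt1 ?ltr1n. Qed.
Let c0 : 0 < c. Proof. exact: powR_gt0. Qed.
Let xi00 : 0 < xi0. Proof. exact: powR_gt0. Qed.
Let halfi i : 0 < 2^-1 ^+ i :> R. Proof. by rewrite exprn_gt0. Qed.
Let lam0 i : 0 < lam i. Proof. by rewrite /lam divr_gt0 ?mulr_gt0. Qed.

Let xi0a i : (xi0 * 2^-1 ^+ i) `^ a = L * r ^+ i.
Proof.
rewrite powRM ?(ltW xi00) ?(ltW (halfi i))// /xi0 -powRrM mulVf ?gt_eqF// powRr1 ?(ltW L0)//.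
by rewrite powRX ?(ltW half0).
Qed.

Let lama i : lam i `^ a <= L * r ^+ i.
Proof.
rewrite -xi0a; apply: ge0_ler_powR; rewrite ?nnegrE ?(ltW a0) ?(ltW (lam0 i))//.
  by rewrite mulr_ge0// ltW.
by rewrite /lam ler_pdivrMr// ler_peMr ?ler1n// mulr_ge0// ltW.
Qed.

Let crth i : c ^+ i * Num.sqrt (r ^+ i) = th ^+ i.
Proof.
rewrite -powR12_sqrt ?exprn_ge0 ?(ltW r0)// powRX ?(ltW r0)// -exprMn.
by rewrite /c /th -powRD ?(gt_eqF r0) ?implybT// addrC.
Qed.

(* The weight is a sum over [i] of smooth bumps at frequency [lam i], with coefficients growing
   like [(|xi|^a / L)^(- sg)]; the shells with [|xi|^a < 1 / T] are not needed. *)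
Lemma block_B_weight : exists I : nat,
  (forall i, (i < I)%N -> 1 <= L * T * r ^+ i) /\
  (forall xi : R, T^-1 < `|xi| `^ a <= L ->
     1 <= (\sum_(i < I) c ^+ i * shell (lam i) xi) * (c * (`|xi| `^ a / L) `^ sg)).
Proof.
(* [I] will be the first such index: earlier shells satisfy [L * T * r^i >= 1], as the kernel bound
   requires, and later ones lie below [|xi|^a = 1 / T]. *)
have exI : exists I, L * T * r ^+ I < 1 by apply: powR_small r0 r1 (mulr_gt0 L0 T0).
case: (ex_minnP exI) => I hI minI.
exists I; split.
  by move=> i iI; rewrite leNgt; apply/negP => /minI; rewrite leqNgt iI.
move=> xi /andP[om1 om2].
have exm : exists m, xi0 * 2^-1 ^+ m < `|xi|.
  exists I; rewrite ltNge; apply/negP => h.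
  have : `|xi| `^ a <= L * r ^+ I.
    rewrite -xi0a; apply: ge0_ler_powR => //; rewrite ?nnegrE ?(ltW a0)//.
    by rewrite mulr_ge0// ltW.
  move=> /(lt_le_trans om1); rewrite -[X in X < _]mul1r ltr_pdivrMr// => h'.
  by have := lt_trans hI h'; rewrite mulrAC ltxx.
(* The least [m] locates [xi] in the shell [m - 1]; [m = 0] is excluded by [|xi|^a <= L]. *)
case: (ex_minnP exm) => m hm minm.
have mI : (m <= I)%N.
  apply: minm; rewrite ltNge; apply/negP => h.
  have : `|xi| `^ a <= L * r ^+ I.
    rewrite -xi0a; apply: ge0_ler_powR => //; rewrite ?nnegrE ?(ltW a0)//.
    by rewrite mulr_ge0// ltW.
  move=> /(lt_le_trans om1); rewrite -[X in X < _]mul1r ltr_pdivrMr// => h'.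
  by have := lt_trans hI h'; rewrite mulrAC ltxx.
case: m => [|i] in hm minm mI *.
  exfalso; have : L < `|xi| `^ a.
    have := xi0a 0; rewrite expr0 !mulr1 => <-.
    apply: gt0_ltr_powR => //; rewrite ?nnegrE ?(ltW xi00)//.
    by move: hm; rewrite expr0 mulr1.
  by rewrite ltNge om2.
have hi : `|xi| <= xi0 * 2^-1 ^+ i.
  by rewrite leNgt; apply/negP => /minm; rewrite ltnn.
have u1 : 1 <= shell (lam i) xi.
  have l3 : lam i * 3 = xi0 * 2^-1 ^+ i by rewrite /lam divfK.
  have l32 : lam i * (3 / 2) = xi0 * 2^-1 ^+ i.+1 by rewrite mulrA l3 exprSr; ring.
  have ha : 3 / 2 <= `|xi| / lam i by rewrite ler_pdivlMr// mulrC l32 ltW.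
  have hb : `|xi| / lam i <= 3 by rewrite ler_pdivrMr// mulrC l3.
  rewrite /shell indicE mem_set ?mulr1; first by apply: bump_ge1; rewrite ha hb.
  rewrite /= in_itv/=; apply/andP; split.
    by rewrite -[leLHS]mul1r -ler_pdivlMr//; apply: le_trans ha; rewrite ler_pdivlMr// mul1r ler_nat.
  by rewrite -ler_pdivrMr//; apply: (le_trans hb); rewrite ler_nat.
have wi : c ^+ i <= \sum_(i < I) c ^+ i * shell (lam i) xi.
  rewrite (bigD1 (Ordinal mI))//=; rewrite -[leLHS]addr0; apply: lerD.
    by rewrite ler_peMr// exprn_ge0// ltW.
  by apply: sumr_ge0 => k _; rewrite mulr_ge0 ?shell_ge0// exprn_ge0// ltW.
(* Only the lower end of the shell bounds [|xi|^a] from below; this costs the extra factor [c] in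
   the statement. *)
have omr : r ^+ i.+1 <= `|xi| `^ a / L.
  rewrite ler_pdivlMr// mulrC -xi0a; apply: ge0_ler_powR; rewrite ?nnegrE ?(ltW a0)//.
  by rewrite mulr_ge0// ltW. exact: ltW.
have ci : (c ^+ i.+1)^-1 <= (`|xi| `^ a / L) `^ sg.
  have -> : (c ^+ i.+1)^-1 = (r ^+ i.+1) `^ sg.
    by rewrite powRX ?(ltW r0)// /c powRN exprVn invrK.
  by apply: ge0_ler_powR; rewrite ?nnegrE ?(ltW sg0) ?exprn_ge0 ?(ltW r0)// divr_ge0 ?powR_ge0// ltW.
have ci0 : 0 < c ^+ i.+1 by rewrite exprn_gt0.
apply: (@le_trans _ _ (c ^+ i * (c * (c ^+ i.+1)^-1))).
  by rewrite mulrA -exprSr divff// gt_eqF.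
apply: ler_pM => //; rewrite ?exprn_ge0 ?(ltW c0)//.
  by rewrite mulr_ge0 ?invr_ge0 ?(ltW c0) ?(ltW ci0).
by rewrite ler_pM2l.
Qed.


(** One Schur test for all shells together. The kernel at [(x, y)] sees the time difference
    [tau x - tau y], at most [T] in modulus, so shell [i] is controlled with [M i = L * T * r^i].
    Its majorant has integral of order [sqrt (M i)], and with the coefficient [c^i] this gives
    [sqrt (L * T) * th^i], a geometric series. *)
Lemma block_B_bound (C1 : R) : 0 < C1 ->
  (forall lam x t M : R, 0 < lam -> 1 <= M -> lam `^ a * `|t| <= M ->
    cintegrable (fun xi => (shell lam xi)%:C * cis (x * xi + t * `|xi| `^ a)) /\
    modulus (cintegral (fun xi => (shell lam xi)%:C * cis (x * xi + t * `|xi| `^ a))) <=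
      C1 * (lam * majorant M (lam * `|x|))) ->
  forall (g : R -> R[i]) (tau : R -> R),
    cintegrable g -> (forall xi, g xi != 0 -> T^-1 < `|xi| `^ a <= L) ->
    measurable_fun setT tau -> (forall x, 0 <= tau x <= T) ->
    (\int[mu]_x (sqmod (wave g (tau x) x))%:E <=
      (C1 * 8 * Num.sqrt (L * T) * (1 - th)^-1 * c)%:E *
        \int[mu]_xi ((`|xi| `^ a / L) `^ sg * sqmod (g xi))%:E)%E.
Proof.
move=> C10 hK g tau ig gsupp mtau htau.
have [I [hI hw]] := block_B_weight.
have th1 : 0 < 1 - th.
  have e1 : 1 `^ (2^-1 - sg) = 1 :> R by rewrite powR1.
  rewrite subr_gt0 -[ltRHS]e1; apply: gt0_ltr_powR; rewrite ?subr_gt0// ?nnegrE ?(ltW r0)//.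
have LT0 : 0 < L * T by exact: mulr_gt0.
have LT0' : 0 < Num.sqrt (L * T) by rewrite sqrtr_gt0.
have cc i : 0 <= c ^+ i by rewrite exprn_ge0// ltW.
pose M i : R := L * T * r ^+ i.
pose e (z : R * R) := cis (z.1 * z.2 + tau z.1 * `|z.2| `^ a).
pose w (xi : R) : R := \sum_(i < I) c ^+ i * shell (lam i) xi.
pose k (z : R * R) : R :=
  \sum_(i < I) c ^+ i * (C1 * (lam i * majorant (M i) (lam i * `|z.1 - z.2|))).
pose A : R := C1 * 8 * Num.sqrt (L * T) * (1 - th)^-1.
have A0 : 0 < A by rewrite !mulr_gt0// invr_gt0.
have maj0 i (y : R) : (i < I)%N -> 0 <= y -> 0 <= majorant (M i) y.
  by move=> iI; exact: (majorant_ge0 (hI i iI)).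
have cmaj i : (i < I)%N -> continuous (fun x : R => lam i * majorant (M i) (lam i * `|x|)).
  by move=> iI x; exact: (@contM R _ _ x (@cont_cst R (lam i) x) (@cont_majorant R _ _ (hI i iI) (lam0 i) x)).
have kint (x : R) (F : nat -> R -> R) :
    (forall i, (i < I)%N -> F i = fun y => lam i * majorant (M i) (lam i * `|y - x|)) ->
    (\int[mu]_y (\sum_(i < I) c ^+ i * (C1 * F i y))%:E <= A%:E)%E.
  move=> hF.
  have mF i : (i < I)%N -> measurable_fun setT (F i).
    move=> iI; rewrite hF//.
    have m1 : measurable_fun setT (fun y : R => y - x) by exact: measurable_funB.
    exact: (measurableT_comp (continuous_measurable_fun (cmaj i iI)) m1).
  have F0 i y : (i < I)%N -> 0 <= F i y.
    by move=> iI; rewrite hF// mulr_ge0 ?(ltW (lam0 i))// maj0// mulr_ge0// ltW.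
  rewrite (@Ie_sum R 'I_I _ (fun i y => c ^+ i * (C1 * F i y))); last 2 first.
  - by move=> i; apply: measurable_funM => //; apply: measurable_funM => //; exact: mF.
  - by move=> i y; rewrite mulr_ge0// mulr_ge0 ?(ltW C10)//; exact: F0.
  apply: (@le_trans _ _ (\sum_(i < I) (c ^+ i * (C1 * (8 * Num.sqrt (M i))))%:E)%E).
    apply: lee_sum => i _.
    have iI := ltn_ord i; have mFi := mF i iI; have F0i y := F0 i y iI.
    rewrite (@IeZ R (c ^+ i) (fun y => C1 * F i y)) ?cc//; last 2 first.
    - by apply: measurable_funM.
    - by move=> y; rewrite mulr_ge0 ?(ltW C10).
    rewrite IeZ ?(ltW C10)// !EFinM; apply: lee_wpmul2l; first by rewrite lee_fin.
    apply: lee_wpmul2l; first by rewrite lee_fin ltW.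
    rewrite hF// (@Ie_shift (fun y => lam i * majorant (M i) (lam i * `|y|)))//.
    - by rewrite -EFinM; exact: (majorant_int (hI i iI) (lam0 i)).
    - exact: cmaj.
    - by move=> y; rewrite mulr_ge0 ?(ltW (lam0 i))// maj0// mulr_ge0// ltW.
  rewrite sumEFin lee_fin /A.
  have -> : \sum_(i < I) c ^+ i * (C1 * (8 * Num.sqrt (M i))) =
      C1 * 8 * Num.sqrt (L * T) * \sum_(i < I) th ^+ i.
    rewrite mulr_sumr; apply: eq_bigr => i _.
    rewrite /M sqrtrM ?(ltW LT0)// -crth; ring.
  apply: ler_wpM2l; first by rewrite ltW// !mulr_gt0.
  by apply: geometric_le; rewrite ?powR_ge0// -subr_gt0.
pose rho xi := c * ((`|xi| `^ a / L) `^ sg * sqmod (g xi)).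
have rho0 xi : 0 <= rho xi by exact: (mulr_ge0 (ltW c0) (mulr_ge0 (powR_ge0 _ _) (sqmod_ge0 _))).
have mrho1 : measurable_fun setT (fun xi : R => (`|xi| `^ a / L) `^ sg * sqmod (g xi)).
  apply: measurable_funM.
    apply: (measurableT_comp (measurable_powR sg)).
    by apply: measurable_funM => //; exact: measurable_om.
  apply: measurable_sqmod; exact: cintegrable_meas.
have mrho : measurable_fun setT rho by apply: measurable_funM.
have -> : ((A * c)%:E * \int[mu]_xi ((`|xi| `^ a / L) `^ sg * sqmod (g xi))%:E =
    A%:E * \int[mu]_xi (rho xi)%:E)%E.
  rewrite EFinM -muleA; congr (_ * _)%E; rewrite IeZ ?(ltW c0)// => xi.
  exact: (mulr_ge0 (powR_ge0 _ _) (sqmod_ge0 _)).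
apply: (@schur_dual R w e k A) => //.
- apply: (@L1_sum I (fun i xi => c ^+ i * shell (lam i) xi)) => i iI; apply: L1Zl; have [h _] := shell_cos a 0 0 0 (lam0 i).
  by move: h; congr (L1 _); apply/funext => xi; rewrite !mul0r !addr0 cos0 mulr1.
- by move=> xi; apply: sumr_ge0 => i _; rewrite mulr_ge0 ?shell_ge0.
- exact: cmeas_phase.
- by move=> z; rewrite modulus_cis.
- apply: measurable_sum => i; apply: measurable_funM => //; apply: measurable_funM => //.
  have m1 : measurable_fun setT (fun z : R * R => z.1 - z.2).
    by apply: measurable_funB.
  exact: (measurableT_comp (continuous_measurable_fun (cmaj i (ltn_ord i))) m1).
- move=> z; apply: sumr_ge0 => i _; apply: (mulr_ge0 (cc i)); apply: (mulr_ge0 (ltW C10)).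
  apply: (mulr_ge0 (ltW (lam0 i))); apply: (maj0 i _ (ltn_ord i)).
  exact: (mulr_ge0 (ltW (lam0 i)) (normr_ge0 _)).
- move=> x y; pose G i (xi : R) := (c ^+ i)%:C *
    ((shell (lam i) xi)%:C * cis ((x - y) * xi + (tau x - tau y) * `|xi| `^ a)).
  rewrite (_ : (fun xi => _) = (fun xi => \sum_(i < I) G i xi)).
    apply: (@cintegral_sum_le I G (fun i => c ^+ i * (C1 * (lam i * majorant (M i) (lam i * `|x - y|)))) _).2 => i iI.
    have tt : lam i `^ a * `|tau x - tau y| <= M i.
      rewrite /M mulrAC; apply: ler_pM; rewrite ?powR_ge0//.
      by move: (htau x) (htau y) => /andP[? ?] /andP[? ?]; rewrite ler_norml; apply/andP; split; lra.
    have [i1 i2] := hK (lam i) (x - y) (tau x - tau y) (M i) (lam0 i) (hI i iI) tt.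
    split; first exact: cintegrableZ.
    by rewrite cintegralZ// modulusM modulus_real ger0_norm// ler_wpM2l.
  apply/funext => xi; rewrite /e /= conjc_cis -mulrA -cisD /w /G raddf_sum/= mulr_suml.
  apply: eq_bigr => i _; rewrite real_complexM -mulrA; congr (_ * (_ * cis _)); ring.
- move=> x; apply: (kint x (fun i y => lam i * majorant (M i) (lam i * `|x - y|))) => i iI.
  by apply/funext => y; rewrite distrC.
- by move=> y; apply: (kint y (fun i x => lam i * majorant (M i) (lam i * `|x - y|))) => i iI.
- move=> xi; have [->|gx] := eqVneq (g xi) 0.
    rewrite modulus0 expr0n/= mulr_ge0//.
    by apply: sumr_ge0 => i _; rewrite mulr_ge0 ?shell_ge0.
  rewrite (_ : w xi * rho xi = (w xi * (c * (`|xi| `^ a / L) `^ sg)) * sqmod (g xi)); last first.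
    by rewrite /rho; ring.
  by rewrite -[X in X <= _]mul1r ler_wpM2r ?sqmod_ge0//; exact: (hw xi (gsupp xi gx)).
Qed.

End BlockB.

Lemma block_B (sg : R) : 0 < sg -> sg < 2^-1 -> exists2 C : R, 0 < C &
  forall (L T : R) (g : R -> R[i]) (tau : R -> R), 0 < L -> 0 < T ->
    cintegrable g -> (forall xi, g xi != 0 -> T^-1 < `|xi| `^ a <= L) ->
    measurable_fun setT tau -> (forall x, 0 <= tau x <= T) ->
    (\int[mu]_x (sqmod (wave g (tau x) x))%:E <=
      (C * Num.sqrt (L * T))%:E * \int[mu]_xi ((`|xi| `^ a / L) `^ sg * sqmod (g xi))%:E)%E.
Proof.
move=> sg0 sg2; have [C1 C10 hK] := shell_kernel a0 a1.
pose th : R := (2^-1 `^ a) `^ (2^-1 - sg); pose c : R := (2^-1 `^ a) `^ (- sg).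
exists (C1 * 8 * `|(1 - th)^-1| * c + 1); first by rewrite ltr_wpDl// !mulr_ge0 ?powR_ge0 ?(ltW C10).
move=> L T g tau L0 T0 ig gsupp mtau htau.
apply: (le_trans (block_B_bound sg0 sg2 L0 T0 C10 hK ig gsupp mtau htau)).
apply: lee_wpmul2r; first by apply: Ie_ge0 => xi; exact: (mulr_ge0 (powR_ge0 _ _) (sqmod_ge0 _)).
rewrite lee_fin -/th -/c [leLHS](_ : _ = C1 * 8 * (1 - th)^-1 * c * Num.sqrt (L * T)); last ring.
apply: ler_wpM2r; first exact: sqrtr_ge0.
apply: ler_wpDr => //; apply: ler_wpM2r; first exact: powR_ge0.
by apply: ler_wpM2l; [rewrite mulr_ge0// ltW|exact: ler_norm].
Qed.

End Wave.

(** * The maximal inequality for integrable data *)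

Lemma bessel_cst_ge0 {R : realType} : 0 <= bessel_cst :> R.
Proof. by rewrite /bessel_cst !mulr_ge0 ?expR_ge0 ?pi_ge0. Qed.

Lemma measurable_sobolev_weight {R : realType} (s : R) :
  measurable_fun setT (fun xi : R => (1 + `|xi| ^+ 2) `^ s).
Proof.
have mn : measurable_fun setT (fun x : R => `|x|) by exact: measurableT_comp.
apply: (measurableT_comp (measurable_powR s)); apply: measurable_funD => //.
exact: (measurable_funX 2 mn).
Qed.

Section CutOff.
Context {R : realType}.
Local Notation mu := (@lebesgue_measure R).
Implicit Types (b : R -> bool) (g : R -> R[i]).

Definition cut b g (xi : R) : R[i] := ((b xi)%:R : R)%:C * g xi.

Lemma measurable_bool01 b : measurable_fun setT b ->
  measurable_fun setT (fun xi => (b xi)%:R : R).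
Proof.
move=> mb; rewrite (_ : (fun xi => _) = (fun xi => if b xi then 1 else 0 : R)).
  exact: measurable_fun_ifT.
by apply/funext => xi; case: (b xi).
Qed.

Lemma cintegrable_cut b g : measurable_fun setT b -> cintegrable g -> cintegrable (cut b g).
Proof.
move=> mb ig.
rewrite (_ : cut b g = fun xi => g xi * ((b xi)%:R : R)%:C); last first.
  by apply/funext => xi; rewrite /cut mulrC.
apply: (cintegrableMbounded ig (M := 1)); first by apply: cmeas_real; exact: measurable_bool01.
by move=> xi; rewrite modulus_real; case: (b xi); rewrite ?normr1 ?normr0.
Qed.

Lemma sqmod_cut b g xi : sqmod (cut b g xi) = (b xi)%:R * sqmod (g xi).
Proof.
rewrite /sqmod /cut modulusM modulus_real; case: (b xi); first by rewrite normr1 !mul1r.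
by rewrite normr0 !mul0r expr0n.
Qed.

Lemma cut_split b b1 b2 g xi : (b xi)%:R = (b1 xi)%:R + (b2 xi)%:R :> R ->
  cut b g xi = cut b1 g xi + cut b2 g xi.
Proof. by move=> h; rewrite /cut h real_complexD mulrDl. Qed.

Lemma cut_true g xi : cut xpredT g xi = g xi.
Proof. by rewrite /cut mul1r. Qed.

Lemma wave_split a b b1 b2 g t x : measurable_fun setT b1 -> measurable_fun setT b2 ->
  cintegrable g -> (forall xi, (b xi)%:R = (b1 xi)%:R + (b2 xi)%:R :> R) ->
  wave a (cut b g) t x = wave a (cut b1 g) t x + wave a (cut b2 g) t x.
Proof.
move=> m1 m2 ig hb.
have -> : cut b g = (fun xi => cut b1 g xi + cut b2 g xi) by apply/funext => xi; exact: cut_split.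
exact: (waveD _ _ _ (cintegrable_cut m1 ig) (cintegrable_cut m2 ig)).
Qed.

(** Fits the decomposition in [block_maximal]: [p] is the low part minus its value at time 0, [q]
    and [u] are the middle and high parts, and [v] is everything but the low part at time 0. *)
Lemma sqmod_add4 (p q u v : R[i]) (A B C : R) : sqmod p <= A -> sqmod q <= B -> sqmod u <= C ->
  sqmod (p - v + (q + u)) <= 4 * ((A + sqmod v) + (B + C)).
Proof.
have h1 := sqmodD (p - v) (q + u); have h2 := sqmodD p (- v); have h3 := sqmodD q u.
have hv : sqmod (- v) = sqmod v by rewrite /sqmod modulusN.
rewrite hv in h2; move: h1 h2 h3; set s1 := sqmod (_ + (q + u)).
move: (sqmod (p - v)) (sqmod (q + u)) (sqmod p) (sqmod q) (sqmod u) (sqmod v) s1.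
move=> s2 s3 s4 s5 s6 s7 s1; lra.
Qed.

End CutOff.

(** * Low frequencies: telescoping in time *)

Section BlockAC.
Context {R : realType}.
Local Notation mu := (@lebesgue_measure R).
Variable a : R.

(* Cauchy-Schwarz for a telescoping sum, with weights the increments of [S]. *)
Lemma sqmod_telescope (z : nat -> R[i]) (S : nat -> R) (m : nat) :
  (forall i, (i < m)%N -> S i < S i.+1) -> forall k, (k <= m)%N ->
  S 0%N <= S k /\
  sqmod (z k - z 0%N) <= (S k - S 0%N) * \sum_(i < k) sqmod (z i.+1 - z i) / (S i.+1 - S i).
Proof.
move=> hS; elim=> [|k IH] km.
  by rewrite !subrr mul0r /sqmod modulus0 expr0n.
have [IH1 IH2] := IH (ltnW km); have d0 := hS k km.
split; first by rewrite (le_trans IH1)// ltW.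
rewrite big_ord_recr/=; move: IH2; set Q := \sum_(i < k) _ => IH2.
have Q0 : 0 <= Q.
  apply: sumr_ge0 => i _; rewrite divr_ge0 ?sqmod_ge0// subr_ge0 ltW//.
  exact: (hS i (ltn_trans (ltn_ord i) km)).
pose A := modulus (z k - z 0%N); pose p := modulus (z k.+1 - z k) / (S k.+1 - S k).
pose D := S k - S 0%N; pose d := S k.+1 - S k.
have dd0 : 0 < d by rewrite subr_gt0.
have D0 : 0 <= D by rewrite subr_ge0.
have A0 : 0 <= A by exact: modulus_ge0.
have p0 : 0 <= p by rewrite divr_ge0 ?modulus_ge0// ltW.
have AQ : A ^+ 2 <= D * Q by [].
have hp : modulus (z k.+1 - z k) = p * d by rewrite divfK// gt_eqF.
have -> : sqmod (z k.+1 - z k) / (S k.+1 - S k) = p ^+ 2 * d.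
  by rewrite /sqmod hp -/d expr2 expr2; field; rewrite gt_eqF.
have -> : S k.+1 - S 0%N = D + d by rewrite /D /d; ring.
have tri : modulus (z k.+1 - z 0%N) <= A + p * d.
  rewrite -hp /A (_ : z k.+1 - z 0%N = (z k - z 0%N) + (z k.+1 - z k)); last ring.
  exact: modulusD.
(* AM-GM applied to [A^2 <= D * Q]; when [D = 0] this forces [A = 0]. *)
have h2 : 2 * A * p <= D * p ^+ 2 + Q.
  move: D0; rewrite le_eqVlt => /predU1P[D0|D0].
    have A00 : A = 0.
      apply/eqP; rewrite -sqrf_eq0 eq_le sqr_ge0 andbT.
      by apply: (le_trans AQ); rewrite -D0 mul0r.
    by rewrite A00 -D0 mulr0 !mul0r add0r.
  rewrite -(ler_pM2l D0) -subr_ge0.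
  have -> : D * (D * p ^+ 2 + Q) - D * (2 * A * p) = (D * p - A) ^+ 2 + (D * Q - A ^+ 2) by ring.
  by rewrite addr_ge0 ?sqr_ge0// subr_ge0.
apply: (@le_trans _ _ ((A + p * d) ^+ 2)).
  by rewrite /sqmod lerXn2r ?nnegrE ?modulus_ge0// addr_ge0// mulr_ge0// ltW.
rewrite -subr_ge0.
have -> : (D + d) * (Q + p ^+ 2 * d) - (A + p * d) ^+ 2 =
  (D * Q - A ^+ 2) + d * (D * p ^+ 2 + Q - 2 * A * p) by ring.
by rewrite addr_ge0 ?subr_ge0// mulr_ge0 ?subr_ge0// ltW.
Qed.

Lemma measurable_sqmod_wave g t : cintegrable g -> measurable_fun setT (fun x => sqmod (wave a g t x)).
Proof. by move=> ig; apply: measurable_sqmod; exact: cmeas_wave. Qed.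

Lemma wave_increment g (r s : R) : cintegrable g -> measurable_fun setT (fun x => sqmod (wave a g r x - wave a g s x)) /\
  (\int[mu]_x (sqmod (wave a g r x - wave a g s x))%:E <=
    (4 * bessel_cst * (r - s) ^+ 2)%:E * \int[mu]_xi ((`|xi| `^ a) ^+ 2 * sqmod (g xi))%:E)%E.
Proof.
move=> ig; pose h xi := g xi * (cis (r * `|xi| `^ a) - cis (s * `|xi| `^ a)).
have mc (t : R) : cmeas (fun xi : R => cis (t * `|xi| `^ a)).
  by apply: cmeas_cis; apply: measurable_funM => //; exact: measurable_om.
have ih : cintegrable h.
  apply: (cintegrableMbounded ig (M := 2)); first by apply: cmeasD => //; apply: cmeasN.
  move=> xi; apply: (le_trans (modulusD _ _)).
  by rewrite modulusN !modulus_cis.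
have E x : wave a g r x - wave a g s x = wave a h 0 x.
  rewrite -cintegralB; [|exact: cintegrable_wave|exact: cintegrable_wave].
  congr cintegral; apply/funext => xi; rewrite /h mul0r addr0 !cisD; ring.
have -> : (fun x => sqmod (wave a g r x - wave a g s x)) = (fun x => sqmod (wave a h 0 x)).
  by apply/funext => x; rewrite E.
split; first exact: measurable_sqmod_wave.
rewrite (_ : (fun x => _%:E) = (fun x => (sqmod (wave a h 0 x))%:E)); last first.
  by apply/funext => x; rewrite E.
apply: (le_trans (wave_bessel a 0 ih)).
have mg : measurable_fun setT (fun xi : R => (`|xi| `^ a) ^+ 2 * sqmod (g xi)).
  apply: measurable_funM; first by apply: measurable_funX; exact: measurable_om.
  by apply: measurable_sqmod; exact: cintegrable_meas.
have g0 xi : 0 <= (`|xi| `^ a) ^+ 2 * sqmod (g xi) by rewrite mulr_ge0 ?sqr_ge0 ?sqmod_ge0.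
have b0 : 0 <= bessel_cst :> R by exact: bessel_cst_ge0.
have c0 : 0 <= 4 * (r - s) ^+ 2 by rewrite mulr_ge0// sqr_ge0.
rewrite [leRHS](_ : _ = bessel_cst%:E * ((4 * (r - s) ^+ 2)%:E *
  \int[mu]_xi ((`|xi| `^ a) ^+ 2 * sqmod (g xi))%:E))%E; last first.
  by rewrite muleA -EFinM; congr (_%:E * _)%E; ring.
apply: lee_wpmul2l; first by rewrite lee_fin.
rewrite -IeZ//; apply: le_Ie => //.
- by apply: measurable_sqmod; exact: cintegrable_meas.
- exact: measurable_funM.
- by move=> xi; exact: sqmod_ge0.
move=> xi; rewrite /sqmod /h modulusM exprMn mulrC mulrA; apply: ler_wpM2r; first exact: sqr_ge0.
apply: (@le_trans _ _ ((2 * `|r * `|xi| `^ a - s * `|xi| `^ a|) ^+ 2)).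
  by rewrite lerXn2r ?nnegrE ?modulus_ge0 ?mulr_ge0//; exact: modulus_cisB.
have -> : (2 * `|r * `|xi| `^ a - s * `|xi| `^ a|) ^+ 2 = 4 * (r - s) ^+ 2 * `|xi| `^ a ^+ 2.
  by rewrite exprMn real_normK ?num_real//; ring.
by [].
Qed.

(** The bound does not depend on the number of times: step [i] contributes the square of its length
    divided by its length, and the lengths telescope to [S m - S 0]. *)
Lemma block_A (S : nat -> R) (m : nat) g : cintegrable g ->
  (forall i, (i < m)%N -> S i < S i.+1) -> exists M : R -> R,
  [/\ measurable_fun setT M, (forall x, 0 <= M x),
    (forall k x, (k <= m)%N -> sqmod (wave a g (S k) x - wave a g (S 0%N) x) <= M x) &
    (\int[mu]_x (M x)%:E <= (4 * bessel_cst * (S m - S 0%N) ^+ 2)%:E *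
      \int[mu]_xi ((`|xi| `^ a) ^+ 2 * sqmod (g xi))%:E)%E].
Proof.
move=> ig hS.
pose M x := (S m - S 0%N) *
  \sum_(i < m) (S i.+1 - S i)^-1 * sqmod (wave a g (S i.+1) x - wave a g (S i) x).
have S0m : 0 <= S m - S 0%N by rewrite subr_ge0; case: (sqmod_telescope (fun=> 0) hS (leqnn m)).
have d0 (i : 'I_m) : 0 <= (S i.+1 - S i)^-1 by rewrite invr_ge0 subr_ge0 ltW// hS.
have mX (i : 'I_m) : measurable_fun setT (fun x => (S i.+1 - S i)^-1 * sqmod (wave a g (S i.+1) x - wave a g (S i) x)).
  by apply: measurable_funM => //; exact: (wave_increment _ _ ig).1.
have X0 (i : 'I_m) x : 0 <= (S i.+1 - S i)^-1 * sqmod (wave a g (S i.+1) x - wave a g (S i) x).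
  by rewrite mulr_ge0 ?sqmod_ge0.
have mS : measurable_fun setT (fun x => \sum_(i < m) (S i.+1 - S i)^-1 * sqmod (wave a g (S i.+1) x - wave a g (S i) x)).
  by apply: measurable_sum => i; exact: mX.
exists M; split.
- exact: measurable_funM.
- by move=> x; rewrite mulr_ge0// sumr_ge0.
- move=> k x km.
  have [k1 k2] := sqmod_telescope (fun i => wave a g (S i) x) hS km.
  (* Monotonicity, read off the first conclusion of [sqmod_telescope] for the sequence shifted by
     [k]. *)
  have Skm : S k <= S m.
    have hS' i : (i < m - k)%N -> S (k + i)%N < S (k + i).+1.
      by rewrite ltn_subRL; exact: hS.
    have [] := @sqmod_telescope (fun=> 0) (fun i => S (k + i)%N) (m - k)%N _ (m - k)%N (leqnn _).
      by move=> i /hS'; rewrite addnS.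
    by rewrite addn0 subnKC.
  have F0 (i : 'I_m) : 0 <= sqmod (wave a g (S i.+1) x - wave a g (S i) x) / (S i.+1 - S i).
    by rewrite divr_ge0 ?sqmod_ge0// subr_ge0 ltW// hS.
  apply: (le_trans k2); apply: ler_pM; rewrite ?subr_ge0//.
  + by apply: sumr_ge0 => i _; exact: (F0 (widen_ord km i)).
  + by rewrite lerD2r.
  + rewrite (big_ord_widen _ (fun i => sqmod (wave a g (S i.+1) x - wave a g (S i) x) / (S i.+1 - S i)) km).
    rewrite big_mkcond/=; apply: ler_sum => i _; rewrite mulrC [leRHS]mulrC.
    by have := F0 i; case: ifP => _ h; rewrite ?h // mulrC.
- rewrite IeZ//; last by move=> x; exact: sumr_ge0.
  rewrite (Ie_sum _ mX X0); set I2 := (\int[mu]_xi _)%E.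
  have I20 : (0 <= I2)%E by apply: Ie_ge0 => xi; rewrite mulr_ge0 ?sqr_ge0 ?sqmod_ge0.
  apply: (@le_trans _ _ ((S m - S 0%N)%:E * \sum_(i < m) (4 * bessel_cst * (S i.+1 - S i))%:E * I2)%E).
    apply: lee_wpmul2l; first by rewrite lee_fin.
    apply: lee_sum => i _; have [mw hw] := wave_increment (S i.+1) (S i) ig.
    rewrite IeZ//; last by move=> x; exact: sqmod_ge0.
    apply: (le_trans (lee_wpmul2l _ hw)); first by rewrite lee_fin.
    rewrite muleA -EFinM (_ : _ * (4 * bessel_cst * _) = 4 * bessel_cst * (S i.+1 - S i))//.
    by field; rewrite subr_eq0 gt_eqF// hS.
  rewrite -ge0_sume_distrl; last first.
    move=> i _; rewrite lee_fin mulr_ge0 ?subr_ge0 ?(ltW (hS _ (ltn_ord i)))// mulr_ge0//.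
    exact: bessel_cst_ge0.
  rewrite sumEFin muleA -EFinM -mulr_sumr.
  rewrite -(big_mkord xpredT (fun i => S i.+1 - S i)) telescope_sumr//.
  by rewrite le_eqVlt; apply/orP; left; apply/eqP; congr (_%:E * _)%E; ring.
Qed.

End BlockAC.

Section Dominated.
Context {R : realType}.
Local Notation mu := (@lebesgue_measure R).
Implicit Types (f h : R -> R) (K : R).

Definition dominated K f h : Prop :=
  [/\ measurable_fun setT f /\ (forall x, 0 <= f x), measurable_fun setT h /\ (forall x, 0 <= h x) &
    (\int[mu]_x (f x)%:E <= K%:E * \int[mu]_x (h x)%:E)%E].

Lemma dominatedD K f h f' h' : 0 <= K -> dominated K f h -> dominated K f' h' ->
  dominated K (fun x => f x + f' x) (fun x => h x + h' x).
Proof.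
move=> K0 [[mf f0] [mh h0] fh] [[mf' f0'] [mh' h0'] fh']; split.
- by split=> [|x]; [exact: measurable_funD|rewrite addr_ge0].
- by split=> [|x]; [exact: measurable_funD|rewrite addr_ge0].
rewrite IeD// IeD// ge0_muleDr ?Ie_ge0//; exact: leeD.
Qed.

Lemma dominatedZ K (c : R) f h : 0 <= c -> dominated K f h -> dominated (c * K) (fun x => c * f x) h.
Proof.
move=> c0 [[mf f0] hh fh]; split => //.
  by split=> [|x]; [exact: measurable_funM|rewrite mulr_ge0].
by rewrite IeZ// EFinM -muleA lee_wpmul2l// lee_fin.
Qed.

Lemma dominatedW K K' f h h' : K <= K' -> 0 <= K -> measurable_fun setT h' ->
  (forall x, h x <= h' x) -> dominated K f h -> dominated K' f h'.
Proof.
move=> KK K0 mh' hh' [hf [mh h0] fh]; split => //.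
  by split => // x; rewrite (le_trans (h0 x)).
apply: (le_trans fh); apply: lee_pmul; rewrite ?lee_fin ?Ie_ge0//.
exact: le_Ie.
Qed.

Lemma dominated_sum K (J : nat) (f h : nat -> R -> R) : 0 <= K ->
  (forall j, dominated K (f j) (h j)) ->
  dominated K (fun x => \sum_(j < J) f j x) (fun x => \sum_(j < J) h j x).
Proof.
move=> K0 fh; elim: J => [|J IH].
  have -> : (fun x : R => \sum_(j < 0) f j x) = (fun=> 0) by apply/funext => x; rewrite big_ord0.
  have -> : (fun x : R => \sum_(j < 0) h j x) = (fun=> 0) by apply/funext => x; rewrite big_ord0.
  by split=> //; rewrite integral0 mule0.
have -> : (fun x : R => \sum_(j < J.+1) f j x) = (fun x => \sum_(j < J) f j x + f J x).
  by apply/funext => x; rewrite big_ord_recr.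
have -> : (fun x : R => \sum_(j < J.+1) h j x) = (fun x => \sum_(j < J) h j x + h J x).
  by apply/funext => x; rewrite big_ord_recr.
exact: dominatedD.
Qed.

End Dominated.

Section DyadicSums.
Context {R : realType}.

(** The terms above one are dropped and the others form a geometric series starting below one. The
    bound is thus uniform in [c], which will depend on the frequency. *)
Lemma sum_geometric_le1 (q c : R) (J : nat) : 0 <= q -> q < 1 -> 0 <= c ->
  \sum_(j < J) c * q ^+ j * (c * q ^+ j <= 1)%R%:R <= (1 - q)^-1.
Proof.
move=> q0 q1; elim: J c => [|J IH] c c0.
  by rewrite big_ord0 invr_ge0 subr_ge0 ltW.
have [c1|c1] := leP c 1.
  apply: (@le_trans _ _ (\sum_(j < J.+1) q ^+ j)); last exact: geometric_le.
  apply: ler_sum => i _; have h : 0 <= q ^+ i by rewrite exprn_ge0.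
  have h' : c * q ^+ i <= q ^+ i by rewrite ler_piMl.
  by case: (_ <= 1); rewrite ?mulr1 ?mulr0.
rewrite big_ord_recl expr0 mulr1 (leNgt c) c1/= mulr0 add0r.
have := IH (c * q) (mulr_ge0 c0 q0); congr (_ <= _).
by apply: eq_bigr => i _; rewrite exprS mulrA.
Qed.

Lemma sum_dyadic_lt (y : R) (J : nat) : 0 <= y -> \sum_(j < J) 2 ^+ j * (2 ^+ j < y)%R%:R <= 2 * y.
Proof.
move=> y0; elim: J => [|J IH]; first by rewrite big_ord0 mulr_ge0.
have [Jy|Jy] := ltP (2 ^+ J) y; last first.
  by rewrite big_ord_recr/= ltNge Jy/= mulr0 addr0.
apply: (@le_trans _ _ (\sum_(j < J.+1) 2 ^+ j)).
  by apply: ler_sum => i _; rewrite ler_piMr ?exprn_ge0// lern1 leq_b1.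
have := subrX1 (2 : R) J.+1; rewrite (_ : 2 - 1 = 1 :> R) ?mul1r; last ring.
by move=> <-; rewrite exprS; lra.
Qed.

Lemma block_exponent_lt (gamma : R) : 0 < gamma -> (1 + gamma / 4) / (gamma + 2) < 2^-1.
Proof.
move=> g0; have g2 : 0 < gamma + 2 by lra.
by rewrite ltr_pdivrMr//; lra.
Qed.

End DyadicSums.

(** * Dyadic blocks of times and the sum of their weights *)

Section Core.
Context {R : realType}.
Local Notation mu := (@lebesgue_measure R).
Variables gamma a s : R.
Hypotheses (gamma0 : 0 < gamma) (a0 : 0 < a) (a1 : a != 1) (s0 : 0 < s).

Definition time (n : nat) : R := n%:R `^ (- gamma).
Let om (xi : R) : R := `|xi| `^ a.
(* In the block [2^j <= n < 2^(j+1)] the frequencies [om = |xi|^a] are split at [low j] and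
   [high j]. Below [low j] the phases [t_n om] hardly vary over the block and differences in
   time telescope; above [high j] one can afford to sum the squares over all [2^j] times; in
   between one linearises the supremum and uses [T T^*]. *)
Let N (j : nat) : R := 2 ^+ j.
Let low (j : nat) : R := N j `^ gamma.
Let high (j : nat) : R := N j `^ (gamma + 2).
(* Any exponent strictly between [1 / (gamma + 2)] and [1 / 2] would do: the lower bound makes
   the sum over the blocks converge, the upper bound the sum over dyadic shells in [block_B]. *)
Let sg : R := (1 + gamma / 4) / (gamma + 2).

Let N0 j : 0 < N j. Proof. by rewrite exprn_gt0. Qed.
Let low0 j : 0 < low j. Proof. by rewrite powR_gt0. Qed.
Let high0 j : 0 < high j. Proof. by rewrite powR_gt0. Qed.
Let om0 xi : 0 <= om xi. Proof. exact: powR_ge0. Qed.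
Let mom : measurable_fun setT om. Proof. exact: measurable_om. Qed.
Let g2 : 0 < gamma + 2. Proof. by rewrite addr_gt0. Qed.

Let sg0 : 0 < sg.
Proof. by rewrite divr_gt0// addr_gt0// divr_gt0. Qed.

Let sg2 : sg < 2^-1.
Proof. exact: block_exponent_lt. Qed.

Lemma time_gt0 n : (0 < n)%N -> 0 < time n.
Proof. by move=> n0; rewrite powR_gt0// ltr0n. Qed.

Lemma time_lt m n : (0 < m)%N -> (m < n)%N -> time n < time m.
Proof.
move=> m0 mn; have n0 := ltn_trans m0 mn.
rewrite /time !powRN ltf_pV2 ?posrE ?powR_gt0 ?ltr0n//.
by apply: gt0_ltr_powR; rewrite ?nnegrE ?ler0n// ltr_nat.
Qed.

Let time_dyadic j : time (2 ^ j) = (low j)^-1.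
Proof. by rewrite /time powRN natrX. Qed.

(** The costs, in order, of the telescoped low part, of the remaining frequencies at time 0, of the
    linearised middle part and of the sum of squares at high frequencies. *)
Definition block_weight (j : nat) (xi : R) : R :=
  (om xi / low j) ^+ 2 * (om xi <= low j)%R%:R + (low j < om xi)%R%:R +
  (N j * (om xi / high j) `^ sg * (om xi <= high j)%R%:R + N j * (high j < om xi)%R%:R).

Let mle c : measurable_fun setT (fun xi => om xi <= c).
Proof. exact: measurable_fun_ler. Qed.
Let mlt c : measurable_fun setT (fun xi => c < om xi).
Proof. exact: measurable_fun_ltr. Qed.

Let dominated_cut K (f : R -> R) (v : R -> R) (b : R -> bool) (g : R -> R[i]) :
  cmeas g -> measurable_fun setT f -> (forall x, 0 <= f x) ->
  measurable_fun setT v -> (forall xi, 0 <= v xi) -> measurable_fun setT b ->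
  (\int[mu]_x (f x)%:E <= K%:E * \int[mu]_xi (v xi * sqmod (cut b g xi))%:E)%E ->
  dominated K f (fun xi => v xi * (b xi)%:R * sqmod (g xi)).
Proof.
move=> mg mf f0 mv v0 mb fg; split; [by []| |].
  split=> [|xi]; last by rewrite mulr_ge0 ?sqmod_ge0// mulr_ge0.
  apply: measurable_funM; last exact: measurable_sqmod.
  by apply: measurable_funM => //; exact: measurable_bool01.
apply: (le_trans fg); rewrite le_eqVlt; apply/orP; left; apply/eqP; congr (_ * _)%E.
by apply: eq_integral => xi _; rewrite sqmod_cut mulrA.
Qed.

Let piece_A g j : cintegrable g -> exists M : R -> R,
  (forall n x, (2 ^ j <= n < 2 ^ j.+1)%N -> let h := cut (fun xi => om xi <= low j) g in
    sqmod (wave a h (time n) x - wave a h 0 x) <= M x) /\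
  dominated (4 * bessel_cst) M (fun xi => (om xi / low j) ^+ 2 * (om xi <= low j)%R%:R * sqmod (g xi)).
Proof.
move=> ig; set h := cut _ g; have ih : cintegrable h by exact: cintegrable_cut.
(* Times increase as [n] decreases, so the block is run through backwards: [S] starts at time 0, and
   index [i >= 1] stands for [n = 2^(j + 1) - i], down to [n = 2^j]. *)
pose S (i : nat) : R := if i is 0%N then 0 else time (2 ^ j.+1 - i).
have j0 : (0 < 2 ^ j)%N by rewrite expn_gt0.
have jj : (2 ^ j.+1 = 2 ^ j + 2 ^ j)%N by rewrite expnS mul2n addnn.
have hS i : (i < 2 ^ j)%N -> S i < S i.+1.
  case: i => [|i] ij; first by apply: time_gt0; rewrite subn_gt0 jj; lia.
  by apply: time_lt; rewrite jj; lia.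
have [M [mM M0 hM iM]] := block_A a ih hS.
exists M; split.
  move=> n x /andP[n1 n2]; have nk : (2 ^ j.+1 - n <= 2 ^ j)%N by rewrite jj; lia.
  have := hM _ x nk; rewrite /S; case E : (2 ^ j.+1 - n)%N => [|k]; first by exfalso; lia.
  by rewrite (_ : (2 ^ j.+1 - k.+1)%N = n)//; lia.
apply: dominated_cut => //; first exact: cintegrable_meas.
- by apply: measurable_funX; apply: measurable_funM.
- by move=> xi; exact: sqr_ge0.
have E : S (2 ^ j)%N = (low j)^-1.
  have SE m : (0 < m)%N -> S m = time (2 ^ j.+1 - m) by case: m.
  by rewrite SE// jj addnK time_dyadic.
apply: (le_trans iM); rewrite E /S subr0 -/h.
have mh : measurable_fun setT (fun xi => om xi ^+ 2 * sqmod (h xi)).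
  apply: measurable_funM; first exact: measurable_funX.
  by apply: measurable_sqmod; exact: cintegrable_meas.
rewrite EFinM -muleA; apply: lee_wpmul2l; first by rewrite lee_fin mulr_ge0// bessel_cst_ge0.
rewrite -IeZ ?sqr_ge0//; last by move=> xi; exact: (mulr_ge0 (sqr_ge0 _) (sqmod_ge0 _)).
rewrite le_eqVlt; apply/orP; left; apply/eqP; apply: eq_integral => xi _.
congr (_%:E); rewrite exprMn /om; ring.
Qed.

Let piece_B : exists2 C : R, 0 < C & forall g j, cintegrable g -> exists M : R -> R,
  (forall n x, (2 ^ j <= n < 2 ^ j.+1)%N ->
    let h := cut (fun xi => (low j < om xi) && (om xi <= high j)) g in
    sqmod (wave a h (time n) x) <= M x) /\
  dominated C M (fun xi => N j * (om xi / high j) `^ sg * (om xi <= high j)%R%:R * sqmod (g xi)).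
Proof.
have [C C0 hB] := block_B a0 a1 sg0 sg2; exists C; first exact: C0.
move=> g j ig; set h := cut _ g.
have mb : measurable_fun setT (fun xi => (low j < om xi) && (om xi <= high j)).
  exact: measurable_and.
have ih : cintegrable h by exact: cintegrable_cut.
have j0 : (0 < 2 ^ j)%N by rewrite expn_gt0.
have jj : (2 ^ j.+1 = 2 ^ j + 2 ^ j)%N by rewrite expnS mul2n addnn.
(* The selection runs over [2^j + 1] times; the last one, [n = 2^(j + 1)], belongs to the next block
   and also lies below [1 / low j]. *)
have [tau [mtau mM htau hmax]] := @measurable_argmax R (fun t x => sqmod (wave a h t x))
  (fun i => time (2 ^ j + i)) (2 ^ j) (fun t => measurable_sqmod_wave a t ih).
exists (fun x => sqmod (wave a h (tau x) x)); split.
  move=> n x /andP[n1 n2]; have nk : (n - 2 ^ j <= 2 ^ j)%N by lia.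
  by have := hmax _ x nk; rewrite subnKC.
have T0 : 0 < (low j)^-1 by rewrite invr_gt0.
have tauT x : 0 <= tau x <= (low j)^-1.
  have [i _ ->] := htau x; rewrite ltW ?time_gt0 ?addn_gt0 ?j0//= -time_dyadic.
  by case: i => [|i]; rewrite ?addn0// ltW// time_lt// -addn1 leq_add2l.
have hsupp xi : h xi != 0 -> (low j)^-1^-1 < `|xi| `^ a <= high j.
  rewrite invrK /h /cut; case: (_ && _) => //.
  by rewrite mul0r eqxx.
have /= HB := hB (high j) (low j)^-1 h tau (high0 j) T0 ih hsupp mtau tauT.
(* The exponent [gamma + 2] in [high] is the one for which [block_B] costs [N j] at [om = high j],
   as much as summing squares over the [2^j] times. *)
have sN : Num.sqrt (high j / low j) = N j.
  rewrite /high /low -powRN -powRD ?(gt_eqF (N0 j)) ?implybT//.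
  rewrite (_ : gamma + 2 - gamma = 2%:R); last ring.
  by rewrite powR_mulrn ?(ltW (N0 j))// sqrtr_sqr ger0_norm// ltW.
rewrite sN in HB.
have mg := cintegrable_meas ig.
have mv : measurable_fun setT (fun xi => (om xi / high j) `^ sg).
  by apply: (measurableT_comp (measurable_powR sg)); exact: measurable_funM.
apply: (@dominatedW R C _ _ (fun xi => N j * (om xi / high j) `^ sg *
   ((low j < om xi) && (om xi <= high j))%:R * sqmod (g xi))); rewrite ?(ltW C0)//.
- apply: measurable_funM; last exact: measurable_sqmod.
  by apply: measurable_funM; [exact: measurable_funM|exact: measurable_bool01].
- move=> xi; apply: ler_wpM2r; first exact: sqmod_ge0.
  apply: ler_wpM2l; first by rewrite mulr_ge0 ?powR_ge0// ltW.
  by rewrite ler_nat; case: (low j < om xi); case: (om xi <= high j).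
apply: dominated_cut => //.
- by move=> x; exact: sqmod_ge0.
- exact: measurable_funM.
- by move=> xi; rewrite mulr_ge0 ?powR_ge0// ltW.
apply: (le_trans HB); rewrite EFinM -muleA; apply: lee_wpmul2l; first by rewrite lee_fin ltW.
rewrite -IeZ ?(ltW (N0 j))//.
- rewrite le_eqVlt; apply/orP; left; apply/eqP; apply: eq_integral => xi _.
  by rewrite mulrA.
- apply: measurable_funM => //; apply: measurable_sqmod; exact: cintegrable_meas.
- by move=> xi; exact: (mulr_ge0 (powR_ge0 _ _) (sqmod_ge0 _)).
Qed.

Let wave_dominated g (b : R -> bool) t : cintegrable g -> measurable_fun setT b ->
  dominated bessel_cst (fun x => sqmod (wave a (cut b g) t x)) (fun xi => (b xi)%:R * sqmod (g xi)).
Proof.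
move=> ig mb; have ih := cintegrable_cut mb ig.
have -> : (fun xi => (b xi)%:R * sqmod (g xi)) = (fun xi => 1 * (b xi)%:R * sqmod (g xi)).
  by apply/funext => xi; rewrite mul1r.
apply: dominated_cut => //.
- exact: cintegrable_meas.
- exact: measurable_sqmod_wave.
- by move=> x; exact: sqmod_ge0.
under [X in (_ <= _ * X)%E]eq_integral do rewrite mul1r.
exact: wave_bessel.
Qed.

Let piece_C g j : cintegrable g -> exists M : R -> R,
  (forall n x, (2 ^ j <= n < 2 ^ j.+1)%N -> let h := cut (fun xi => high j < om xi) g in
    sqmod (wave a h (time n) x) <= M x) /\
  dominated bessel_cst M (fun xi => N j * (high j < om xi)%R%:R * sqmod (g xi)).
Proof.
move=> ig; set h := cut _ g.
exists (fun x => \sum_(i < 2 ^ j) sqmod (wave a h (time (2 ^ j + i)) x)); split.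
  move=> n x /andP[n1 n2] /=; have jj : (2 ^ j.+1 = 2 ^ j + 2 ^ j)%N by rewrite expnS mul2n addnn.
  have nk : (n - 2 ^ j < 2 ^ j)%N by lia.
  rewrite (bigD1 (Ordinal nk))//= subnKC// lerDl sumr_ge0// => i _; exact: sqmod_ge0.
have -> : (fun xi => N j * (high j < om xi)%R%:R * sqmod (g xi)) =
    (fun xi => \sum_(i < 2 ^ j) (high j < om xi)%R%:R * sqmod (g xi)).
  apply/funext => xi; by rewrite sumr_const card_ord -[RHS]mulr_natl natrX mulrA.
apply: (@dominated_sum R _ (2 ^ j) (fun i x => sqmod (wave a h (time (2 ^ j + i)) x))
  (fun _ xi => (high j < om xi)%R%:R * sqmod (g xi))); first exact: bessel_cst_ge0.
by move=> i; exact: wave_dominated.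
Qed.

(** The mean at time 0 is subtracted because the low frequencies by themselves would contribute
    [|g|^2] to every block, and the sum over [j] would be unbounded. *)
Lemma block_maximal : exists2 C : R, 0 < C & forall g j, cintegrable g -> exists M : R -> R,
  (forall n x, (2 ^ j <= n < 2 ^ j.+1)%N -> sqmod (wave a g (time n) x - wave a g 0 x) <= M x) /\
  dominated C M (fun xi => block_weight j xi * sqmod (g xi)).
Proof.
have [CB CB0 pB] := piece_B; have b0 : 0 <= bessel_cst :> R := bessel_cst_ge0.
pose K : R := 4 * bessel_cst + CB; have K0 : 0 < K by rewrite ltr_wpDl// mulr_ge0.
have bK : bessel_cst <= K by rewrite /K; lra.
have b4K : 4 * bessel_cst <= K by rewrite lerDl ltW.
have CBK : CB <= K by rewrite lerDr mulr_ge0.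
exists (4 * K) => [|g j ig]; first by rewrite mulr_gt0.
have [MA [hA dA]] := piece_A j ig.
have [MB [hB dB]] := pB g j ig.
have [MC [hC dC]] := piece_C j ig.
have dD := wave_dominated 0 ig (mlt (low j)).
exists (fun x => 4 * ((MA x + sqmod (wave a (cut (fun xi => low j < om xi) g) 0 x)) + (MB x + MC x))).
split.
  move=> n x nj; have /= {hA}hA := hA n x nj; have /= {hB}hB := hB n x nj; have /= {hC}hC := hC n x nj.
  have icut b := @cintegrable_cut R b g.
  have mab : measurable_fun setT (fun xi => (low j < om xi) && (om xi <= high j)).
    exact: measurable_and.
  have lh : low j <= high j.
    apply: ler_powR; last by rewrite lerDl.
    by rewrite /N exprn_ege1// ler1n.
  have gT : cut xpredT g = g by apply/funext => xi; exact: cut_true.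
  have E t : wave a g t x = wave a (cut (fun xi => om xi <= low j) g) t x +
      wave a (cut (fun xi => low j < om xi) g) t x.
    rewrite -[in LHS]gT; apply: wave_split => // xi.
    by rewrite ltNge; case: (_ <= _); rewrite ?addr0 ?add0r.
  have E2 t : wave a (cut (fun xi => low j < om xi) g) t x =
      wave a (cut (fun xi => (low j < om xi) && (om xi <= high j)) g) t x +
      wave a (cut (fun xi => high j < om xi) g) t x.
    apply: wave_split => // xi; rewrite [high j < _]ltNge.
    case: (leP (om xi) (high j)) => /= h; first by rewrite andbT addr0.
    by rewrite andbF add0r (le_lt_trans lh h).
  rewrite (E (time n)) (E 0) (E2 (time n)).
  set p := wave a _ (time n) x in hA *; set p0 := wave a _ 0 x in hA *.
  set q := wave a _ (time n) x in hB *; set u := wave a _ (time n) x in hC *; set v := wave a _ 0 x.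
  rewrite (_ : p + (q + u) - (p0 + v) = ((p - p0) + (- v)) + (q + u)); last ring.
  exact: sqmod_add4.
have ww j' xi : block_weight j' xi * sqmod (g xi) =
  ((om xi / low j') ^+ 2 * (om xi <= low j')%R%:R * sqmod (g xi) + (low j' < om xi)%R%:R * sqmod (g xi)) +
  (N j' * (om xi / high j') `^ sg * (om xi <= high j')%R%:R * sqmod (g xi) +
   N j' * (high j' < om xi)%R%:R * sqmod (g xi)).
  by rewrite /block_weight; ring.
have wK C' f h : 0 <= C' -> C' <= K -> dominated C' f h -> dominated K f h.
  by move=> C'0 C'K d; have [_ [mh _] _] := d; apply: (dominatedW C'K C'0 mh _ d).
apply: dominatedZ => //; rewrite (funext (ww j)).
apply: (dominatedD (ltW K0)); apply: (dominatedD (ltW K0)).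
- by apply: (wK (4 * bessel_cst)) => //; rewrite mulr_ge0.
- exact: (wK bessel_cst).
- by apply: (wK CB) => //; rewrite ltW.
- exact: (wK bessel_cst).
Qed.

Let W (xi : R) : R := (1 + `|xi| ^+ 2) `^ s.

Let W1 xi : 1 <= W xi.
Proof.
have e1 : 1 `^ s = 1 :> R by rewrite powR1.
rewrite -[leLHS]e1; apply: ge0_ler_powR; rewrite ?nnegrE ?(ltW s0)//.
by rewrite lerDl sqr_ge0.
Qed.

Let powR_le_W (e xi : R) : 0 <= e -> e <= 2 * s -> `|xi| `^ e <= W xi.
Proof.
move=> e0 es; have [x1|x1] := leP `|xi| 1.
  apply: (le_trans _ (W1 xi)); have e1 : 1 `^ e = 1 :> R by rewrite powR1.
  by rewrite -[leRHS]e1; apply: ge0_ler_powR; rewrite ?nnegrE.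
apply: (@le_trans _ _ (`|xi| `^ (2 * s))); first by apply: ler_powR => //; exact: ltW.
rewrite powRrM (powR_mulrn 2) ?normr_ge0//.
apply: ge0_ler_powR; rewrite ?nnegrE ?(ltW s0) ?sqr_ge0//.
by rewrite lerDr.
Qed.

Let powN (e : R) j : N j `^ e = (2 `^ e) ^+ j.
Proof. by rewrite /N powRX. Qed.

Let pow2_gt1 (e : R) : 0 < e -> 0 <= ((2 : R) `^ e)^-1 < 1.
Proof.
move=> e0; have h0 : 0 < 2 `^ e :> R by rewrite powR_gt0.
have e1 : 1 `^ e = 1 :> R by rewrite powR1.
rewrite invr_ge0 ltW//= invf_lt1// -[ltLHS]e1.
by apply: gt0_ltr_powR; rewrite ?nnegrE ?ltr1n.
Qed.

Hypothesis s_crit : a / (2 * gamma + 4) <= s.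

(** Geometric in [j] with ratio [2^(- 2 gamma)] and restricted to terms at most one, hence bounded
    whatever [xi] is. *)
Let weight_low : exists2 C : R, 0 < C & forall J xi,
  \sum_(j < J) (om xi / low j) ^+ 2 * (om xi <= low j)%R%:R <= C * W xi.
Proof.
have /andP[q0 q1] := pow2_gt1 gamma0; set q := (2 `^ gamma)^-1 in q0 q1.
have qq : q ^+ 2 < 1 by rewrite expr_lt1.
exists (1 - q ^+ 2)^-1 => [|J xi]; first by rewrite invr_gt0 subr_gt0.
apply: (@le_trans _ _ (1 - q ^+ 2)^-1); last by rewrite ler_peMr// invr_ge0 subr_ge0 ltW.
have E j : (om xi / low j) ^+ 2 = om xi ^+ 2 * (q ^+ 2) ^+ j.
  by rewrite /low powN exprMn -exprVn -/q -!exprM mulnC.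
apply: le_trans (sum_geometric_le1 J (sqr_ge0 q) qq (sqr_ge0 (om xi))).
apply: ler_sum => j _; rewrite -E; apply: ler_wpM2l; first exact: sqr_ge0.
have h : 0 <= om xi / low j by exact: (divr_ge0 (om0 _) (ltW (low0 j))).
by rewrite (expr_le1 (ltn0Sn 1) h) ler_pdivrMr// mul1r.
Qed.

(** The sum counts the blocks with [low j < om], about [log om] of them. Bounding each indicator by
    [(om / low j)^p] with [p = 2 s / a > 0] turns the count into a geometric series times
    [om^p = |xi|^(2 s)]. *)
Let weight_D : exists2 C : R, 0 < C & forall J xi, \sum_(j < J) (low j < om xi)%R%:R <= C * W xi.
Proof.
pose p := 2 * s / a; have p0 : 0 < p by rewrite divr_gt0// mulr_gt0.
have /andP[q0 q1] := pow2_gt1 (mulr_gt0 gamma0 p0); set q := (2 `^ _)^-1 in q0 q1.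
exists (1 - q)^-1 => [|J xi]; first by rewrite invr_gt0 subr_gt0.
apply: (@le_trans _ _ (\sum_(j < J) om xi `^ p * q ^+ j)).
  apply: ler_sum => j _; case: ltP => h; last by rewrite mulr_ge0 ?powR_ge0// exprn_ge0.
  have -> : q ^+ j = (low j `^ p)^-1 by rewrite /low -powRrM powN -exprVn.
  rewrite ler_pdivlMr ?powR_gt0// mul1r.
  by apply: ge0_ler_powR; rewrite ?nnegrE ?(ltW p0) ?(ltW (low0 j)) ?(ltW h).
rewrite -mulr_sumr mulrC; apply: ler_pM; rewrite ?powR_ge0//.
- by apply: sumr_ge0 => j _; rewrite exprn_ge0.
- exact: geometric_le.
rewrite /om -powRrM /p mulrCA divff ?gt_eqF// mulr1; apply: powR_le_W => //.
by rewrite mulr_ge0// ltW.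
Qed.

(** The block size at which [high] would equal [om xi]. In [yW] the condition on [s] enters:
    [y = |xi|^(a / (gamma + 2))] and [a / (gamma + 2) <= 2 s]. *)
Let y (xi : R) : R := om xi `^ (gamma + 2)^-1.
Let yW xi : y xi <= W xi.
Proof.
rewrite /y /om -powRrM; apply: powR_le_W; first by rewrite divr_ge0 ?ltW.
move: s_crit; rewrite !ler_pdivrMr//; last by rewrite addr_gt0// mulr_gt0.
by move=> h; apply: (le_trans h); rewrite le_eqVlt; apply/orP; left; apply/eqP; ring.
Qed.

Let high_root j : high j `^ (gamma + 2)^-1 = N j.
Proof. by rewrite /high -powRrM divff ?gt_eqF// powRr1// ltW. Qed.

(** Write [z = om / high j] and [sg = 1 / (gamma + 2) + e']. Then [N j * z^(1 / (gamma + 2))] is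
    exactly [y], independent of [j], and the surplus [z^e'] is geometric in [j] with terms at most
    one. *)
Let weight_B : exists2 C : R, 0 < C & forall J xi,
  \sum_(j < J) N j * (om xi / high j) `^ sg * (om xi <= high j)%R%:R <= C * W xi.
Proof.
pose e : R := gamma / 4; have e0 : 0 < e by rewrite divr_gt0.
pose e' : R := e / (gamma + 2); have e'0 : 0 < e' by rewrite divr_gt0.
have /andP[q0 q1] := pow2_gt1 e0; set q := (2 `^ _)^-1 in q0 q1.
exists (1 - q)^-1 => [|J xi]; first by rewrite invr_gt0 subr_gt0.
apply: (@le_trans _ _ (y xi * \sum_(j < J) om xi `^ e' * q ^+ j * (om xi `^ e' * q ^+ j <= 1)%R%:R)).
  rewrite mulr_sumr; apply: ler_sum => j _; set z := om xi / high j.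
  have z0 : 0 <= z := divr_ge0 (om0 xi) (ltW (high0 j)).
  have sgE : sg = (gamma + 2)^-1 + e' by rewrite /sg /e' /e mulrDl mul1r.
  have powz r : z `^ r = om xi `^ r * (high j `^ r)^-1.
    have hi0 : 0 <= (high j)^-1 by rewrite invr_ge0 ltW.
    by rewrite /z (powRM _ (om0 xi) hi0) -(powR_inv1 (ltW (high0 j))) -powRrM mulN1r powRN.
  have zE : z `^ e' = om xi `^ e' * q ^+ j.
    rewrite powz; congr (_ * _); rewrite /high -powRrM /e' mulrCA divff ?gt_eqF// mulr1.
    by rewrite powN -exprVn.
  have Ny : N j * z `^ (gamma + 2)^-1 = y xi.
    by rewrite powz high_root mulrCA divff ?gt_eqF// mulr1.
  rewrite sgE powRD; last first.
    by apply/implyP => /eqP h; exfalso; move: h; apply/eqP; rewrite gt_eqF// addr_gt0// invr_gt0.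
  rewrite mulrA Ny -zE -mulrA; apply: ler_wpM2l; first exact: powR_ge0.
  apply: ler_wpM2l; first exact: powR_ge0.
  case: (leP (om xi) (high j)) => h //; rewrite (_ : z `^ e' <= 1)//.
  have e1 : 1 `^ e' = 1 :> R by rewrite powR1.
  rewrite -[leRHS]e1; apply: ge0_ler_powR; rewrite ?nnegrE ?(ltW e'0)//.
  by rewrite ler_pdivrMr// mul1r.
rewrite mulrC; apply: ler_pM; rewrite ?powR_ge0//.
- by apply: sumr_ge0 => j _; rewrite mulr_ge0// mulr_ge0 ?powR_ge0// exprn_ge0.
- by apply: sum_geometric_le1 => //; exact: powR_ge0.
Qed.

Let weight_C J xi : \sum_(j < J) N j * (high j < om xi)%R%:R <= 2 * W xi.
Proof.
apply: (@le_trans _ _ (\sum_(j < J) 2 ^+ j * (2 ^+ j < y xi)%R%:R)).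
  apply: ler_sum => j _; apply: ler_wpM2l; first exact: ltW.
  case: ltP => // h; rewrite (_ : 2 ^+ j < y xi)// -/(N j) -high_root.
  by apply: gt0_ltr_powR; rewrite ?invr_gt0 ?nnegrE ?(ltW (high0 j)).
apply: (le_trans (sum_dyadic_lt _ (powR_ge0 _ _))).
exact: (ler_wpM2l (ler0n _ 2) (yW xi)).
Qed.

Lemma block_weight_sum : exists2 C : R, 0 < C & forall J xi,
  \sum_(j < J) block_weight j xi <= C * W xi.
Proof.
have [CA CA0 hA] := weight_low; have [CD CD0 hD] := weight_D; have [CB CB0 hB] := weight_B.
exists (CA + CD + (CB + 2)) => [|J xi]; first by rewrite !addr_gt0.
rewrite /block_weight !big_split/= (mulrDl (CA + CD)) (mulrDl CA) (mulrDl CB).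
by apply: lerD; apply: lerD; [exact: hA|exact: hD|exact: hB|exact: weight_C].
Qed.

Let mW : measurable_fun setT W := measurable_sobolev_weight s.

(** [M] depends on [J] but [C] does not, so the range of times can later grow together with the
    approximation of the data. *)
Lemma core_maximal : exists2 C : R, 0 < C & forall g J, cintegrable g -> exists M : R -> R,
  [/\ measurable_fun setT M, (forall x, 0 <= M x),
    (forall n x, (0 < n < 2 ^ J)%N -> sqmod (wave a g (time n) x) <= M x) &
    (\int[mu]_x (M x)%:E <= C%:E * \int[mu]_xi ((1 + `|xi| ^+ 2) `^ s * sqmod (g xi))%:E)%E].
Proof.
have [C C0 hC] := block_maximal; have [CW CW0 hW] := block_weight_sum.
have b0 : 0 <= bessel_cst :> R := bessel_cst_ge0.
pose K := C + bessel_cst; have K0 : 0 < K by rewrite ltr_wpDr.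
exists (2 * K * (CW + 1)) => [|g J ig]; first by rewrite !mulr_gt0// ltr_wpDr.
have mg := cintegrable_meas ig.
have /choice[Mj hM] : forall j, exists M : R -> R,
  (forall n x, (2 ^ j <= n < 2 ^ j.+1)%N -> sqmod (wave a g (time n) x - wave a g 0 x) <= M x) /\
  dominated C M (fun xi => block_weight j xi * sqmod (g xi)) by move=> j; exact: hC.
have Mj0 j x : 0 <= Mj j x by have [_ [[_ h] _ _]] := hM j.
have dM j : dominated C (Mj j) (fun xi => block_weight j xi * sqmod (g xi)) := (hM j).2.
have dS := dominated_sum J (ltW C0) dM.
have d0 := wave_dominated 0 ig (measurable_cst true : measurable_fun setT (fun _ : R => true)).
have gT : cut (fun=> true) g = g by apply/funext => xi; exact: cut_true.
rewrite gT in d0.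
have CK : C <= K by rewrite lerDl.
have bK : bessel_cst <= K by rewrite lerDr ltW.
have [_ [mS _] _] := dS; have [_ [m0 _] _] := d0.
have dS' := dominatedW CK (ltW C0) mS (fun xi => lexx _) dS.
have d0' := dominatedW bK b0 m0 (fun xi => lexx _) d0.
have [[mM M0] [mh h0] iM] := dominatedZ (ler0n R 2) (dominatedD (ltW K0) dS' d0').
exists (fun x => 2 * (\sum_(j < J) Mj j x + sqmod (wave a g 0 x))); split => //.
  move=> n x /andP[n0 nJ].
  have /andP[n1 n2] := trunc_log_bounds (ltnSn 1) n0; set j := trunc_log 2 n in n1 n2.
  have jJ : (j < J)%N by rewrite -(ltn_exp2l _ _ (ltnSn 1)); exact: leq_ltn_trans nJ.
  have hj : sqmod (wave a g (time n) x - wave a g 0 x) <= \sum_(j < J) Mj j x.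
    rewrite (bigD1 (Ordinal jJ))//= ler_wpDr//; first by apply: sumr_ge0 => i _; exact: Mj0.
    by apply: (hM j).1; rewrite n1.
  rewrite -[wave a g (time n) x](subrK (wave a g 0 x)).
  by apply: (le_trans (sqmodD _ _)); rewrite mulrDr lerD2r ler_pM2l.
apply: (le_trans iM); rewrite -[leRHS](_ : (2 * K)%:E * ((CW + 1)%:E * \int[mu]_xi (W xi * sqmod (g xi))%:E) = _)%E; last first.
  by rewrite muleA -EFinM.
apply: lee_wpmul2l; first by rewrite lee_fin mulr_ge0// ltW.
have mWg : measurable_fun setT (fun xi => W xi * sqmod (g xi)).
  by apply: measurable_funM; [exact: mW|exact: measurable_sqmod].
have Wg0 xi : 0 <= W xi * sqmod (g xi) by rewrite mulr_ge0 ?powR_ge0 ?sqmod_ge0.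
rewrite -IeZ ?addr_ge0 ?(ltW CW0)//; apply: le_Ie => //; first exact: measurable_funM.
move=> xi; rewrite -mulr_suml -mulrDl mulrA; apply: ler_wpM2r; first exact: sqmod_ge0.
by rewrite mulrDl mul1r; apply: lerD; [exact: hW|exact: W1].
Qed.

End Core.

(** * Gaussian test functions and the sufficiency of the condition *)

Lemma modulus_eq0 {R : realType} (z : R[i]) : modulus z = 0 -> z = 0.
Proof. exact: Normc.eq0_normc. Qed.

Lemma modulus_dist {R : realType} (z w : R[i]) : `|modulus z - modulus w| <= modulus (z - w).
Proof.
have h (z' w' : R[i]) : modulus z' - modulus w' <= modulus (z' - w').
  by rewrite lerBlDr; apply: le_trans (modulusD _ _); rewrite subrK.
by rewrite ler_norml h andbT lerNl opprB; apply: (le_trans (h w z)); rewrite -modulusN opprB.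
Qed.

Section SchwartzGauss.
Context {R : realType}.
Local Notation mu := (@lebesgue_measure R).
Variables (eps b c : R).
Hypothesis eps0 : 0 < eps.

(** A class of functions that contains the real and imaginary parts of a modulated Gaussian and is
    stable under differentiation. *)
Definition gauss_poly (p q : {poly R}) (x : R) : R :=
  (p.[x] * cos (c * x) + q.[x] * sin (c * x)) * gauss eps b x.

Lemma der_gauss (x : R) : is_derive x (1 : R) (gauss eps b) (- (2 * eps * (x - b)) * gauss eps b x).
Proof.
have h1 := derB (der_id x) (der_cst b x).
have h2 := derN (derZ eps (der_X 2 h1)).
by apply: (is_derive_eq (der_exp h2)); rewrite /gauss /= expr1; ring.
Qed.

Lemma der_gauss_poly (p q : {poly R}) (x : R) : is_derive x (1 : R) (gauss_poly p q)
  (gauss_poly (p^`() + c *: q - (2 * eps) *: (('X - b%:P) * p))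
              (q^`() - c *: p - (2 * eps) *: (('X - b%:P) * q)) x).
Proof.
have hc : is_derive x (1 : R) (fun y : R => c * y) c by have := derZ c (der_id x); rewrite mulr1.
have h1 := derM (is_derive_poly p x) (der_cos hc).
have h2 := derM (is_derive_poly q x) (der_sin hc).
apply: (is_derive_eq (derM (derD h1 h2) (der_gauss x))).
rewrite /gauss_poly !(hornerD, hornerN, hornerZ, hornerM, hornerX, hornerC).
move: (p^`().[x]) (q^`().[x]) (p.[x]) (q.[x]) => P1 Q1 P Q; ring.
Qed.

Lemma derive1n_gauss_poly (p q : {poly R}) (n : nat) : exists p' q' : {poly R},
  (gauss_poly p q)^`(n)%classic = gauss_poly p' q'.
Proof.
elim: n => [|n [p' [q' IH]]]; first by exists p, q.
exists (p'^`() + c *: q' - (2 * eps) *: (('X - b%:P) * p')),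
  (q'^`() - c *: p' - (2 * eps) *: (('X - b%:P) * q')).
rewrite derive1nS IH; apply/funext => x; rewrite derive1E.
have h := der_gauss_poly p' q' x; exact: derive_val.
Qed.

(** Combines [|x|^j <= (j + 1)^j * expR |x|] with [|x| <= |b| + eps * (x - b)^2 + 1 / (4 eps)],
    whose quadratic term the Gaussian cancels. *)
Lemma pow_gauss_bound (j : nat) : exists K : R, forall x : R, `|x| ^+ j * gauss eps b x <= K.
Proof.
exists (j.+1%:R ^+ j * expR (`|b| + (4 * eps)^-1)) => x.
have m0 : 0 < j.+1%:R :> R by rewrite ltr0n.
pose t := `|x| / j.+1%:R; have t0 : 0 <= t by rewrite divr_ge0 ?ler0n.
have ht : t ^+ j <= expR `|x|.
  have -> : expR `|x| = expR t ^+ j.+1 by rewrite -expRM_natl mulrC divfK// gt_eqF.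
  have h1 : 1 + t <= expR t := expR_ge1Dx t.
  have h1' : 1 <= 1 + t by rewrite lerDl.
  apply: (@le_trans _ _ ((1 + t) ^+ j)); first by rewrite lerXn2r ?nnegrE ?addr_ge0// lerDr.
  apply: (@le_trans _ _ ((1 + t) ^+ j.+1)); first by rewrite exprS ler_peMl// exprn_ge0// addr_ge0.
  by rewrite lerXn2r ?nnegrE ?expR_ge0 ?addr_ge0.
have hx : `|x| ^+ j <= j.+1%:R ^+ j * expR `|x|.
  have -> : `|x| ^+ j = j.+1%:R ^+ j * t ^+ j by rewrite -exprMn mulrC divfK// gt_eqF.
  by rewrite ler_wpM2l// exprn_ge0.
apply: (@le_trans _ _ (j.+1%:R ^+ j * (expR `|x| * gauss eps b x))).
  by rewrite mulrA ler_wpM2r// ltW// gauss_gt0.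
rewrite ler_wpM2l ?exprn_ge0 ?ler0n// /gauss -expRD ler_expR.
have tri : `|x| <= `|b| + `|x - b| by rewrite -{1}(subrKC b x) ler_normD.
have sq : (x - b) ^+ 2 = `|x - b| ^+ 2 by rewrite real_normK ?num_real.
have am : `|x - b| <= eps * (x - b) ^+ 2 + (4 * eps)^-1.
  rewrite sq -subr_ge0.
  have -> : eps * `|x - b| ^+ 2 + (4 * eps)^-1 - `|x - b| = (2 * eps * `|x - b| - 1) ^+ 2 / (4 * eps).
    by field; rewrite gt_eqF.
  by rewrite divr_ge0 ?sqr_ge0// mulr_ge0// ltW.
lra.
Qed.

Lemma poly_gauss_bound (p : {poly R}) (j : nat) : exists K : R, forall x : R,
  `|x| ^+ j * `|p.[x]| * gauss eps b x <= K.
Proof.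
elim/poly_ind: p j => [|p d IH] j.
  by exists 0 => x; rewrite horner0 normr0 mulr0 mul0r.
have [K1 h1] := IH j.+1; have [K2 h2] := pow_gauss_bound j.
exists (K1 + `|d| * K2) => x.
have g0 : 0 <= gauss eps b x := ltW (gauss_gt0 _ _ _).
apply: (@le_trans _ _ (`|x| ^+ j.+1 * `|p.[x]| * gauss eps b x + `|d| * (`|x| ^+ j * gauss eps b x))).
  rewrite -subr_ge0.
  have -> : `|x| ^+ j.+1 * `|p.[x]| * gauss eps b x + `|d| * (`|x| ^+ j * gauss eps b x) -
    `|x| ^+ j * `|(p * 'X + d%:P).[x]| * gauss eps b x =
    `|x| ^+ j * gauss eps b x * (`|p.[x]| * `|x| + `|d| - `|(p * 'X + d%:P).[x]|).
    by rewrite exprS; ring.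
  rewrite mulr_ge0 ?subr_ge0// ?mulr_ge0 ?exprn_ge0// !hornerE -normrM; exact: ler_normD.
by apply: lerD; [exact: h1|rewrite ler_wpM2l].
Qed.

Lemma gauss_poly_bound (p q : {poly R}) (j : nat) : exists K : R, forall x : R,
  `|x| ^+ j * `|gauss_poly p q x| <= K.
Proof.
have [K1 h1] := poly_gauss_bound p j; have [K2 h2] := poly_gauss_bound q j.
exists (K1 + K2) => x; have g0 : 0 <= gauss eps b x := ltW (gauss_gt0 _ _ _).
apply: le_trans (lerD (h1 x) (h2 x)).
rewrite /gauss_poly normrM (ger0_norm g0) mulrA -mulrDl ler_wpM2r// -mulrDr ler_wpM2l ?exprn_ge0//.
have hc : `|cos (c * x)| <= 1 by rewrite ler_norml cos_geN1 cos_le1.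
have hs : `|sin (c * x)| <= 1 by rewrite ler_norml sin_geN1 sin_le1.
by apply: (le_trans (ler_normD _ _)); rewrite !normrM; apply: lerD; rewrite ler_piMr.
Qed.

Lemma schwartz_gauss : schwartz (fun x : R => cis (c * x) * (gauss eps b x)%:C).
Proof.
set phi := (fun x : R => _).
have rE : re phi = gauss_poly 1 0.
  by apply/funext => x; rewrite /re /phi cReM /gauss_poly hornerC horner0 /=; ring.
have iE : im phi = gauss_poly 0 1.
  by apply/funext => x; rewrite /im /phi cImM /gauss_poly horner0 hornerC /=; ring.
split.
  move=> n x; rewrite rE iE.
  have [p1 [q1 ->]] := derive1n_gauss_poly 1 0 n; have [p2 [q2 ->]] := derive1n_gauss_poly 0 1 n.
  by split; [have [] := der_gauss_poly p1 q1 x|have [] := der_gauss_poly p2 q2 x].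
move=> j k; have [p1 [q1 E1]] := derive1n_gauss_poly 1 0 k.
have [p2 [q2 E2]] := derive1n_gauss_poly 0 1 k.
have [K1 h1] := gauss_poly_bound p1 q1 j; have [K2 h2] := gauss_poly_bound p2 q2 j.
exists (K1 + K2) => _ [x _ <-]; rewrite /weighted_deriv /cderiven rE iE E1 E2.
apply: le_trans (lerD (h1 x) (h2 x)); rewrite -mulrDr ler_wpM2l ?exprn_ge0//.
exact: modulus_le_ReIm.
Qed.

End SchwartzGauss.

Section SchwartzFunctions.
Context {R : realType}.
Local Notation mu := (@lebesgue_measure R).

Lemma schwartz_gauss0 (eps b : R) : 0 < eps -> schwartz (fun x : R => (gauss eps b x)%:C).
Proof.
move=> e0; have := schwartz_gauss b 0 e0; congr schwartz; apply/funext => x.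
by rewrite mul0r cis0 mul1r.
Qed.

Lemma fourier_gauss_mod (eps x y : R) : 0 < eps ->
  fourier (fun xi => cis (x * xi) * (gauss eps 0 xi)%:C) y =
  (Num.sqrt (pi / eps) * expR (- ((x - y) ^+ 2 / (4 * eps))))%:C.
Proof.
move=> e0; rewrite -fourier_gauss//; congr cintegral; apply/funext => xi.
by rewrite mulrAC -cisD mulrC; congr (_ * cis _); ring.
Qed.

(* [heat_width n] is the width of the Gaussian whose Fourier transform is [2 pi * heat n]. *)
Definition heat_width (n : nat) : R := (4 * n.+1%:R)^-1.

Lemma heat_width_gt0 n : 0 < heat_width n.
Proof. by rewrite invr_gt0 mulr_gt0// ltr0n. Qed.

Lemma fourier_heat (n : nat) (x y : R) :
  fourier (fun xi => cis (x * xi) * (gauss (heat_width n) 0 xi)%:C) y = (2 * pi * heat n x y)%:C.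
Proof.
have n0 : n.+1%:R != 0 :> R by rewrite pnatr_eq0.
have p0 : 0 < pi :> R := pi_gt0 R.
have pn : pi != 0 :> R by rewrite gt_eqF.
rewrite fourier_gauss_mod ?heat_width_gt0//; congr (_%:C); rewrite /heat mulrA; congr (_ * _).
  have -> : pi / heat_width n = (2 * pi) ^+ 2 * (n.+1%:R / pi).
    rewrite /heat_width invrK; move: n.+1%:R n0 pn => N N0; move: pi => q q0; field; exact: q0.
  by rewrite sqrtrM ?sqr_ge0// sqrtr_sqr ger0_norm// mulr_ge0// ltW.
rewrite /gauss; congr (expR (- _)); rewrite /heat_width.
have -> : (4 * (4 * n.+1%:R)^-1)^-1 = n.+1%:R :> R by move: n.+1%:R n0 => N N0; field; rewrite N0.
by rewrite mulrC; congr (_ * _); ring.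
Qed.

(** The definition of the transform is tested on a modulated Gaussian, whose own transform is
    [2 * pi * heat n x]. Heat averages of [u] thus become Gaussian-cut inverse transforms of [g],
    with no inversion theorem involved. *)
Lemma dist_of_fun_heat (u g : R -> R[i]) (n : nat) (x : R) :
  represented_by (dist_of_fun u) u -> has_fourier (dist_of_fun u) g ->
  cintegral (fun y => u y * (heat n x y)%:C) =
  ((2 * pi)^-1)%:C * cintegral (fun xi => g xi * (gauss (heat_width n) 0 xi)%:C * cis (x * xi)).
Proof.
move=> [_ hu] [_ hg].
have [_ E] := hg _ (schwartz_gauss 0 x (heat_width_gt0 n)).
have [iu _] := hu _ (schwartz_gauss0 x (ltr0Sn R n)).
have ih : cintegrable (fun y => u y * (heat n x y)%:C).
  have := cintegrableZ (Num.sqrt (n.+1%:R / pi))%:C iu.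
  congr cintegrable; apply/funext => y; rewrite /heat real_complexM; ring.
have := E; rewrite /fourier_dist /dist_of_fun.
have -> : (fun y => u y * fourier (fun xi => cis (x * xi) * (gauss (heat_width n) 0 xi)%:C) y) =
    (fun y => (2 * pi)%:C * (u y * (heat n x y)%:C)).
  by apply/funext => y; rewrite fourier_heat real_complexM mulrCA.
rewrite cintegralZ// => E'.
have -> : (fun xi => g xi * (gauss (heat_width n) 0 xi)%:C * cis (x * xi)) =
    (fun xi => g xi * (cis (x * xi) * (gauss (heat_width n) 0 xi)%:C)).
  by apply/funext => xi; rewrite -mulrA [cis _ * _]mulrC.
rewrite -E' mulrA -real_complexM mulVf ?mul1r// mulf_neq0 ?gt_eqF ?pi_gt0//.
Qed.

Lemma cintegral_ae (f g : R -> R[i]) : cmeas f -> cmeas g ->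
  {ae mu, forall x, f x = g x} -> cintegral f = cintegral g.
Proof.
move=> mf mg fg.
have [mf1 mf2] : measurable_fun setT (re f) /\ measurable_fun setT (im f) by exact: mf.
have [mg1 mg2] : measurable_fun setT (re g) /\ measurable_fun setT (im g) by exact: mg.
rewrite /cintegral /Rintegral; congr (Complex (fine _) (fine _)).
  apply: ae_eq_integral => //; [exact/measurable_EFinP|exact/measurable_EFinP|].
  by apply: (@filterS _ _ (ae_filter_ringOfSetsType mu)) fg => x /= h _; rewrite /re h.
apply: ae_eq_integral => //; [exact/measurable_EFinP|exact/measurable_EFinP|].
by apply: (@filterS _ _ (ae_filter_ringOfSetsType mu)) fg => x /= h _; rewrite /im h.
Qed.

(** Gaussian test functions suffice: all heat averages of [g - h] vanish, and they converge to
    [g - h] almost everywhere. *)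
Lemma has_fourier_unique (T : @schwartz_functional R) (g h : R -> R[i]) :
  has_fourier T g -> has_fourier T h -> {ae mu, forall x, g x = h x}.
Proof.
move=> [mg hg] [mh hh].
have md : cmeas (fun x => g x - h x) by apply: cmeasD => //; apply: cmeasN.
have I eps x : 0 < eps -> cintegrable (fun y => (g y - h y) * (gauss eps x y)%:C) /\
    cintegral (fun y => (g y - h y) * (gauss eps x y)%:C) = 0.
  move=> e0; have sg := schwartz_gauss0 x e0.
  have [i1 e1] := hg _ sg; have [i2 e2] := hh _ sg.
  rewrite (_ : (fun y => _) = (fun y => g y * (gauss eps x y)%:C - h y * (gauss eps x y)%:C)); last first.
    by apply/funext => y; rewrite mulrBl.
  split; first exact: cintegrableB.
  by rewrite cintegralB//; move: e1 e2; rewrite /dist_of_fun => <- <-; rewrite subrr.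
have := heat_cvgC md (fun x => (I 1 x ltr01).1).
apply: (@filterS _ _ (ae_filter_ringOfSetsType mu)) => x /= hx.
have E n : cintegral (fun y => (g y - h y) * (heat n x y)%:C) = 0.
  have [i1 e1] := I n.+1%:R x (ltr0Sn R n).
  rewrite (_ : (fun y => _) = (fun y => (Num.sqrt (n.+1%:R / pi))%:C * ((g y - h y) * (gauss n.+1%:R x y)%:C))).
    by rewrite cintegralZ// e1 mulr0.
  by apply/funext => y; rewrite /heat real_complexM; ring.
have : (fun n => modulus (cintegral (fun y => (g y - h y) * (heat n x y)%:C) - (g x - h x))) @ \oo -->
    modulus (g x - h x).
  rewrite (_ : (fun n => _) = (fun=> modulus (g x - h x))); first exact: cvg_cst.
  by apply/funext => n; rewrite E sub0r modulusN.
move=> /(cvg_unique _ hx) => /(_ (@Rhausdorff R)) m0.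
apply/eqP; rewrite -subr_eq0; apply/eqP; exact: modulus_eq0.
Qed.

End SchwartzFunctions.

Section LimInf.
Context {R : realType}.

Lemma limn_einf_ge (v M : nat -> R) (l : R) (k0 : nat) : v @ \oo --> l ->
  (forall k, (k0 <= k)%N -> v k <= M k) -> (l%:E <= limn_einf (fun k => (M k)%:E))%E.
Proof.
move=> vl vM; apply/lee_subgt0Pr => e e0; rewrite limn_einf_lim.
rewrite (cvg_lim (@ereal_hausdorff R) (@cvg_einfs_sup R _)).
move/cvgrPdist_lt : vl => /(_ e e0) [k1 _ hk1].
apply: (@le_trans _ _ (einfs (fun k => (M k)%:E) (maxn k0 k1))); last first.
  by apply: ereal_sup_ubound; exists (maxn k0 k1).
apply: le_ereal_inf_tmp => _ [k /= kk <-].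
have [kk0 kk1] : (k0 <= k)%N /\ (k1 <= k)%N.
  by split; apply: leq_trans kk; rewrite ?leq_maxl ?leq_maxr.
have := hk1 k kk1; rewrite /= ltr_norml => /andP[_ h2].
rewrite -EFinB lee_fin; apply: le_trans (vM k kk0); lra.
Qed.

Lemma limn_einf_le (v : nat -> \bar R) (b : \bar R) : (forall k, v k <= b)%E ->
  (limn_einf v <= b)%E.
Proof.
move=> vb; rewrite limn_einf_lim (cvg_lim (@ereal_hausdorff R) (@cvg_einfs_sup R _)).
apply: ge_ereal_sup => _ [k _ <-]; apply: le_trans (vb k).
by apply: ereal_inf_lbound; exists k => /=.
Qed.

End LimInf.

(** * From integrable data to arbitrary data in the Sobolev space *)

Section Sufficiency.
Context {R : realType}.
Local Notation mu := (@lebesgue_measure R).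
Variables gamma a s : R.
Hypotheses (gamma0 : 0 < gamma) (a0 : 0 < a) (a1 : a != 1) (s0 : 0 < s).
Hypothesis s_crit : a / (2 * gamma + 4) <= s.

Let regularised (fhat : R -> R[i]) (k : nat) (xi : R) : R[i] :=
  fhat xi * (gauss (heat_width k) 0 xi)%:C.

(** [schrodinger_mean] may use another representative of the transform of [f] than [fhat]; the two
    agree almost everywhere, which suffices under the integral. *)
Let mean_limit (f : @schwartz_functional R) (fhat v : R -> R[i]) (t : R) :
  has_fourier f fhat -> schrodinger_mean a t f v ->
  {ae mu, forall x, modulus (((2 * pi)^-1)%:C * wave a (regularised fhat k) t x - v x)
    @[k --> \oo] --> (0 : R)}.
Proof.
move=> hf [_ hv [fhat' hf' hv']].
have [mv iv] := hv; have [mfh ifh] := hf; have [mfh' ifh'] := hf'.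
have gv x : cintegrable (fun y => v y * (gauss 1 x y)%:C).
  exact: (iv _ (schwartz_gauss0 x ltr01)).1.
have := heat_cvgC mv gv.
apply: (@filterS _ _ (ae_filter_ringOfSetsType mu)) => x /=.
rewrite (_ : (fun n => _) = (fun k => modulus (((2 * pi)^-1)%:C * wave a (regularised fhat k) t x - v x)))//.
apply/funext => k; congr (modulus (_ - _)); rewrite (dist_of_fun_heat _ _ hv hv'); congr (_ * _).
have mg : cmeas (fun xi : R => (gauss (heat_width k) 0 xi)%:C).
  by apply: cmeas_real; exact: measurable_gauss.
have mc : cmeas (fun xi : R => cis (x * xi)) by apply: cmeas_cis; exact: measurable_funM.
have mt : cmeas (fun xi : R => cis (t * `|xi| `^ a)).
  by apply: cmeas_cis; apply: measurable_funM => //; exact: measurable_om.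
apply: cintegral_ae.
- by apply: cmeasM => //; apply: cmeasM => //; apply: cmeasM.
- by apply: cmeasM; [exact: cmeasM|exact: cmeas_phase1].
have := has_fourier_unique hf hf'.
apply: (@filterS _ _ (ae_filter_ringOfSetsType mu)) => xi /= h.
by rewrite /regularised h cisD; ring.
Qed.

Let regularised_le fhat k xi : sqmod (regularised fhat k xi) <= sqmod (fhat xi).
Proof.
rewrite /sqmod /regularised modulusM modulus_real lerXn2r ?nnegrE ?mulr_ge0 ?modulus_ge0//.
rewrite ler_piMr ?modulus_ge0// ger0_norm ?(ltW (gauss_gt0 _ _ _))//.
by rewrite /gauss expR_le1 oppr_le0 mulr_ge0 ?sqr_ge0// ltW// heat_width_gt0.
Qed.

Lemma measurable_maximal (u : nat -> R -> R[i]) : (forall n, (1 <= n)%N -> cmeas (u n)) ->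
  measurable_fun setT (maximal_fun u).
Proof.
(* [maxn n 1] avoids the index 0, at which nothing is known about [u]. *)
move=> mu'; pose v n x := (modulus (u (maxn n 1) x))%:E.
have mv n : measurable_fun setT (v n).
  by apply/measurable_EFinP; apply: measurable_modulus; apply: mu'; rewrite leq_maxr.
have := measurable_fun_esups mv 1; congr (measurable_fun _ _).
apply/funext => x; rewrite /esups /maximal_fun /sdrop /=; congr ereal_sup.
apply/seteqP; split=> [_ [n /= n1 <-]|_ [n /= n1 <-]]; exists n => //.
  by rewrite /v (maxn_idPl n1).
by rewrite /v (maxn_idPl n1).
Qed.

Let maximal_le (u : nat -> R -> R[i]) (K : R) (m : \bar R) x : 0 < K -> (0 <= m)%E ->
  (forall n, (1 <= n)%N -> (sqmod (u n x))%:E <= K%:E * m)%E ->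
  (`|maximal_fun u x| `^ 2 <= K%:E * m)%E.
Proof.
move=> K0 m0 h.
have Mx0 : (0 <= maximal_fun u x)%E.
  apply: (@le_trans _ _ (modulus (u 1%N x))%:E); first by rewrite lee_fin modulus_ge0.
  by apply: ereal_sup_ubound; exists 1%N.
rewrite gee0_abs//; case: m m0 h => [m| |]// m0 h; last first.
  by rewrite gt0_muley ?lte_fin// leey.
have Km : 0 <= K * m by rewrite mulr_ge0 ?(ltW K0).
have le_sqrt : (maximal_fun u x <= (Num.sqrt (K * m))%:E)%E.
  apply: ge_ereal_sup => _ [n /= n1 <-]; rewrite lee_fin.
  rewrite -[leLHS](ger0_norm (modulus_ge0 _)) -sqrtr_sqr ler_wsqrtr//.
  by have := h n n1; rewrite -EFinM lee_fin.
have E : ((Num.sqrt (K * m))%:E `^ 2 = K%:E * m%:E)%E.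
  by rewrite poweR_EFin powR_mulrn ?sqrtr_ge0// sqr_sqrtr// EFinM.
rewrite -E; apply: gt0_ler_poweR => //; rewrite ?in_itv/= ?leey ?andbT//.
Qed.

(** The majorant [M k] handles the [k]-th regularisation and all [n < 2^k]. For a fixed [n] this
    covers every large [k], so the lower limit of [M k] dominates each [|u n|^2] almost everywhere,
    up to the constant [K]. *)
Lemma maximal_bound : exists2 C : R, 0 < C &
  forall (f : @schwartz_functional R) (fhat : R -> R[i]) (u : nat -> R -> R[i]),
    in_sobolev s f fhat ->
    (forall n : nat, (1 <= n)%N -> schrodinger_mean a (n%:R `^ (- gamma)) f (u n)) ->
    ('N[mu]_(2%:E) [maximal_fun u] <= C%:E * sobolev_norm s fhat)%E.
Proof.
have [C C0 hC] := core_maximal gamma0 a0 a1 s0 s_crit.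
(* The square of the factor omitted in [wave]. *)
pose K : R := (2 * pi) ^- 2; have K0 : 0 < K by rewrite invr_gt0 exprn_gt0// mulr_gt0// pi_gt0.
exists ((K * C) `^ 2^-1); first by rewrite powR_gt0// mulr_gt0.
move=> f fhat u [_ hf _] hu.
have [mfh ifh] := hf.
have ig k : cintegrable (regularised fhat k).
  exact: (ifh _ (schwartz_gauss0 0 (heat_width_gt0 k))).1.
have mu1 n : (1 <= n)%N -> cmeas (u n) by move=> /hu [_ [m _] _].
have mW := @measurable_sobolev_weight R s.
have /choice[M hM] : forall k, exists M : R -> R,
    [/\ measurable_fun setT M, (forall x, 0 <= M x),
    (forall n x, (0 < n < 2 ^ k)%N -> sqmod (wave a (regularised fhat k) (time gamma n) x) <= M x) &
    (\int[mu]_x (M x)%:E <= C%:E * \int[mu]_xi ((1 + `|xi| ^+ 2) `^ s * sqmod (regularised fhat k xi))%:E)%E].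
  by move=> k; exact: hC.
pose B := (\int[mu]_xi ((1 + `|xi| ^+ 2) `^ s * sqmod (fhat xi))%:E)%E.
have MB k : (\int[mu]_x (M k x)%:E <= C%:E * B)%E.
  have [_ _ _ iM] := hM k; apply: (le_trans iM); apply: lee_wpmul2l; first by rewrite lee_fin ltW.
  apply: le_Ie.
  - by apply: measurable_funM => //; apply: measurable_sqmod; exact: cintegrable_meas.
  - by apply: measurable_funM => //; apply: measurable_sqmod.
  - by move=> xi; rewrite mulr_ge0 ?powR_ge0 ?sqmod_ge0.
  - by move=> xi; apply: ler_wpM2l; [exact: powR_ge0|exact: regularised_le].
have mM k : measurable_fun setT (fun x => (M k x)%:E).
  by apply/measurable_EFinP; have [] := hM k.
have M0 k x : (0 <= (M k x)%:E)%E by rewrite lee_fin; have [_ h _ _] := hM k.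
pose m x := limn_einf (fun k => (M k x)%:E).
have mm : measurable_fun setT m.
  rewrite (_ : m = fun x => - limn_esup (fun k => - (M k x)%:E))%E//.
  apply: measurableT_comp => //; apply: measurable_fun_limn_esup => k.
  by apply: measurableT_comp.
have m0 x : (0 <= m x)%E.
  apply: (@limn_einf_ge R (fun=> 0) (fun k => M k x) 0 0); first exact: cvg_cst.
  by move=> k _; have [_ h _ _] := hM k.
have im : (\int[mu]_x m x <= C%:E * B)%E.
  have F := @fatou _ _ R mu setT measurableT (fun k x => (M k x)%:E) mM (fun k x _ => M0 k x).
  by apply: (le_trans F); exact: limn_einf_le.
have ae_le : {ae mu, forall x, setT x -> (`|maximal_fun u x| `^ 2 <= K%:E * m x)%E}.
  have lim n : {ae mu, forall x, (1 <= n)%N ->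
      modulus (((2 * pi)^-1)%:C * wave a (regularised fhat k) (time gamma n) x - u n x)
      @[k --> \oo] --> (0 : R)}.
    case: n => [|n]; first by apply: (@filterE _ _ (ae_filter_ringOfSetsType mu)).
    by have := mean_limit hf (hu n.+1 isT); apply: (@filterS _ _ (ae_filter_ringOfSetsType mu)).
  have /ae_foralln := lim.
  apply: (@filterS _ _ (ae_filter_ringOfSetsType mu)) => x /= hx _.
  apply: maximal_le => // n n1; have {}hx := hx n n1.
  pose w k := ((2 * pi)^-1)%:C * wave a (regularised fhat k) (time gamma n) x.
  have cw : modulus (w k) @[k --> \oo] --> modulus (u n x).
    apply/cvgrPdist_le => e e0; move/cvgrPdist_le : hx => /(_ e e0) [k0 _ hk0].
    exists k0 => // k /hk0 /=; rewrite sub0r normrN (ger0_norm (modulus_ge0 _)) -/(w k).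
    by apply: le_trans; rewrite distrC; exact: modulus_dist.
  have cw2 : (fun k => K^-1 * modulus (w k) ^+ 2) @ \oo --> K^-1 * modulus (u n x) ^+ 2.
    by apply: cvgM; [exact: cvg_cst|exact: (cvgM cw cw)].
  have [J0 hJ0] : exists J : nat, forall k, (J <= k)%N -> (n < 2 ^ k)%N.
    by exists n => k nk; apply: (leq_trans (ltn_expl n (ltnSn 1))); rewrite leq_exp2l.
  have := limn_einf_ge cw2 (k0 := J0) (M := fun k => M k x).
  rewrite -/(m x) => H.
  rewrite -lee_pdivrMl//. 
  apply: H => k /hJ0 nk; have [_ _ h _] := hM k.
  apply: le_trans (h n x _); last by rewrite nk n1.
  rewrite /w modulusM modulus_real exprMn real_normK ?num_real// mulrA.
  rewrite (_ : K^-1 * _ = 1) ?mul1r// /K invrK exprVn mulfV//.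
  by rewrite expf_neq0// mulf_neq0// gt_eqF ?pi_gt0.
have mmax := measurable_maximal mu1.
have step : (\int[mu]_x (`|maximal_fun u x| `^ 2) <= (K * C)%:E * B)%E.
  apply: (@le_trans _ _ (\int[mu]_x (K%:E * m x))%E).
    apply: ae_ge0_le_integral => //.
    - by move=> x _; exact: poweR_ge0.
    - have ma : measurable_fun setT (fun x => `|maximal_fun u x|%E) by exact: measurableT_comp.
      exact: (measurableT_comp (measurable_poweR 2) ma).
    - by move=> x _; rewrite mule_ge0// lee_fin ltW.
    - exact: measurable_funeM.
  rewrite ge0_integralZl_EFin ?(ltW K0)//.
  by rewrite EFinM -muleA lee_wpmul2l// lee_fin ltW.
have B0 : (0 <= B)%E by apply: Ie_ge0 => xi; rewrite mulr_ge0 ?powR_ge0 ?sqmod_ge0.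
rewrite unlock /sobolev_norm -/B.
apply: (@le_trans _ _ (((K * C)%:E * B) `^ 2^-1)%E).
  apply: gt0_ler_poweR => //; rewrite ?in_itv/= ?leey ?andbT//.
    by apply: integral_ge0 => x _; exact: poweR_ge0.
  by rewrite mule_ge0// lee_fin mulr_ge0// ltW.
by rewrite poweRM ?lee_fin ?mulr_ge0 ?(ltW K0) ?(ltW C0)// poweR_EFin.
Qed.

End Sufficiency.

(** * Fourier inversion for band-limited functions *)

Section SchwartzBounds.
Context {R : realType}.
Local Notation mu := (@lebesgue_measure R).
Implicit Types (phi : R -> R[i]).

Lemma le_schwartz_seminorm j k phi x : schwartz phi ->
  weighted_deriv j k phi x <= schwartz_seminorm j k phi.
Proof. by move=> [_ /(_ j k) h]; apply: ub_le_sup => //; exists x. Qed.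

Lemma schwartz_seminorm_ge0 j k phi : schwartz phi -> 0 <= schwartz_seminorm j k phi.
Proof.
move=> sp; apply: le_trans (le_schwartz_seminorm j k 0 sp).
by rewrite mulr_ge0 ?exprn_ge0 ?modulus_ge0.
Qed.

Definition decay_cst phi : R := schwartz_seminorm 0 0 phi + schwartz_seminorm 2 0 phi.

Lemma decay_cst_ge0 phi : schwartz phi -> 0 <= decay_cst phi.
Proof. by move=> sp; rewrite addr_ge0 ?schwartz_seminorm_ge0. Qed.

Lemma schwartz_decay phi x : schwartz phi -> (1 + x ^+ 2) * modulus (phi x) <= decay_cst phi.
Proof.
move=> sp; have h0 := le_schwartz_seminorm 0 0 x sp; have h2 := le_schwartz_seminorm 2 0 x sp.
have E : cderiven 0 phi x = phi x by rewrite /cderiven /re /im !derive1n0; case: (phi x).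
rewrite /weighted_deriv E expr0 mul1r in h0; rewrite /weighted_deriv E real_normK ?num_real// in h2.
by rewrite mulrDl mul1r; exact: lerD.
Qed.

Lemma schwartz_cmeas phi : schwartz phi -> cmeas phi.
Proof.
move=> [sm _]; split; apply: continuous_measurable_fun => x.
  have [h _] := sm 0%N x; rewrite derive1n0 in h.
  by apply: differentiable_continuous; exact/derivable1_diffP.
have [_ h] := sm 0%N x; rewrite derive1n0 in h.
by apply: differentiable_continuous; exact/derivable1_diffP.
Qed.

Lemma schwartz_le phi x : schwartz phi -> modulus (phi x) <= decay_cst phi.
Proof.
move=> sp; apply: le_trans (schwartz_decay x sp).
by rewrite ler_peMl ?modulus_ge0// lerDl sqr_ge0.
Qed.

(** [majorant 1] decays like [|x|^(-3/2)] and serves as an integrable weight whose integral is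
    already known to be at most 8. *)
Lemma L1_majorant1 : L1 (fun x : R => majorant 1 `|x|).
Proof.
have h := majorant_int (lexx 1) (@ltr01 R).
have E : (fun x : R => majorant 1 `|x|) = (fun x => 1 * majorant 1 (1 * `|x|)).
  by apply/funext => x; rewrite !mul1r.
rewrite E; apply: (L1_le_Ie (B := 8 * Num.sqrt 1)) h.
  apply: measurable_funM => //; apply: continuous_measurable_fun.
  exact: (continuous_majorant (lexx 1) ltr01).
by move=> x; rewrite mul1r majorant_ge0// mul1r.
Qed.

Lemma schwartz_le_majorant phi x : schwartz phi ->
  modulus (phi x) <= 4 * decay_cst phi * majorant 1 `|x|.
Proof.
move=> sp; have d := schwartz_decay x sp; have d0 := decay_cst_ge0 sp.
have y0 := normr_ge0 x; have p0 : 0 < 1 + x ^+ 2 by rewrite ltr_pwDl// sqr_ge0.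
apply: (@le_trans _ _ (decay_cst phi / (1 + x ^+ 2))); first by rewrite ler_pdivlMr// mulrC.
rewrite [4 * _]mulrC -mulrA; apply: ler_wpM2l => //.
have -> : x ^+ 2 = `|x| ^+ 2 by rewrite real_normK ?num_real.
move: (normr_ge0 x); set y := `|x|; move=> {}y0.
have s1 : 1 <= 1 + y by rewrite lerDl.
have sq : Num.sqrt (1 + y) <= 1 + y.
  rewrite -[leRHS](ger0_norm (le_trans ler01 s1)) -sqrtr_sqr ler_wsqrtr//.
  by rewrite expr2 ler_peMl// (le_trans ler01 s1).
have s0 : 0 < Num.sqrt (1 + y) by rewrite sqrtr_gt0 (lt_le_trans ltr01 s1).
have y2 : 0 < 1 + 1 + y by rewrite ltr_pwDl.
have q0 : 0 < 1 + y ^+ 2 by rewrite ltr_pwDl// sqr_ge0.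
rewrite /majorant mul1r -[leLHS]mul1r ler_pdivrMr// mulrAC ler_pdivlMr ?mulr_gt0// mul1r.
apply: (@le_trans _ _ ((1 + 1 + y) * (1 + y))); first by rewrite ler_pM2l.
nra.
Qed.

Lemma schwartz_cintegrable phi : schwartz phi -> cintegrable phi.
Proof.
move=> sp; apply: (@cintegrable_le _ _ (fun x => 4 * decay_cst phi * majorant 1 `|x|)).
- exact: schwartz_cmeas.
- by apply: L1Zl; exact: L1_majorant1.
- by move=> x; exact: schwartz_le_majorant.
Qed.

Lemma schwartz_Rint_modulus phi : schwartz phi -> \int[mu]_x modulus (phi x) <= 32 * decay_cst phi.
Proof.
move=> sp; have d0 := decay_cst_ge0 sp.
apply: (@le_trans _ _ (\int[mu]_x (4 * decay_cst phi * majorant 1 `|x|))).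
  apply: le_Rint; first exact: cintegrable_modulus (schwartz_cintegrable sp).
    by apply: L1Zl; exact: L1_majorant1.
  by move=> x; exact: schwartz_le_majorant.
rewrite RintZl; last exact: L1_majorant1.
have m8 : \int[mu]_x majorant 1 `|x| <= 8 :> R.
  rewrite Ie_Rint; last exact: L1_majorant1.
  have := majorant_int (lexx 1) (@ltr01 R); rewrite sqrtr1 mulr1.
  apply: le_trans; rewrite le_eqVlt; apply/orP; left; apply/eqP; apply: eq_integral => x _.
  by rewrite !mul1r.
apply: (@le_trans _ _ (4 * decay_cst phi * 8)); first by rewrite ler_wpM2l// mulr_ge0.
by rewrite le_eqVlt; apply/orP; left; apply/eqP; ring.
Qed.

End SchwartzBounds.

Section GaussWidth.
Context {R : realType}.

Lemma gauss_width_le1 k (x : R) : gauss (heat_width k) 0 x <= 1.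
Proof. by rewrite /gauss expR_le1 oppr_le0 mulr_ge0 ?sqr_ge0// ltW// heat_width_gt0. Qed.

Lemma gauss_width_cvg (x : R) : `|gauss (heat_width k) 0 x - 1| @[k --> \oo] --> (0 : R).
Proof.
have h : (fun k => x ^+ 2 / 4 * k.+1%:R^-1) @ \oo --> x ^+ 2 / 4 * 0.
  by apply: cvgM; [exact: cvg_cst|exact: cvg_harmonic].
rewrite mulr0 in h; apply/cvgrPdist_le => e e0; move/cvgrPdist_le : h => /(_ e e0).
apply: filterS => k /=; rewrite !sub0r !normrN normr_id => /(le_trans (ler_norm _)).
apply: le_trans; rewrite distrC ger0_norm ?subr_ge0 ?gauss_width_le1//.
have := expR_ge1Dx (- (heat_width k * (x - 0) ^+ 2)).
rewrite -/(gauss (heat_width k) 0 x) subr0 => h1.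
have -> : x ^+ 2 / 4 / k.+1%:R = heat_width k * x ^+ 2 by rewrite /heat_width invfM; ring.
lra.
Qed.

Lemma mul_le_sqrD (p q r : R) : 0 <= p -> 0 <= q -> 0 <= r -> r <= q -> p * r <= p ^+ 2 + q ^+ 2.
Proof. by move=> p0 q0 r0 rq; have := sqr_ge0 (p - q); nra. Qed.

End GaussWidth.

Section Inversion.
Context {R : realType}.
Local Notation mu := (@lebesgue_measure R).

Lemma cintegral_dct (F : nat -> R -> R[i]) (f : R -> R[i]) (h : R -> R) :
  (forall k, cmeas (F k)) -> cmeas f -> L1 h -> (forall k x, modulus (F k x) <= h x) ->
  (forall x, modulus (f x) <= h x) ->
  {ae mu, forall x, modulus (F k x - f x) @[k --> \oo] --> (0 : R)} ->
  modulus (cintegral (F k) - cintegral f) @[k --> \oo] --> (0 : R).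
Proof.
move=> mF mf ih Fh fh Ff.
have iF k : cintegrable (F k) by exact: (cintegrable_le (mF k) ih).
have if' : cintegrable f by exact: (cintegrable_le mf ih).
pose D k x := modulus (F k x - f x).
have mD k : measurable_fun setT (D k).
  by apply: measurable_modulus; apply: cmeasD; [exact: mF|exact: cmeasN].
have iD k : L1 (D k) by apply: cintegrable_modulus; exact: cintegrableB.
have ih2 : mu.-integrable setT (EFin \o (fun x => 2 * h x)) by exact: L1Zl.
have [||||_ _] := @dominated_convergence _ _ R mu setT measurableT (fun k x => (D k x)%:E) (fun=> 0%E)
  (EFin \o (fun x => 2 * h x)) _ _ _ ih2.
- by move=> k; apply/measurable_EFinP; exact: mD.
- by [].
- apply: (@filterS _ _ (ae_filter_ringOfSetsType mu)) Ff => x hx _.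
  by apply: cvg_EFin; [exact: nearW|exact: hx].
- apply: (@filterE _ _ (ae_filter_ringOfSetsType mu)) => x k _ /=.
  rewrite lee_fin ger0_norm ?modulus_ge0//; apply: (le_trans (modulusD _ _)).
  by rewrite modulusN mulrDl !mul1r; exact: lerD.
rewrite integral0 => /fine_cvgP[_ hc].
apply/cvgrPdist_le => e e0; move/cvgrPdist_le : hc => /(_ e e0).
apply: filterS => k h'; rewrite sub0r normrN ger0_norm ?modulus_ge0//.
apply: (le_trans _ h'); rewrite sub0r normrN; apply: le_trans (ler_norm _).
by rewrite -cintegralB//; apply: modulus_cintegral; exact: cintegrableB.
Qed.

Lemma cmeas_fourier (phi : R -> R[i]) : cintegrable phi -> cmeas (fourier phi).
Proof.
move=> ip; apply: (cmeas_cintegral ip (e := fun z => cis (- (z.1 * z.2))) (M := 1)).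
  by apply: cmeas_cis; apply: measurableT_comp => //; exact: measurable_funM.
by move=> z; rewrite modulus_cis.
Qed.

Lemma modulus_fourier_le (phi : R -> R[i]) x : cintegrable phi ->
  modulus (fourier phi x) <= \int[mu]_y modulus (phi y).
Proof.
move=> ip; apply: modulus_cint_kernel => //; last by move=> y; rewrite modulus_cis.
by apply: cmeas_cis; apply: measurableT_comp => //; exact: measurable_funM.
Qed.

(** A bounded integrable function is square integrable, so the right-hand side of [bessel] is
    finite. *)
Lemma L1_bessel (h : R -> R[i]) (M : R) : cintegrable h -> (forall x, modulus (h x) <= M) ->
  L1 (fun y => modulus (cintegral (fun x => h x * cis (x * y))) ^+ 2).
Proof.
move=> ih hM; have mh := cintegrable_meas ih.
apply: L1_lty; last first.
- apply: (le_lt_trans (bessel ih)).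
  have il : L1 (fun x => modulus (h x) ^+ 2).
    apply: (L1_le (g := fun x => M * modulus (h x))).
    + by apply: measurable_funX; exact: measurable_modulus.
    + by apply: L1Zl; exact: cintegrable_modulus.
    + by move=> x; rewrite ger0_norm ?sqr_ge0// expr2 ler_wpM2r ?modulus_ge0.
  by rewrite -L1_fineK// -EFinM ltry.
- by move=> x; exact: sqr_ge0.
apply: measurable_funX; apply: measurable_modulus.
apply: (cmeas_cintegral ih (e := fun z => cis (z.1 * z.2)) (M := 1)).
  by apply: cmeas_cis; exact: measurable_funM.
by move=> z; rewrite modulus_cis.
Qed.

Definition inv_fourier (g : R -> R[i]) (x : R) : R[i] :=
  ((2 * pi)^-1)%:C * cintegral (fun xi => g xi * cis (x * xi)).

Variables (g : R -> R[i]) (M : R).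
Hypothesis ig : cintegrable g.
Hypothesis gM : forall x, modulus (g x) <= M.

Let V : R := (2 * pi)^-1 * \int[mu]_y modulus (g y).

Let pi2 : 0 < (2 * pi)^-1 :> R.
Proof. by rewrite invr_gt0 mulr_gt0// pi_gt0. Qed.

Lemma cmeas_inv_fourier : cmeas (inv_fourier g).
Proof.
apply: cmeasM; first exact: cmeas_cst.
apply: (cmeas_cintegral ig (e := fun z => cis (z.2 * z.1)) (M := 1)).
  by apply: cmeas_cis; exact: measurable_funM.
by move=> z; rewrite modulus_cis.
Qed.

Let modulus_inv_fourier x : modulus (inv_fourier g x) <= V.
Proof.
rewrite modulusM modulus_real (ger0_norm (ltW pi2)); apply: ler_wpM2l; first exact: ltW.
apply: modulus_cint_kernel => //; last by move=> y; rewrite modulus_cis.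
by apply: cmeas_cis; exact: measurable_funM.
Qed.

Let ivphi phi : schwartz phi -> cintegrable (fun x => inv_fourier g x * phi x).
Proof.
move=> sp.
rewrite (_ : (fun x => _) = (fun x => phi x * inv_fourier g x)); last first.
  by apply/funext => x; rewrite mulrC.
apply: (cintegrableMbounded (schwartz_cintegrable sp) cmeas_inv_fourier (M := V)).
exact: modulus_inv_fourier.
Qed.

Lemma represented_inv_fourier : represented_by (dist_of_fun (inv_fourier g)) (inv_fourier g).
Proof. by split; [exact: cmeas_inv_fourier|move=> phi sp; split => //; exact: ivphi]. Qed.

Lemma tempered_inv_fourier : tempered (dist_of_fun (inv_fourier g)).
Proof.
have V0 : 0 <= V.
  by apply: mulr_ge0; [exact: ltW|apply: Rintegral_ge0 => y _; exact: modulus_ge0].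
split.
  move=> c phi psi sp sq; rewrite /dist_of_fun -cintegralZ; last exact: ivphi.
  rewrite -cintegralD; [|by apply: cintegrableZ; exact: ivphi|exact: ivphi].
  by congr cintegral; apply/funext => x; ring.
(* Order 2 is what [decay_cst] needs, being built from the seminorms [(0, 0)] and [(2, 0)]; 32 comes
   from [schwartz_Rint_modulus]. *)
exists 2%N, (V * 32) => phi sp.
apply: (le_trans (modulus_cintegral (ivphi sp))).
apply: (@le_trans _ _ (\int[mu]_x (V * modulus (phi x)))).
  apply: le_Rint.
  - by apply: cintegrable_modulus; exact: ivphi.
  - by apply: L1Zl; apply: cintegrable_modulus; exact: schwartz_cintegrable.
  - by move=> x; rewrite modulusM ler_wpM2r ?modulus_ge0.
rewrite RintZl; last by apply: cintegrable_modulus; exact: schwartz_cintegrable.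
rewrite -mulrA; apply: ler_wpM2l => //.
apply: (le_trans (schwartz_Rint_modulus sp)); apply: ler_wpM2l => //.
have s0 j k := schwartz_seminorm_ge0 j k sp.
rewrite !big_ord_recr !big_ord0 /= /decay_cst.
have aux (x00 x01 x02 x10 x11 x12 x20 x21 x22 : R) : 0 <= x01 -> 0 <= x02 -> 0 <= x10 ->
    0 <= x11 -> 0 <= x12 -> 0 <= x21 -> 0 <= x22 ->
    x00 + x20 <= 0 + (0 + x00 + x01 + x02) + (0 + x10 + x11 + x12) + (0 + x20 + x21 + x22).
  by lra.
by apply: aux; exact: s0.
Qed.

Let L1_v : L1 (fun x => modulus (inv_fourier g x) ^+ 2).
Proof.
have := L1Zl ((2 * pi)^-1 ^+ 2) (L1_bessel ig gM); congr (L1 _); apply/funext => x.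
rewrite modulusM modulus_real (ger0_norm (ltW pi2)) exprMn; congr (_ * modulus _ ^+ 2).
by congr cintegral; apply/funext => xi; rewrite [xi * x]mulrC.
Qed.

(** [bessel] is stated for the phase [+ x * xi]; conjugating [phi] brings the transform to that form
    without changing its modulus. *)
Let L1_fourier (phi : R -> R[i]) : schwartz phi -> L1 (fun x => modulus (fourier phi x) ^+ 2).
Proof.
move=> sp; have ip := schwartz_cintegrable sp.
have ic : cintegrable (fun x => conjc (phi x)).
  apply: (cintegrable_dom _ ip); first by apply: cmeas_conjc; exact: schwartz_cmeas.
  by move=> x; rewrite modulus_conjc.
have cb x : modulus (conjc (phi x)) <= decay_cst phi by rewrite modulus_conjc; exact: schwartz_le.
have := L1_bessel ic cb; congr (L1 _); apply/funext => y; congr (_ ^+ 2).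
rewrite -[RHS]modulus_conjc /fourier -cintegral_conjc.
  congr (modulus (cintegral _)); apply/funext => x.
  by rewrite rmorphM /= conjc_cis opprK.
apply: (cintegrableMbounded ip (M := 1)); last by move=> x; rewrite modulus_cis.
by apply: cmeas_cis; apply: measurableT_comp => //; exact: measurable_funM.
Qed.

(** The Gaussian makes the triple integral absolutely convergent. Two applications of Fubini then
    leave the integral in [x] innermost, and it equals [2 * pi] times the heat kernel. *)
Let regularised_parseval phi k : schwartz phi ->
  cintegral (fun x => inv_fourier g x * (fourier phi x * (gauss (heat_width k) 0 x)%:C)) =
  cintegral (fun xi => g xi * cintegral (fun y => phi y * (heat k xi y)%:C)).
Proof.
move=> sp; have ip := schwartz_cintegrable sp.
pose G x : R[i] := (gauss (heat_width k) 0 x)%:C.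
have iG : cintegrable G by apply: schwartz_cintegrable; apply: schwartz_gauss0; exact: heat_width_gt0.
have mc (xi : R) : cmeas (fun x : R => cis (xi * x)) by apply: cmeas_cis; exact: measurable_funM.
have ipG : cintegrable (fun x => fourier phi x * G x).
  rewrite (_ : (fun x => _) = (fun x => G x * fourier phi x)); last first.
    by apply/funext => x; rewrite mulrC.
  apply: (cintegrableMbounded iG (M := \int[mu]_y modulus (phi y))); first exact: cmeas_fourier.
  by move=> x; exact: modulus_fourier_le.
have pn : (2 * pi) != 0 :> R by rewrite mulf_neq0 ?gt_eqF ?pi_gt0.
transitivity (((2 * pi)^-1)%:C * cintegral (fun x => (fourier phi x * G x) *
    cintegral (fun xi => g xi * cis (x * xi)))).
  rewrite -cintegralZ.
    by congr cintegral; apply/funext => x; rewrite /inv_fourier /G; ring.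
  apply: (cintegrableMbounded ipG (M := \int[mu]_y modulus (g y))).
    apply: (cmeas_cintegral ig (e := fun z => cis (z.2 * z.1)) (M := 1)).
      by apply: cmeas_cis; exact: measurable_funM.
    by move=> z; rewrite modulus_cis.
  move=> x; apply: modulus_cint_kernel => //; by move=> y; rewrite modulus_cis.
have me : cmeas (fun z : R * R => cis (z.1 * z.2)) by apply: cmeas_cis; exact: measurable_funM.
have me' : cmeas (fun z : R * R => cis (- (z.2 * z.1))).
  by apply: cmeas_cis; apply: measurableT_comp => //; exact: measurable_funM.
rewrite (cFubini_kernel ipG ig me (M := 1)) => [|z]; last by rewrite modulus_cis.
rewrite -cintegralZ.
  congr cintegral; apply/funext => xi; rewrite mulrCA; congr (_ * _).
  have iGc : cintegrable (fun x => G x * cis (xi * x)).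
    by apply: (cintegrableMbounded iG (M := 1)) => // x; rewrite modulus_cis.
  transitivity (((2 * pi)^-1)%:C * cintegral (fun x => (G x * cis (xi * x)) *
      cintegral (fun y => phi y * cis (- (y * x))))).
    congr (_ * cintegral _); apply/funext => x; rewrite /= [x * xi]mulrC /fourier; ring.
  rewrite (cFubini_kernel iGc ip me' (M := 1)) => [|z]; last by rewrite modulus_cis.
  have E y : cintegral (fun x => G x * cis (xi * x) * cis (- (y * x))) = (2 * pi * heat k xi y)%:C.
    rewrite -fourier_heat /fourier; congr cintegral; apply/funext => x.
    by rewrite /G [cis (xi * x) * _]mulrC [y * x]mulrC.
  rewrite -cintegralZ.
    congr cintegral; apply/funext => y; rewrite /= E real_complexM mulrCA; congr (_ * _).
    by rewrite mulrA -real_complexM mulVf// mul1r.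
  have -> : (fun y => phi y * cintegral (fun x => G x * cis (xi * x) * cis (- (y * x)))) =
      (fun y => (2 * pi)%:C * (phi y * (heat k xi y)%:C)).
    by apply/funext => y; rewrite E real_complexM mulrCA.
  apply: cintegrableZ.
  have ih : cintegrable (fun y => (heat k xi y)%:C).
    by split; rewrite /re /im /=; [exact: L1_heat|exact: L1_0].
  rewrite (_ : (fun y => _) = (fun y => (heat k xi y)%:C * phi y)); last first.
    by apply/funext => y; rewrite mulrC.
  apply: (cintegrableMbounded ih (M := decay_cst phi)); first exact: schwartz_cmeas.
  by move=> y; exact: schwartz_le.
apply: (cintegrableMbounded ig (M := \int[mu]_x modulus (fourier phi x * G x))).
  by apply: (cmeas_cintegral ipG me (M := 1)) => z; rewrite modulus_cis.
move=> xi; apply: modulus_cint_kernel => //=; last by move=> x; rewrite modulus_cis.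
rewrite (_ : (fun x => _) = (fun x => cis (xi * x)))//.
by apply/funext => x; rewrite mulrC.
Qed.

(** Both limits of the Gaussian-regularised pairing [A k] are computed. In physical space
    [inv_fourier g] need not be integrable, but it and [fourier phi] are square integrable, so the
    sum of their squares dominates; in frequency the heat averages of [phi] converge to [phi]. *)
Lemma has_fourier_inv_fourier : has_fourier (dist_of_fun (inv_fourier g)) g.
Proof.
split; first exact: cintegrable_meas.
move=> phi sp; have ip := schwartz_cintegrable sp; have mp := schwartz_cmeas sp.
have mg := cintegrable_meas ig; have mv := cmeas_inv_fourier; have mf := cmeas_fourier ip.
split; first exact: (cintegrableMbounded ig mp (fun x => schwartz_le x sp)).
pose A k := cintegral (fun x => inv_fourier g x * (fourier phi x * (gauss (heat_width k) 0 x)%:C)).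
rewrite /fourier_dist /dist_of_fun.
have hA : modulus (A k - cintegral (fun x => inv_fourier g x * fourier phi x)) @[k --> \oo] --> (0 : R).
  apply: (cintegral_dct (h := fun x => modulus (inv_fourier g x) ^+ 2 + modulus (fourier phi x) ^+ 2)).
  - move=> k; apply: cmeasM => //; apply: cmeasM => //; apply: cmeas_real; exact: measurable_gauss.
  - exact: cmeasM.
  - by apply: L1D => //; exact: L1_fourier.
  - move=> k x; rewrite modulusM [modulus (fourier _ _ * _)]modulusM modulus_real.
    have g0 := ltW (gauss_gt0 (heat_width k) 0 x); rewrite (ger0_norm g0).
    have g1 := gauss_width_le1 k x.
    apply: mul_le_sqrD; rewrite ?modulus_ge0 ?mulr_ge0 ?modulus_ge0//.
    by rewrite ler_piMr ?modulus_ge0.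
  - by move=> x; rewrite modulusM; apply: mul_le_sqrD; rewrite ?modulus_ge0 ?lexx.
  apply: (@filterE _ _ (ae_filter_ringOfSetsType mu)) => x.
  rewrite (_ : (fun k => _) = (fun k => modulus (inv_fourier g x * fourier phi x) *
    `|gauss (heat_width k) 0 x - 1|)); last first.
    apply/funext => k; rewrite -modulus_real -modulusM; congr modulus.
    by rewrite real_complexD rmorphN1 mulrBr mulr1 mulrA.
  rewrite -[X in _ --> X](mulr0 (modulus (inv_fourier g x * fourier phi x))).
  by apply: cvgM; [exact: cvg_cst|exact: gauss_width_cvg].
have hB : modulus (A k - cintegral (fun x => g x * phi x)) @[k --> \oo] --> (0 : R).
  rewrite (_ : A = fun k => cintegral (fun xi => g xi * cintegral (fun y => phi y * (heat k xi y)%:C))); last first.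
    by apply/funext => k; exact: regularised_parseval.
  have ih k xi : cintegrable (fun y => phi y * (heat k xi y)%:C).
    have ih' : cintegrable (fun y => (heat k xi y)%:C).
      by split; rewrite /re /im /=; [exact: L1_heat|exact: L1_0].
    rewrite (_ : (fun y => _) = (fun y => (heat k xi y)%:C * phi y)); last first.
      by apply/funext => y; rewrite mulrC.
    exact: (cintegrableMbounded ih' mp (fun x => schwartz_le x sp)).
  apply: (cintegral_dct (h := fun x => decay_cst phi * modulus (g x))).
  - move=> k; apply: cmeasM => //.
    apply: (cmeas_cintegral ip (e := fun z => (heat k z.2 z.1)%:C) (M := Num.sqrt (k.+1%:R / pi))).
      apply: cmeas_real; apply: measurable_funM => //; apply: measurableT_comp => //.
      apply: measurableT_comp => //; apply: measurable_funM => //; apply: measurable_funX.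
      exact: (measurable_funB measurable_fst measurable_snd).
    move=> z; rewrite modulus_real ger0_norm ?(ltW (heat_gt0 _ _ _))//.
    rewrite /heat ler_piMr ?sqrtr_ge0// /gauss expR_le1 oppr_le0 mulr_ge0 ?sqr_ge0//.
  - exact: cmeasM.
  - by apply: L1Zl; exact: cintegrable_modulus.
  - move=> k xi; rewrite modulusM mulrC ler_wpM2r ?modulus_ge0//.
    apply: (le_trans (modulus_cintegral (ih k xi))).
    rewrite -[leRHS]mulr1 -(Rint_heat k xi) -RintZl; last exact: L1_heat.
    apply: le_Rint; [exact: cintegrable_modulus|by apply: L1Zl; exact: L1_heat|].
    move=> y; rewrite modulusM modulus_real ger0_norm ?(ltW (heat_gt0 _ _ _))//.
    by rewrite ler_wpM2r ?(ltW (heat_gt0 _ _ _))//; exact: schwartz_le.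
  - by move=> xi; rewrite modulusM mulrC ler_wpM2r ?modulus_ge0//; exact: schwartz_le.
  have gp xi : cintegrable (fun y => phi y * (gauss 1 xi y)%:C).
    have i1 : cintegrable (fun y : R => (gauss 1 xi y)%:C).
      by apply: schwartz_cintegrable; exact: schwartz_gauss0.
    rewrite (_ : (fun y => _) = (fun y => (gauss 1 xi y)%:C * phi y)); last first.
      by apply/funext => y; rewrite mulrC.
    exact: (cintegrableMbounded i1 mp (fun x => schwartz_le x sp)).
  have := heat_cvgC mp gp; apply: (@filterS _ _ (ae_filter_ringOfSetsType mu)) => xi hx.
  rewrite (_ : (fun k => _) = (fun k => modulus (g xi) *
    modulus (cintegral (fun y => phi y * (heat k xi y)%:C) - phi xi))); last first.
    by apply/funext => k; rewrite -mulrBr modulusM.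
  by rewrite -[X in _ --> X](mulr0 (modulus (g xi))); apply: cvgM; [exact: cvg_cst|exact: hx].
apply/eqP; rewrite -subr_eq0; apply/eqP; apply: modulus_eq0; apply/eqP.
rewrite eq_le modulus_ge0 andbT; apply/ler_addgt0Pr => e e0; rewrite add0r.
have e2 : 0 < e / 2 by rewrite divr_gt0.
move/cvgrPdist_le : hA => /(_ _ e2) [k1 _ h1]; move/cvgrPdist_le : hB => /(_ _ e2) [k2 _ h2].
have {}h1 := h1 (maxn k1 k2) (leq_maxl _ _); have {}h2 := h2 (maxn k1 k2) (leq_maxr _ _).
rewrite /= sub0r normrN ger0_norm ?modulus_ge0// in h1.
rewrite /= sub0r normrN ger0_norm ?modulus_ge0// in h2.
set I1 := cintegral _ in h1 *; set I2 := cintegral _ in h2 *.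
rewrite (_ : I1 - I2 = (A (maxn k1 k2) - I2) - (A (maxn k1 k2) - I1)); last by ring.
apply: (le_trans (modulusD _ _)); rewrite modulusN.
by rewrite [leRHS](splitr e) addrC; exact: lerD.
Qed.

End Inversion.

(** * Wave packets and the necessity of the condition *)

Section PowerEstimates.
Context {R : realType}.

Lemma powR_MVT (p x y : R) : 0 < x -> x <= y ->
  exists2 z, x <= z <= y & y `^ p - x `^ p = p * z `^ (p - 1) * (y - x).
Proof.
move=> x0 xy.
have pos (z : R) : x <= z <= y -> 0 < z by move=> /andP[h _]; exact: lt_le_trans h.
have hd (z : R) : z \in `]x, y[ -> is_derive z (1 : R) (fun z => z `^ p) (p * z `^ (p - 1)).
  by rewrite in_itv/= => /andP[h1 h2]; apply: der_powR; apply: pos; rewrite !ltW.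
have cf : {within `[x, y], continuous (fun z : R => z `^ p)}.
  by apply: cont_within => z hz; exact: (der_cont (der_powR p (pos z hz))).
have [z] := MVT_segment xy hd cf.
by rewrite in_itv/= => hz E; exists z.
Qed.

(** The mean value theorem is used twice. The factor [2^|a - 2|] bounds [(w / lam)^(a - 2)] for an
    intermediate point [w] between [lam] and [2 lam], whatever the sign of [a - 2]. *)
Lemma powR_taylor (a : R) : 0 <= a -> exists2 C : R, 0 <= C & forall lam xi : R, 0 < lam ->
  lam <= xi <= 2 * lam ->
  `|xi `^ a - lam `^ a - a * lam `^ (a - 1) * (xi - lam)| <= C * lam `^ (a - 2) * (xi - lam) ^+ 2.
Proof.
move=> a0; exists (a * `|a - 1| * 2 `^ `|a - 2|).
  by rewrite mulr_ge0 ?powR_ge0// mulr_ge0.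
move=> lam xi lam0 /andP[h1 h2].
have [z /andP[z1 z2] ->] := powR_MVT a lam0 h1.
have [w /andP[w1 w2] E] := powR_MVT (a - 1) lam0 z1.
have -> : a * z `^ (a - 1) * (xi - lam) - a * lam `^ (a - 1) * (xi - lam) =
    a * (z `^ (a - 1) - lam `^ (a - 1)) * (xi - lam) by ring.
rewrite E (_ : a - 1 - 1 = a - 2); last by ring.
have wl : w `^ (a - 2) <= 2 `^ `|a - 2| * lam `^ (a - 2).
  have q1 : 1 <= w / lam by rewrite ler_pdivlMr// mul1r.
  have q2 : w / lam <= 2 by rewrite ler_pdivrMr// (le_trans w2)// (le_trans z2).
  have q0 : 0 <= w / lam := le_trans ler01 q1.
  have -> : w `^ (a - 2) = (w / lam) `^ (a - 2) * lam `^ (a - 2).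
    by rewrite -powRM ?(ltW lam0)// divfK// gt_eqF.
  apply: ler_wpM2r; first exact: powR_ge0.
  apply: (@le_trans _ _ ((w / lam) `^ `|a - 2|)); first by apply: ler_powR => //; exact: ler_norm.
  by apply: ge0_ler_powR; rewrite ?nnegrE.
rewrite !normrM (ger0_norm a0) (ger0_norm (powR_ge0 _ _)).
rewrite (ger0_norm (_ : 0 <= z - lam)) ?subr_ge0// (ger0_norm (_ : 0 <= xi - lam)) ?subr_ge0//.
have zx : z - lam <= xi - lam by rewrite lerD2r.
have z0 : 0 <= z - lam by rewrite subr_ge0.
rewrite expr2 -!mulrA; apply: ler_wpM2l => //; apply: ler_wpM2l => //.
rewrite [leRHS]mulrA; apply: ler_pM; rewrite ?powR_ge0//.
  by rewrite mulr_ge0// subr_ge0.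
by apply: ler_wpM2r; rewrite // subr_ge0.
Qed.

(** All indices lie between [N] and [2 N], where the derivative of the time has modulus at least
    [gamma * (2 N)^(- gamma - 1)]; distinct indices differ by at least one. *)
Lemma time_gap (gamma : R) (N i j : nat) : 0 < gamma -> (i < j < N)%N ->
  gamma * (2 * N%:R) `^ (- gamma - 1) <= time gamma (N + i.+1) - time gamma (N + j.+1).
Proof.
move=> g0 ijN; have [n0 nm mN] : [/\ 0 < N + i.+1, N + i.+1 < N + j.+1 & N + j.+1 <= 2 * N]%N.
  by split; lia.
move: n0 nm mN; set n := (N + i.+1)%N; set m := (N + j.+1)%N => n0 nm mN; have n0' : 0 < n%:R :> R by rewrite ltr0n.
have nm' : n%:R <= m%:R :> R by rewrite ler_nat ltnW.
have [z /andP[z1 z2] E] := powR_MVT (- gamma) n0' nm'.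
have z0 : 0 < z := lt_le_trans n0' z1.
rewrite /time -[leRHS]opprB E.
have -> : - (- gamma * z `^ (- gamma - 1) * (m%:R - n%:R)) =
    gamma * (z `^ (- gamma - 1) * (m%:R - n%:R)) by ring.
apply: ler_wpM2l; first exact: ltW.
have mn1 : 1 <= m%:R - n%:R :> R by rewrite lerBrDl natr1 ler_nat.
apply: (@le_trans _ _ (z `^ (- gamma - 1))); last by rewrite ler_peMr// powR_ge0.
have g1 : 0 <= gamma + 1 by rewrite addr_ge0// ltW.
rewrite (_ : - gamma - 1 = - (gamma + 1)); last by ring.
have zN : z <= 2 * N%:R by rewrite (le_trans z2)// -natrM ler_nat.
rewrite !powRN lef_pV2 ?posrE ?powR_gt0//; last exact: lt_le_trans zN.
by apply: ge0_ler_powR; rewrite ?nnegrE ?(ltW z0)// (le_trans (ltW z0)).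
Qed.

End PowerEstimates.

Section BandFunction.
Context {R : realType}.
Local Notation mu := (@lebesgue_measure R).

Definition band (lam rho : R) (xi : R) : R := \1_(`[lam, lam + rho]) xi.

Lemma bandE lam rho xi : band lam rho xi = (lam <= xi <= lam + rho)%R%:R.
Proof. by rewrite /band indicE mem_setE in_itv. Qed.

Lemma band_ge0 lam rho xi : 0 <= band lam rho xi.
Proof. by rewrite bandE. Qed.

Lemma band_le1 lam rho xi : band lam rho xi <= 1.
Proof. by rewrite bandE; case: (_ <= _ <= _). Qed.

Lemma sqr_band lam rho xi : band lam rho xi ^+ 2 = band lam rho xi.
Proof. by rewrite bandE; case: (_ <= _ <= _); rewrite ?expr1n ?expr0n. Qed.

Lemma L1_band lam rho : L1 (band lam rho).
Proof.
have := @L1_restrict R (fun=> 1) lam (lam + rho) (fun x _ => @cont_cst R 1 x).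
by congr (L1 _); apply/funext => x; rewrite mul1r.
Qed.

Lemma Rint_band lam rho : 0 <= rho -> \int[mu]_x band lam rho x = rho.
Proof.
move=> r0; have := @Rint_restrict R (fun=> 1) lam (lam + rho).
rewrite Rintegral_cst//= lebesgue_measure_itv/= lte_fin mul1r.
under [X in _ = X]eq_Rintegral do rewrite mul1r.
move=> <-; move: r0; rewrite le_eqVlt => /predU1P[<-|r0]; first by rewrite addr0 ltxx.
by rewrite ltrDl r0 -EFinD /= addrAC subrr add0r.
Qed.

Definition cband (lam rho : R) (xi : R) : R[i] := (band lam rho xi)%:C.

Lemma cintegrable_cband lam rho : cintegrable (cband lam rho).
Proof. by split; rewrite /re /im /=; [exact: L1_band|exact: L1_0]. Qed.

Lemma modulus_cband lam rho xi : modulus (cband lam rho xi) = band lam rho xi.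
Proof. by rewrite modulus_real ger0_norm// band_ge0. Qed.

(** Phases within [1 / 4] of [th] change each exponential by at most [1 / 2], so at least half of
    the fully coherent value [rho] remains. *)
Lemma wave_cband_ge (a lam rho t x th : R) : 0 < lam -> 0 < rho ->
  (forall xi, lam <= xi <= lam + rho ->
    `|(x * xi + t * xi `^ a) - th| <= 4^-1) ->
  rho / 2 <= modulus (wave a (cband lam rho) t x).
Proof.
move=> lam0 rho0 hth; have ig := cintegrable_cband lam rho.
have i1 := cintegrable_wave a t x ig.
have i2 : cintegrable (fun xi => cis th * cband lam rho xi) by exact: cintegrableZ.
have E : cintegral (fun xi => cis th * cband lam rho xi) = cis th * rho%:C.
  by rewrite cintegralZ// cintegral_real Rint_band// ltW.
have d : modulus (wave a (cband lam rho) t x - cis th * rho%:C) <= rho / 2.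
  rewrite -E /wave -cintegralB//.
  apply: (le_trans (modulus_cintegral (cintegrableB i1 i2))).
  have -> : rho / 2 = \int[mu]_xi (2^-1 * band lam rho xi).
    by rewrite (RintZl _ (L1_band lam rho)) (Rint_band _ (ltW rho0)) mulrC.
  apply: le_Rint.
  - by apply: cintegrable_modulus; exact: cintegrableB.
  - by apply: L1Zl; exact: L1_band.
  move=> xi; rewrite [cis th * _]mulrC -mulrBr modulusM modulus_cband mulrC bandE.
  have [h|_] := boolP (lam <= xi <= lam + rho); last by rewrite !mulr0.
  rewrite !mulr1; apply: (le_trans (modulus_cisB _ _)).
  have xi0 : 0 < xi by move: h => /andP[h _]; exact: lt_le_trans h.
  by have := hth xi h; rewrite (ger0_norm (ltW xi0)); lra.
have m : modulus (cis th * rho%:C) = rho by rewrite modulusM modulus_cis mul1r modulus_real ger0_norm// ltW.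
have := modulus_dist (wave a (cband lam rho) t x) (cis th * rho%:C).
rewrite m distrC => /(le_trans (ler_norm _)) => h; lra.
Qed.

End BandFunction.

Section Necessity.
Context {R : realType}.
Local Notation mu := (@lebesgue_measure R).
Variables (gamma a s C : R).
Hypotheses (gamma0 : 0 < gamma) (a0 : 0 < a) (s0 : 0 < s) (C0 : 0 < C).
Hypothesis maximal_ineq :
  forall (f : @schwartz_functional R) (fhat : R -> R[i]) (u : nat -> R -> R[i]),
    in_sobolev s f fhat ->
    (forall n : nat, (1 <= n)%N -> schrodinger_mean a (n%:R `^ (- gamma)) f (u n)) ->
    ('N[mu]_(2%:E) [maximal_fun u] <= C%:E * sobolev_norm s fhat)%E.

Let packet (lam rho : R) (n : nat) : R -> R[i] :=
  inv_fourier (fun xi => cis (time gamma n * `|xi| `^ a) * cband lam rho xi).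

Let cintegrable_packet lam rho t :
  cintegrable (fun xi => cis (t * `|xi| `^ a) * cband lam rho xi).
Proof.
rewrite (_ : (fun xi => _) = (fun xi => cband lam rho xi * cis (t * `|xi| `^ a))); last first.
  by apply/funext => xi; rewrite mulrC.
apply: (cintegrableMbounded (cintegrable_cband lam rho) (M := 1)).
  by apply: cmeas_cis; apply: measurable_funM => //; exact: measurable_om.
by move=> xi; rewrite modulus_cis.
Qed.

Let packet_le1 lam rho t xi : modulus (cis (t * `|xi| `^ a) * cband lam rho xi) <= 1.
Proof. by rewrite modulusM modulus_cis mul1r modulus_cband band_le1. Qed.

Let cband_le1 lam rho xi : modulus (cband lam rho xi) <= 1 :> R.
Proof. by rewrite modulus_cband band_le1. Qed.

Let mean_packet lam rho n :
  schrodinger_mean a (n%:R `^ (- gamma)) (dist_of_fun (inv_fourier (cband lam rho))) (packet lam rho n).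
Proof.
have ip := cintegrable_packet lam rho (time gamma n); split.
- exact: (tempered_inv_fourier ip).
- exact: (represented_inv_fourier ip).
exists (cband lam rho).
  exact: (has_fourier_inv_fourier (cintegrable_cband lam rho) (cband_le1 lam rho)).
exact: (has_fourier_inv_fourier ip (packet_le1 lam rho _)).
Qed.

Let modulus_packet lam rho n x :
  modulus (packet lam rho n x) = (2 * pi)^-1 * modulus (wave a (cband lam rho) (time gamma n) x).
Proof.
rewrite /packet /inv_fourier modulusM modulus_real ger0_norm ?invr_ge0 ?mulr_ge0 ?pi_ge0//.
congr (_ * modulus (cintegral _)); apply/funext => xi; rewrite cisD; ring.
Qed.

Let energy (lam rho : R) : \bar R :=
  (\int[mu]_xi (((1 + `|xi| ^+ 2) `^ s) * modulus (cband lam rho xi) ^+ 2)%:E)%E.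

(** On the band [xi <= 2 lam], and [lam >= 1], so [1 + xi^2 <= 5 lam^2]. *)
Let energy_le lam rho : 1 <= lam -> 0 < rho -> rho <= lam ->
  (energy lam rho <= ((5 * lam ^+ 2) `^ s * rho)%:E)%E.
Proof.
move=> lam1 rho0 rl; have lam0 : 0 < lam := lt_le_trans ltr01 lam1.
have mW := @measurable_sobolev_weight R s.
have mb : measurable_fun setT (band lam rho) by exact: L1_meas (L1_band lam rho).
apply: (@le_trans _ _ (\int[mu]_xi ((5 * lam ^+ 2) `^ s * band lam rho xi)%:E)%E).
  apply: le_Ie.
  - apply: measurable_funM => //; apply: measurable_funX; apply: measurable_modulus.
    exact: cintegrable_meas (cintegrable_cband lam rho).
  - exact: measurable_funM.
  - by move=> xi; rewrite mulr_ge0 ?powR_ge0 ?sqr_ge0.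
  move=> xi; rewrite modulus_cband sqr_band bandE.
  have [/andP[h1 h2]|_] := boolP (lam <= xi <= lam + rho); last by rewrite !mulr0.
  rewrite !mulr1; have xi0 : 0 < xi := lt_le_trans lam0 h1.
  have x2 : xi <= 2 * lam by lra.
  rewrite (ger0_norm (ltW xi0)); apply: ge0_ler_powR; rewrite ?nnegrE ?(ltW s0)//.
  - by rewrite addr_ge0 ?sqr_ge0.
  - by rewrite mulr_ge0 ?sqr_ge0.
  - nra.
rewrite -L1_fineK; last by apply: L1Zl; exact: L1_band.
by rewrite lee_fin RintZl ?Rint_band ?(ltW rho0)//; exact: L1_band.
Qed.

(* Each packet is large near its own centre [z i]; since these neighbourhoods are disjoint, the
   maximal function picks up the mass of all [N] of them. *)
Let packing lam rho (c d : R) (N : nat) (z : nat -> R) : 0 <= c -> 0 <= d -> 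
  (forall i j, (i < j < N)%N -> 2 * d < `|z i - z j|) ->
  (forall i x, (i < N)%N -> `|x - z i| <= d -> c <= modulus (packet lam rho (N + i.+1) x)) ->
  ((c ^+ 2 * (2 * d * N%:R))%:E <= \int[mu]_x (`|maximal_fun (packet lam rho) x| `^ 2))%E.
Proof.
move=> c0 d0 zd hc; set u := packet lam rho.
have mu1 n : (1 <= n)%N -> cmeas (u n) by move=> _; exact: cmeas_inv_fourier (cintegrable_packet _ _ _).
have mmax := measurable_maximal mu1.
pose F (i : 'I_N) x : R := c ^+ 2 * band (z i - d) (2 * d) x.
have mF i : measurable_fun setT (F i).
  by apply: measurable_funM => //; exact: L1_meas (L1_band _ _).
have F0 i x : 0 <= F i x by rewrite mulr_ge0 ?sqr_ge0 ?band_ge0.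
have E : ((c ^+ 2 * (2 * d * N%:R))%:E = \int[mu]_x (\sum_(i < N) F i x)%:E)%E.
  rewrite (Ie_sum _ mF F0).
  have EF i : (\int[mu]_x (F i x)%:E = (c ^+ 2 * (2 * d))%:E)%E.
    rewrite -L1_fineK; last by apply: L1Zl; exact: L1_band.
    by rewrite (RintZl _ (L1_band _ _)) Rint_band// mulr_ge0.
  rewrite (eq_bigr (fun=> (c ^+ 2 * (2 * d))%:E)) => [|i _]; last exact: EF.
  by rewrite sumEFin sumr_const card_ord -(mulr_natr (c ^+ 2 * (2 * d)) N); congr (_%:E); ring.
rewrite E; apply: ge0_le_integral => //.
- by move=> x _; rewrite lee_fin sumr_ge0.
- apply/measurable_EFinP; apply: measurable_sum => i; exact: mF.
- have ma : measurable_fun setT (fun x => `|maximal_fun u x|%E) by exact: measurableT_comp.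
  exact: (measurableT_comp (measurable_poweR 2) ma).
move=> x _.
have inband i : (z i - d <= x <= z i - d + 2 * d) = (`|x - z i| <= d).
  by rewrite ler_norml; apply/idP/idP => /andP[h1 h2]; apply/andP; split; lra.
have [[i hi]|none] := pselect (exists i : 'I_N, `|x - z i| <= d); last first.
  rewrite big1 ?poweR_ge0// => i _; rewrite /F bandE inband.
  by case: (boolP (`|x - z i| <= d)) => h; rewrite ?mulr0//; exfalso; apply: none; exists i.
have hi' := hc i x (ltn_ord i) hi.
have max_ge : ((modulus (u (N + i.+1)%N x))%:E <= `|maximal_fun u x|)%E.
  apply: (le_trans _ (lee_abs _)); apply: ereal_sup_ubound; exists (N + i.+1)%N => //=.
  by rewrite addnS.
rewrite (bigD1 i)//= big1 ?addr0; last first.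
  move=> j ji; rewrite /F bandE inband; case: (boolP (`|x - z j| <= d)) => hj; rewrite ?mulr0//; exfalso.
  have far : `|z i - z j| <= 2 * d.
    rewrite (_ : z i - z j = (x - z j) - (x - z i)); last by ring.
    by apply: (le_trans (ler_normB _ _)); lra.
  have : 2 * d < `|z i - z j|.
    move: ji; rewrite -val_eqE neq_ltn => /orP[h|h]; last by apply: zd; rewrite h ltn_ord.
    by rewrite distrC; apply: zd; rewrite h ltn_ord.
  by rewrite ltNge far.
rewrite /F bandE inband hi mulr1.
apply: (@le_trans _ _ ((modulus (u (N + i.+1)%N x))%:E `^ 2)%E).
  rewrite poweR_EFin lee_fin powR_mulrn ?modulus_ge0//.
  by rewrite lerXn2r ?nnegrE ?modulus_ge0.
apply: gt0_ler_poweR => //; rewrite ?in_itv/= ?leey ?andbT ?lee_fin ?modulus_ge0//.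
Qed.

Let packet_ineq lam rho (L : R) : 1 <= lam -> 0 < rho -> rho <= lam -> 0 <= L ->
  (L%:E <= \int[mu]_x (`|maximal_fun (packet lam rho) x| `^ 2))%E ->
  L <= C ^+ 2 * ((5 * lam ^+ 2) `^ s * rho).
Proof.
move=> lam1 rho0 rl L0 hL; set S0 := (_ `^ s * rho).
have S00 : 0 <= S0 by rewrite mulr_ge0 ?powR_ge0// ltW.
have he : (energy lam rho <= S0%:E)%E := energy_le lam1 rho0 rl.
have e0 : (0 <= energy lam rho)%E by apply: Ie_ge0 => xi; rewrite mulr_ge0 ?powR_ge0 ?sqr_ge0.
have hsob : in_sobolev s (dist_of_fun (inv_fourier (cband lam rho))) (cband lam rho).
  split.
  - exact: (tempered_inv_fourier (cintegrable_cband lam rho)).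
  - exact: (has_fourier_inv_fourier (cintegrable_cband lam rho) (cband_le1 lam rho)).
  - by apply: poweR_lty; apply: (le_lt_trans he); rewrite ltry.
have := maximal_ineq hsob (fun n _ => mean_packet lam rho n).
rewrite unlock /sobolev_norm -/(energy lam rho) => H.
have half0 : 0 <= 2^-1 :> R by rewrite invr_ge0.
have h1 : ((L%:E) `^ 2^-1 <= C%:E * (S0%:E) `^ 2^-1)%E.
  apply: (@le_trans _ _ ((\int[mu]_x (`|maximal_fun (packet lam rho) x| `^ 2)) `^ 2^-1)%E).
    apply: gt0_ler_poweR => //; rewrite ?in_itv/= ?leey ?andbT ?lee_fin//.
    by apply: integral_ge0 => x _; exact: poweR_ge0.
  apply: (le_trans H); apply: lee_wpmul2l; first by rewrite lee_fin ltW.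
  by apply: gt0_ler_poweR => //; rewrite ?in_itv/= ?leey ?andbT ?lee_fin.
move: h1; rewrite !poweR_EFin -EFinM lee_fin !powR12_sqrt// => h1.
rewrite -(sqr_sqrtr L0) -(sqr_sqrtr S00) -exprMn lerXn2r ?nnegrE ?sqrtr_ge0//.
by rewrite mulr_ge0 ?sqrtr_ge0// ltW.
Qed.

Let growth : exists2 K : R, 0 < K & forall N : nat, (0 < N)%N ->
  N%:R <= K * N%:R `^ ((gamma + 2) / a * (2 * s)).
Proof.
have [T T0 hT] := powR_taylor (ltW a0).
(* Small enough that the quadratic phase error [T * kap^2] is at most [1 / 8]. *)
pose kap : R := (8 * (1 + T))^-1.
have T1 : 0 < 1 + T by rewrite ltr_pwDl.
have kap0 : 0 < kap by rewrite invr_gt0 mulr_gt0.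
have kap8 : kap * (8 * (1 + T)) = 1 by rewrite mulVf// mulf_neq0 ?gt_eqF.
have kap1 : kap <= 8^-1.
  rewrite lef_pV2 ?posrE ?mulr_gt0//; by rewrite ler_peMr// lerDl.
have Tkap : T * kap ^+ 2 <= 8^-1.
  have : T * kap <= 8^-1 by nra.
  nra.
pose b : R := a * gamma * 2 `^ (- gamma - 1) * kap.
have b0 : 0 < b by rewrite !mulr_gt0// powR_gt0.
(* Satisfies both [del <= 1 / 8], the allowance for the linear phase error, and [2 * del < b], where
   [b / rho] will be the distance between centres. *)
pose del : R := b / (4 + 8 * b).
have den0 : 0 < 4 + 8 * b by rewrite addr_gt0// mulr_gt0.
have del0 : 0 < del by rewrite divr_gt0.
have del8 : del <= 8^-1 by rewrite ler_pdivrMr//; lra.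
have delb : 2 * del < b.
  rewrite /del mulrA ltr_pdivrMr//; have : 0 < b * b by rewrite mulr_gt0.
  lra.
have [q [q0 qE]] : exists q : R, 0 < q /\ pi = q by exists pi; split => //; exact: pi_gt0.
have qn : q != 0 by rewrite gt_eqF.
have deln : del != 0 by rewrite gt_eqF.
have kapn : kap != 0 by rewrite gt_eqF.
exists (C ^+ 2 * 5 `^ s * (8 * q ^+ 2) / del).
  by rewrite divr_gt0// mulr_gt0 ?mulr_gt0 ?powR_gt0 ?exprn_gt0.
move=> N N0; pose X : R := N%:R.
have X1 : 1 <= X by rewrite ler1n.
have X0 : 0 < X := lt_le_trans ltr01 X1.
pose lam : R := X `^ ((gamma + 2) / a).
have g2 : 0 < gamma + 2 by rewrite addr_gt0.
have lam1 : 1 <= lam.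
  by rewrite -(powRr0 X); apply: ler_powR => //; rewrite divr_ge0// ltW.
have lam0 : 0 < lam := lt_le_trans ltr01 lam1.
have lama : lam `^ a = X `^ (gamma + 2) by rewrite -powRrM divfK// gt_eqF.
(* Since [lam^a = X^(gamma + 2)] and the times are at most [X^(- gamma)], the second-order error
   [t * T * lam^(a - 2) * rho^2] is at most [T * kap^2]. *)
pose rho : R := kap * lam / X.
have rho0 : 0 < rho by rewrite divr_gt0// mulr_gt0.
have rl : rho <= lam.
  rewrite ler_pdivrMr// mulrC ler_pM2l//; apply: le_trans X1; apply: (le_trans kap1).
  by rewrite invf_le1// ler1n.
have rX : rho * X = kap * lam by rewrite divfK// gt_eqF.
have X2 : X `^ (gamma + 2) = X `^ gamma * X ^+ 2.
  by rewrite powRD ?(gt_eqF X0) ?implybT// powR_mulrn// ltW.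
have lam_m1 : lam `^ (a - 1) = X `^ gamma * X ^+ 2 / lam.
  by rewrite powRD ?(gt_eqF lam0) ?implybT// lama X2 powR_inv1// ltW.
have lam_m2 : lam `^ (a - 2) = X `^ gamma * X ^+ 2 / lam ^+ 2.
  by rewrite powRD ?(gt_eqF lam0) ?implybT// lama X2 powR_invn// ltW.
have lamn : lam != 0 by rewrite gt_eqF.
have Xn : X != 0 by rewrite gt_eqF.
have rhon : rho != 0 by rewrite gt_eqF.
have Xg0 : 0 < X `^ gamma by rewrite powR_gt0.
(* The point where the derivative of the phase at [xi = lam] vanishes, that is, the position reached
   by moving with the group velocity. *)
pose z i := - (time gamma (N + i.+1) * (a * lam `^ (a - 1))).
pose c : R := (2 * q)^-1 * (rho / 2).
have c0 : 0 <= c by apply: mulr_ge0; [rewrite invr_ge0 mulr_ge0// ltW|rewrite divr_ge0// ltW].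
have d0 : 0 <= del / rho by rewrite divr_ge0 ?ltW.
have timeX i : time gamma (N + i.+1) <= (X `^ gamma)^-1.
  by rewrite -powRN; apply: ltW; apply: time_lt => //; rewrite addnS ltnS leq_addr.
have sep i j : (i < j < N)%N -> 2 * (del / rho) < `|z i - z j|.
  move=> ijN; have gap := time_gap gamma0 ijN; rewrite -/X in gap.
  have al0 : 0 <= a * lam `^ (a - 1) by rewrite mulr_ge0 ?powR_ge0// ltW.
  have -> : z i - z j = - ((time gamma (N + i.+1) - time gamma (N + j.+1)) * (a * lam `^ (a - 1))).
    by rewrite /z; ring.
  rewrite normrN; apply: lt_le_trans (ler_norm _).
  apply: lt_le_trans (ler_wpM2r al0 gap).
  have -> : gamma * (2 * X) `^ (- gamma - 1) * (a * lam `^ (a - 1)) = b / rho.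
    rewrite powRM ?(ltW X0)// (_ : X `^ (- gamma - 1) = (X `^ gamma)^-1 / X); last first.
      by rewrite powRD ?(gt_eqF X0) ?implybT// powRN powR_inv1// ltW.
    rewrite lam_m1 /b /rho; field.
    by rewrite !gt_eqF.
  by rewrite mulrA ltr_pM2r// invr_gt0.
have large i x : (i < N)%N -> `|x - z i| <= del / rho ->
    c <= modulus (packet lam rho (N + i.+1) x).
  move=> iN hx; rewrite modulus_packet qE /c; apply: ler_wpM2l.
    by rewrite invr_ge0 mulr_ge0// ltW.
  set t := time gamma (N + i.+1).
  have t0 : 0 <= t by exact: powR_ge0.
  apply: (@wave_cband_ge R a lam rho t x (x * lam + t * lam `^ a)) => // xi /andP[xi1 xi2].
  have xil : lam <= xi <= 2 * lam by rewrite xi1/=; lra.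
  have := hT lam xi lam0 xil; set E := xi `^ a - _ - _ => hE.
  have -> : x * xi + t * xi `^ a - (x * lam + t * lam `^ a) =
      (x - z i) * (xi - lam) + t * E by rewrite /E /z -/t; ring.
  apply: (le_trans (ler_normD _ _)).
  have xr : xi - lam <= rho by lra.
  have x0 : 0 <= xi - lam by rewrite subr_ge0.
  have p1 : `|(x - z i) * (xi - lam)| <= del.
    rewrite normrM (ger0_norm x0) -[leRHS](divfK rhon); exact: ler_pM.
  have p2 : `|t * E| <= T * kap ^+ 2.
    rewrite normrM (ger0_norm t0).
    apply: (@le_trans _ _ ((X `^ gamma)^-1 * (T * lam `^ (a - 2) * rho ^+ 2))).
      apply: ler_pM => //; first exact: timeX.
      apply: (le_trans hE); apply: ler_wpM2l; first by rewrite mulr_ge0 ?powR_ge0.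
      by rewrite lerXn2r ?nnegrE// ltW.
    rewrite le_eqVlt; apply/orP; left; apply/eqP; rewrite lam_m2 /rho; field.
    by rewrite !gt_eqF.
  lra.
have P := packing c0 d0 sep large.
have L0 : 0 <= c ^+ 2 * (2 * (del / rho) * X).
  exact: (mulr_ge0 (sqr_ge0 _) (mulr_ge0 (mulr_ge0 (ler0n _ 2) d0) (ltW X0))).
have {}P := packet_ineq lam1 rho0 rl L0 P.
have E1 : c ^+ 2 * (2 * (del / rho) * X) = X * (del * rho / (8 * q ^+ 2)).
  by rewrite /c; field; rewrite ?qn ?rhon.
have W0 : 0 < del * rho / (8 * q ^+ 2) by apply: divr_gt0; [exact: mulr_gt0|rewrite mulr_gt0// exprn_gt0].
have E2 : (5 * lam ^+ 2) `^ s = 5 `^ s * X `^ ((gamma + 2) / a * (2 * s)).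
  rewrite powRM ?sqr_ge0//; congr (_ * _).
  by rewrite [RHS]powRrM -/lam powRrM (powR_mulrn 2)// ltW.
(* The mass of the maximal function and the energy are both proportional to [rho], which cancels and
   leaves a comparison of powers of [N]. *)
rewrite E1 E2 in P; rewrite -(ler_pM2r W0); apply: (le_trans P).
rewrite le_eqVlt; apply/orP; left; apply/eqP; field.
by rewrite ?qn ?deln ?rhon.
Qed.

(** A smaller [s] would make the exponent [e] in [growth] less than one, and [N <= K * N^e] fails as
    soon as [N] exceeds [K^(1 / (1 - e))]. *)
Lemma maximal_necessary : a / (2 * gamma + 4) <= s.
Proof.
have [K K0 hK] := growth; rewrite leNgt; apply/negP => hs.
pose e : R := (gamma + 2) / a * (2 * s).
have g4 : 0 < 2 * gamma + 4 by rewrite addr_gt0// mulr_gt0.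
have e1 : 0 < 1 - e.
  rewrite subr_gt0 /e mulrAC ltr_pdivrMr// mul1r; move: hs; rewrite ltr_pdivlMr//; lra.
pose Y : R := K `^ (1 - e)^-1.
pose N := (Num.bound Y).+1.
have YN : Y < N%:R.
  apply: (lt_trans (archi_boundP (powR_ge0 _ _))); by rewrite ltr_nat.
have N0 : 0 < N%:R :> R by rewrite ltr0n.
have KN : K < N%:R `^ (1 - e).
  have -> : K = Y `^ (1 - e) by rewrite /Y -powRrM mulVf ?gt_eqF// powRr1// ltW.
  by apply: gt0_ltr_powR; rewrite ?nnegrE ?powR_ge0 ?(ltW N0).
have := hK N isT; rewrite leNgt => /negP; apply.
rewrite [ltRHS](_ : _ = N%:R `^ (1 - e) * N%:R `^ e); last first.
  by rewrite -powRD ?(gt_eqF N0) ?implybT// subrK powRr1// ltW.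
by rewrite ltr_pM2r// powR_gt0.
Qed.

End Necessity.

Theorem corollary1p5 (R : realType) (gamma a s : R)
    (gamma_gt0 : 0 < gamma) (a_gt0 : 0 < a) (a_neq1 : a != 1) (s_gt0 : 0 < s) :
  (exists2 C : R, 0 < C &
     forall (f : @schwartz_functional R) (fhat : R -> R[i]) (u : nat -> R -> R[i]),
       in_sobolev s f fhat ->
       (forall n : nat, (1 <= n)%N ->
          schrodinger_mean a (n%:R `^ (- gamma)) f (u n)) ->
       ('N[@lebesgue_measure R]_(2%:E) [maximal_fun u]
          <= C%:E * sobolev_norm s fhat)%E)
  <-> a / (2 * gamma + 4) <= s.
Proof.
split=> [[C C0 H]|hs]; first exact: (maximal_necessary gamma_gt0 a_gt0 s_gt0 C0 H).
exact: (maximal_bound gamma_gt0 a_gt0 a_neq1 s_gt0 hs).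
Qed.
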